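(* Let $X\subseteq\{1,2,3\}^{\mathbb N}$ and $Y\subseteq\{1,2\}^{\mathbb N}$ be irreducible shifts of finite type such that $Y$ is the full shift or has transition matrix $\begin{pmatrix}0&1\\1&1\end{pmatrix}$. Let $\pi:X\to Y$ be a one-block factor map with $\pi(1)=1$, $\pi(2)=\pi(3)=2$. Let $f:X\to\mathbb R$ be a function of two coordinates and let $\mathcal G=\{\log g_n\}_{n=1}^\infty$ be the sequence on $Y$ associated to the relative pressure function $P(\sigma_X,\pi,f)$. Let $M$ and $M_{22}\vert_{\pi^{-1}(22)}$ be the matrices associated with $f$. Then the following hold. (i) The sequence $\mathcal G$ is almost additive if and only if there exists a Borel measurable function $\hat g$ on $Y$, for which there exists a unique invariant Gibbs measure, with the property $$\lim_{n\to\infty}\frac1n\|\log g_n-S_n\hat g\|_\infty=0.\qquad(a)$$ If $\mathcal G$ is merely weakly almost additive, then there exists a Borel measurable function $\hat g$ on $Y$ satisfying (a) for which there is a unique invariant weak Gibbs measure. (ii) Suppose that either $M_{22}\vert_{\pi^{-1}(22)}$ is not of the form $\begin{pmatrix}0 & a_1 \\ a_2 & 0\end{pmatrix}$ with $a_1,a_2>0$; or $M_{22}\vert_{\pi^{-1}(22)}=\begin{pmatrix}0 & a_1 \\ a_1 & 0\end{pmatrix}$ for some $a_1>0$ and $M$ satisfies $M(2,1)=M(3,1)$ or $M(1,2)=M(1,3)$. Then (i) holds for $\hat g\in C(Y)$, i.e. both assertions of (i) hold with ''Borel measurable function $\hat g$ on $Y$'' replaced by ''$\hat g\in C(Y)$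''.
   Context: For a $k\times k$ zero-one matrix $A=(a_{ij})$, the shift of finite type with transition matrix $A$ is $X_A=\{x\in\{1,\dots,k\}^{\mathbb N}:a_{x_nx_{n+1}}=1\ \forall n\}$ with the shift $(\sigma x)_i=x_{i+1}$. A subshift $X$ is irreducible if for all allowable words $u,v\in B(X)$ there is $w\in B(X)$ with $uwv\in B(X)$ ($B(X)$ is the set of all finite blocks of $X$, including the empty word); $[x_1\dots x_n]$ denotes a cylinder set. A factor map $\pi:X\to Y$ is a continuous surjection with $\pi\circ\sigma_X=\sigma_Y\circ\pi$; it is one-block if it is induced letterwise by a map on symbols (also denoted $\pi$ and applied to words). $S_ng=\sum_{i=0}^{n-1}g\circ\sigma^i$; $\|\cdot\|_\infty$ is the supremum norm. $f$ is a function of two coordinates if $f(x)$ depends only on $x_1x_2$; write $f[ij]=f(x)$ for $x\in[ij]$. With $A=(a_{ij})$ the $3\times3$ transition matrix of $X$, $M$ is the $3\times 3$ matrix with entries $M(i,j)=e^{f[ij]}a_{ij}$ (zero if $a_{ij}=0$), and $M_{22}\vert_{\pi^{-1}(22)}=(M(i,j))_{i,j\in\{2,3\}}$. For $y\in Y$, $g_n(y)=\sup_{E_n(y)}\sum_{x\in E_n(y)}e^{(S_nf)(x)}$, the supremum being over sets $E_n(y)$ consisting of exactly one point from each cylinder $[x_1\dots x_n]$ of $X$ with $\pi(x_1\dots x_n)=y_1\dots y_n$; $\mathcal G=\{\log g_n\}_{n\ge1}$ is the sequence associated to $P(\sigma_X,\pi,f)$. A sequence $\{\log f_n\}$ of continuous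 functions ($f_n>0$) is almost additive if there is $C>0$ with $e^{-C}f_n(y)f_m(\sigma^ny)\le f_{n+m}(y)\le e^Cf_n(y)f_m(\sigma^ny)$ for all $y$ and $n,m\in\mathbb N$; weakly almost additive if there are $C_n>0$ with $C_n/n\to0$ such that this holds with $C$ replaced by $C_n$. For a Borel measurable function $g$, an invariant Borel probability measure $m$ is a weak Gibbs measure for $g$ if there are $P\in\mathbb R$ and $C_n>0$ with $\frac1n\log C_n\to0$ such that $\frac1{C_n}\le m[y_1\dots y_n]/e^{-nP+(S_ng)(y)}\le C_n$ for all $y$ and $n$; it is a Gibbs measure for $g$ if one can take $C_n=C$ for all $n$. *)

(* Defs.v *)
From HB Require Import structures.
From mathcomp Require Import all_boot all_order all_algebra.
From mathcomp Require Import all_classical all_reals all_analysis.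

Set Implicit Arguments.
Unset Strict Implicit.
Unset Printing Implicit Defensive.

Import Order.TTheory GRing.Theory Num.Theory.
Import numFieldTopology.Exports.

Local Open Scope classical_set_scope.
Local Open Scope ring_scope.

(* Conventions.  The k symbols 1, ..., k are the ordinals 0, ..., k-1 of 'I_k,
   and a sequence x_1 x_2 ... is stored as x 0, x 1, ...  A shift space is a
   set in the ambient space [symseq k]; functions on a shift space X are
   functions on the ambient space of which only the values on X are used. *)

Definition symseq (k : nat) : Type :=
  prod_topology (fun _ : nat => discrete_topology 'I_k).

HB.instance Definition _ k := Topological.on (symseq k).
HB.instance Definition _ k := Uniform.on (symseq k).
HB.instance Definition _ k :=
  isPointed.Build (symseq k.+1) (fun=> ord0).

(* sequences over the k.+1 symbols of 'I_k.+1, with their Borel sigma-algebra *)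
Definition borel_symseq (k : nat) := g_sigma_algebraType (@open (symseq k.+1)).

Section Shifts.
Context {k : nat}.
Implicit Types (X : set (symseq k)) (x : symseq k) (u v w : seq 'I_k).

Definition shift x : symseq k := fun i => x i.+1.

Definition word x (n : nat) : seq 'I_k := mkseq x n.

Definition cylinder X u : set (symseq k) :=
  [set x | X x /\ word x (size u) = u].

Definition blocks X : set (seq 'I_k) :=
  [set u | exists x n, X x /\ word (iter n shift x) (size u) = u].

Definition irreducible X := forall u v,
  blocks X u -> blocks X v -> exists2 w, blocks X w & blocks X (u ++ w ++ v).

Definition sft (A : 'M[bool]_k) : set (symseq k) :=
  [set x | forall n, A (x n) (x n.+1)].

End Shifts.

Definition factor_map k l (X : set (symseq k)) (Y : set (symseq l))
    (pi : symseq k -> symseq l) :=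
  [/\ {within X, continuous pi}, pi @` X = Y &
      forall x, X x -> pi (shift x) = shift (pi x)].

Definition one_block k l (X : set (symseq k)) (pi : symseq k -> symseq l)
    (p : 'I_k -> 'I_l) :=
  forall x, X x -> forall n, pi x n = p (x n).

Definition golden_mx : 'M[bool]_2 := \matrix_(i, j) ((i != 0) || (j != 0)).

Section Potentials.
Context {R : realType}.

Definition birkhoff k (n : nat) (g : symseq k -> R) (x : symseq k) : R :=
  \sum_(i < n) g (iter i shift x).

Definition two_coordinates k (X : set (symseq k)) (f : symseq k -> R) :=
  forall x x', X x -> X x' -> word x 2 = word x' 2 -> f x = f x'.

(* f[ij], the common value of f on the cylinder [ij] of X; it is only
   meaningful if that cylinder is nonempty *)
Definition two_coord_val k (X : set (symseq k.+1)) (f : symseq k.+1 -> R)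
    (i j : 'I_k.+1) : R :=
  f (get (cylinder X [:: i; j])).

Definition potential_mx k (A : 'M[bool]_k.+1) (f : symseq k.+1 -> R) :
    'M[R]_k.+1 :=
  \matrix_(i, j) (expR (two_coord_val (sft A) f i j) * (A i j)%:R).

(* the rows and columns of M indexed by the symbols 2 and 3 *)
Definition mx22 (M : 'M[R]_3) : 'M[R]_2 := mxsub (lift ord0) (lift ord0) M.

Definition antidiag_mx (a1 a2 : R) : 'M[R]_2 :=
  \matrix_(i, j) if i == j then 0 else if i == 0 then a1 else a2.

(* E is a possible choice of E_n(y) *)
Definition is_section k l (X : set (symseq k)) (p : 'I_k -> 'I_l) (n : nat)
    (y : symseq l) (E : set (symseq k)) :=
  E `<=` [set x | X x /\ map p (word x n) = word y n] /\
  (forall u, size u = n -> cylinder X u !=set0 -> map p u = word y n ->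
     exists! x, E x /\ cylinder X u x).

(* E_n(y) is finite, so the inner sum is an ordinary one; the set of sums is
   bounded above when f is bounded on X *)
Definition relative_g k l (X : set (symseq k)) (p : 'I_k -> 'I_l)
    (f : symseq k -> R) (n : nat) (y : symseq l) : R :=
  sup [set \sum_(x \in E) expR (birkhoff n f x) | E in is_section X p n y].

(* Below, F is a sequence of functions F n > 0, n >= 1, and the properties are
   those of the sequence of logarithms {log F n}. *)

Definition positive_continuous_seq k (Y : set (symseq k))
    (F : nat -> symseq k -> R) :=
  forall n, (0 < n)%N ->
    {within Y, continuous (F n)} /\ forall y, Y y -> 0 < F n y.

Definition almost_additive k (Y : set (symseq k)) (F : nat -> symseq k -> R) :=
  positive_continuous_seq Y F /\
  exists2 C : R, 0 < C & forall y n m, Y y -> (0 < n)%N -> (0 < m)%N ->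
    expR (- C) * (F n y * F m (iter n shift y)) <= F (n + m)%N y <=
    expR C * (F n y * F m (iter n shift y)).

Definition weakly_almost_additive k (Y : set (symseq k))
    (F : nat -> symseq k -> R) :=
  positive_continuous_seq Y F /\
  exists C : nat -> R,
    [/\ forall n, (0 < n)%N -> 0 < C n,
        C n / n%:R @[n --> \oo] --> (0 : R) &
        forall y n m, Y y -> (0 < n)%N -> (0 < m)%N ->
          expR (- C n) * (F n y * F m (iter n shift y)) <= F (n + m)%N y <=
          expR (C n) * (F n y * F m (iter n shift y))].

Local Open Scope ereal_scope.

(* extended-real valued, since a Borel function may be unbounded *)
Definition sup_norm k (Y : set (symseq k)) (h : symseq k -> R) : \bar R :=
  ereal_sup [set `|h y|%:E | y in Y].

Definition log_asymptotic k (Y : set (symseq k)) (F : nat -> symseq k -> R)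
    (g : symseq k -> R) :=
  (n%:R^-1)%:E * sup_norm Y (fun y => ln (F n y) - birkhoff n g y)%R
    @[n --> \oo] --> 0.

Definition borel_on k (Y : set (symseq k.+1)) (g : symseq k.+1 -> R) :=
  measurable_fun (Y : set (borel_symseq k)) (g : borel_symseq k -> R).

Definition invariant_on k (Y : set (symseq k.+1))
    (m : probability (borel_symseq k) R) :=
  m Y = 1 /\
  forall B : set (borel_symseq k), measurable B -> m (shift @^-1` B) = m B.

Local Close Scope ereal_scope.

Definition gibbs_bound k (Y : set (symseq k.+1)) (g : symseq k.+1 -> R)
    (m : probability (borel_symseq k) R) (P : R) (C : nat -> R) :=
  forall y n, Y y -> (0 < n)%N ->
    (C n)^-1 <= fine (m (cylinder Y (word y n)))
                  / expR (- (n%:R * P) + birkhoff n g y) <= C n.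

Definition gibbs k (Y : set (symseq k.+1)) (g : symseq k.+1 -> R)
    (m : probability (borel_symseq k) R) :=
  invariant_on Y m /\
  exists P C : R, 0 < C /\ gibbs_bound Y g m P (fun=> C).

Definition weak_gibbs k (Y : set (symseq k.+1)) (g : symseq k.+1 -> R)
    (m : probability (borel_symseq k) R) :=
  invariant_on Y m /\
  exists (P : R) (C : nat -> R),
    [/\ forall n, (0 < n)%N -> 0 < C n,
        ln (C n) / n%:R @[n --> \oo] --> (0 : R) &
        gibbs_bound Y g m P C].

(* Measures are identified when they agree on Borel sets: a term of type
   [probability] also carries irrelevant values on the other sets. *)
Definition exists_unique_measure k
    (Q : probability (borel_symseq k) R -> Prop) :=
  exists2 m, Q m & forall m', Q m' ->
    forall B : set (borel_symseq k), measurable B -> m' B = m B.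

End Potentials.

(* Main.v *)
From HB Require Import structures.
Require Import Defs.
From mathcomp Require Import all_boot all_order all_algebra.
From mathcomp Require Import all_classical all_reals all_analysis.
From mathcomp Require Import ring lra zify.
Import Order.TTheory GRing.Theory Num.Theory.
Import numFieldTopology.Exports numFieldNormedType.Exports.
Set Implicit Arguments.
Unset Strict Implicit.
Unset Printing Implicit Defensive.
Local Open Scope classical_set_scope.
Local Open Scope ring_scope.

Local Notation shift := Defs.shift.

(** Symbols are numbered from 0: the letter 0 of [Y] has the single preimage 0,
    and the letter 1 has the preimages 1 and 2.

    The symbols of [X] that start a point are the states of a nonnegative matrix
    [K] with entries [expR f[ij]], and [K] is primitive ([live_mx_primitive]):
    irreducibility connects the states, and lifting the periodic points
    [01 01 ..] and [011 011 ..] of [Y] gives loops of lengths 2 and 3 at 0.  Let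
    [lam], [l], [h] be the Perron eigenvalue and eigenvectors of [K].  Cut [K]
    into the two matrices that emit the letters 0 and 1, according to the letter
    of the row.  For a word [w] of length [n], the product of [l], of the
    emission matrices of the letters of [w] and of [h] is the weight of [w].  On
    the one hand it is, up to a bounded factor, the value of [g_n] on the
    cylinder of [w] ([relative_g_bounds]).  On the other hand, divided by
    [lam ^+ n], it is the probability of [w] for the image in [Y] of the
    stationary Markov measure of [K] ([chain_measure]).  So this measure is
    Gibbs, or weak Gibbs, for every function whose Birkhoff sums follow the
    logarithms of the weights up to a bounded, or sublinear, error.

    Such a function comes from renewal.  As 0 has one preimage, weights factor
    at each occurrence of 0 ([weight_renewal]).  Along a run of 1s, [potential]
    takes as values the logarithms of the ratios of the weights of the return
    words with [j] and [j - 1] letters 1, [j] being the number of 1s that remain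
    (the logarithm of the weight itself for [j = 1]); these telescope, and the Birkhoff sums add up the logarithms of the weights
    of the completed returns.  What is left at both ends of a word is controlled
    by almost additivity ([potential_bound]); at the sequence [111..] the value
    is the rate of growth [L] of the weights along it, which exists by almost
    additivity.  The function is locally constant away from [111..], hence Borel.

    Weak Gibbs measures for such a function are unique
    ([follows_weak_gibbs_unique]): the words have the same probabilities for any
    two of them up to subexponential factors.  The law of the chain is upper
    psi-mixing, because the powers of [K] converge to a projection
    ([perron_domination]); comparing exponential moments of the number of visits
    to a word then shows that a stationary law dominated by it up to
    subexponential factors is equal to it ([subexp_dominated_eq]).

    Conversely, if a function [g] has a Gibbs measure, then [g] is bounded and
    its Birkhoff sums vary by a bounded amount on cylinders.  If these sums are
    asymptotic to [log g_n], then along a periodic point through 0 the sum of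
    [g] over a period is the logarithm of the weight of the loop
    ([loop_birkhoff]), both sides being additive.  Closing up an arbitrary word
    into such a loop at bounded cost ([weight_lower], [weight_upper]) shows that
    [log g_n] is within a constant of the Birkhoff sums of [g], which are
    additive.

    The potential is continuous as soon as the ratios of consecutive return
    weights converge ([continuous_potential]), the limit being then [expR L]
    ([return_rate_unique]).  The return weights satisfy a linear recurrence of
    order two given by the trace and the determinant of the block of [K] on the
    states 1 and 2, so their ratios converge when the trace is positive.  When
    it is zero the block is antidiagonal, and a symmetric block, together with
    equal weights into or out of the states 1 and 2, makes the return weights a
    geometric sequence ([return_ratio_cvg]). *)

(** * Perron-Frobenius theory *)

Section PerronFrobenius.
Context {R : realType} {n : nat}.
Implicit Types (A K : 'M[R]_n.+1) (v : 'rV[R]_n.+1) (S : {set 'I_n.+1}).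

Definition mx_nonneg p q (A : 'M[R]_(p, q)) := forall i j, 0 <= A i j.

Lemma mx_nonneg_mul p q r (A : 'M[R]_(p, q)) (B : 'M[R]_(q, r)) :
  mx_nonneg A -> mx_nonneg B -> mx_nonneg (A *m B).
Proof.
by move=> hA hB i j; rewrite mxE sumr_ge0// => k _; rewrite mulr_ge0.
Qed.

Lemma mx_nonneg_mul_gt0 p q r (A : 'M[R]_(p, q)) (B : 'M[R]_(q, r)) i j :
  mx_nonneg A -> mx_nonneg B ->
  0 < (A *m B) i j <-> exists k, 0 < A i k /\ 0 < B k j.
Proof.
move=> A0 B0; rewrite mxE; split; last first.
  move=> [k [Aik Bkj]]; rewrite (bigD1 k)//= ltr_pwDl ?mulr_gt0//.
  by rewrite sumr_ge0// => k' _; rewrite mulr_ge0.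
move=> /lt0r_neq0/eqP/psumr_neq0P[k _|k /= ABk]; first by rewrite mulr_ge0.
exists k; rewrite !lt_neqAle A0 B0 !andbT eq_sym [0 == B k j]eq_sym.
by split; apply/negP => /eqP E; rewrite E ?mul0r ?mulr0 ltxx in ABk.
Qed.

Lemma mx_nonneg_exp A m : mx_nonneg A -> mx_nonneg (A ^+ m).
Proof.
move=> hA; elim: m => [|m IH]; last by rewrite exprS; exact: mx_nonneg_mul.
by move=> i j; rewrite expr0 mxE; case: eqP.
Qed.

(** The rows and columns outside [S] are kept as zeros, so that the symbols of a
    shift that start no point can stay in the index type. *)
Definition primitive_on S K m :=
  [/\ mx_nonneg K, forall i j, ~~ ((i \in S) && (j \in S)) -> K i j = 0 &
      forall i j, i \in S -> j \in S -> 0 < (K ^+ m) i j].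

Lemma primitive_on_trmx S K m : primitive_on S K m -> primitive_on S K^T m.
Proof.
move=> [K0 KS Km]; split=> [i j|i j|i j iS jS]; rewrite ?mxE //.
- by rewrite andbC; exact: KS.
- have -> : K^T ^+ m = (K ^+ m)^T; last by rewrite mxE Km.
  elim: m {Km} => [|m IH]; first by rewrite !expr0 trmx1.
  by rewrite exprS IH exprSr -!mulmxE trmx_mul.
Qed.

Lemma primitive_on_col S K m j : primitive_on S K m -> (0 < m)%N ->
  j \notin S -> forall i, (K ^+ m) i j = 0.
Proof.
move=> [_ KS _]; case: m => // m _ jS i; rewrite exprSr mxE big1// => k _.
by rewrite KS ?mulr0// (negbTE jS) andbF.
Qed.

Lemma continuous_maxr (T : topologicalType) (f g : T -> R) :
  continuous f -> continuous g -> continuous (fun x => Num.max (f x) (g x)).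
Proof.
move=> cf cg x; under eq_fun do rewrite maxr_absE.
apply: cvgMl; apply: cvgD; first by apply: cvgD; [exact: cf|exact: cg].
by apply: cvg_norm; apply: cvgB; [exact: cf|exact: cg].
Qed.

Lemma continuous_bigmaxr (T : topologicalType) I (r : seq I) (P : pred I)
    (F : I -> T -> R) :
  (forall i, continuous (F i)) ->
  continuous (fun x => \big[Num.max/0]_(i <- r | P i) F i x).
Proof.
move=> cF x; apply: cvg_big => [|i _]; last exact: cF.
by apply: continuous_maxr => -[y z]; [exact: cvg_fst|exact: cvg_snd].
Qed.

Lemma continuous_mulr (T : topologicalType) (f g : T -> R) :
  continuous f -> continuous g -> continuous (fun x => f x * g x).
Proof. by move=> cf cg x; apply: cvgM; [exact: cf|exact: cg]. Qed.

Lemma continuous_invr (T : topologicalType) (f : T -> R) :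
  (forall x, f x != 0) -> continuous f -> continuous (fun x => (f x)^-1).
Proof. by move=> f0 cf x; apply: cvgV => //; exact: cf. Qed.

Lemma continuous_sumr (T : topologicalType) I (r : seq I) (F : I -> T -> R) :
  (forall i, continuous (F i)) -> continuous (fun x => \sum_(i <- r) F i x).
Proof.
by move=> cF x; apply: cvg_big => [|i _]; [exact: add_continuous|exact: cF].
Qed.

(** Left Perron eigenvector.  The growth factor
    [v |-> max_i (v K)_i / v_i] attains its minimum over the compact set of
    vectors with entries between [d] and 1 on [S]; at a minimiser that is not
    an eigenvector, applying the positive power [K ^+ m] would strictly
    decrease every ratio, and [K ^+ m] maps positive vectors into the cone over
    this compact set once [d] is small. *)
Lemma perron_left S K m s0 : (0 < m)%N -> s0 \in S -> primitive_on S K m ->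
  exists (lam : R) v, [/\ 0 < lam, v *m K = lam *: v,
    forall i, i \in S -> 0 < v 0 i & forall i, i \notin S -> v 0 i = 0].
Proof.
move=> m0 s0S prK; have [K0 KS Km] := prK.
pose L := K ^+ m.
have L0 : mx_nonneg L by exact: mx_nonneg_exp.
(* the bounds [a] and [b] keep a multiple of [v *m L] inside the box below *)
have [a a0 La] : exists2 a : R, 0 < a & forall i j, i \in S -> j \in S -> a <= L i j.
  exists (\big[Num.min/1]_(ij : 'I_n.+1 * 'I_n.+1 | (ij.1 \in S) && (ij.2 \in S))
            L ij.1 ij.2).
    by apply: lt_bigmin => // -[i j] /andP[iS jS]; exact: Km.
  move=> i j iS jS.
  have Sij : [pred ij : 'I_n.+1 * 'I_n.+1 | (ij.1 \in S) && (ij.2 \in S)] (i, j).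
    by rewrite /= iS.
  exact: (bigmin_le_cond _ (fun ij => L ij.1 ij.2) Sij).
pose b := 1 + \sum_i \sum_j L i j.
have b0 : 0 < b.
  by rewrite ltr_pwDl// sumr_ge0// => i _; rewrite sumr_ge0.
have Lb i j : L i j <= b.
  rewrite /b (bigD1 i)//= (bigD1 j)//=.
  set x := L i j; set y := \sum_(_ | _) _; set z := \sum_(_ | _) _.
  have y0 : 0 <= y by rewrite sumr_ge0.
  have z0 : 0 <= z by rewrite sumr_ge0// => k _; rewrite sumr_ge0.
  lra.
pose d := a / b; have d0 : 0 < d by rewrite divr_gt0.
pose box i : set R := if i \in S then `[d, 1]%classic else [set 0].
pose V := [set v : 'rV[R]_n.+1 | forall i, box i (v ord0 i)].
have cV : compact V.
  apply: rV_compact => i; rewrite /box; case: ifP => _.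
    exact: segment_compact.
  exact: compact_set1.
pose phi v := \big[Num.max/0]_(i in S) ((v *m K) 0 i / Num.max (v 0 i) d).
have cphi : continuous phi.
  apply: continuous_bigmaxr => i.
  have cM : continuous (fun v : 'rV[R]_n.+1 => (v *m K) 0 i).
    under eq_fun do rewrite mxE.
    apply: continuous_sumr => j; apply: continuous_mulr; last exact: cst_continuous.
    exact: coord_continuous.
  apply: continuous_mulr => //; apply: continuous_invr => [v|].
    by rewrite gt_eqF// lt_max d0 orbT.
  by apply: continuous_maxr; [exact: coord_continuous|exact: cst_continuous].
have dle1 : d <= 1.
  by rewrite ler_pdivrMr// mul1r (le_trans (La s0 s0 s0S s0S))// Lb.
have V0 : V !=set0.
  exists (\row_i (if i \in S then 1 else 0)) => i /=.
  rewrite mxE /box; case: ifP => //= _.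
  by rewrite in_itv/= lexx andbT.
have [v vV vmin] := @EVT_min_rV R _ phi V V0 cV (continuous_subspaceT cphi).
rewrite inE in vV.
have vS i : i \in S -> d <= v 0 i.
  by move=> iS; have := vV i; rewrite /= /box iS /= in_itv/= => /andP[].
have vN i : i \notin S -> v 0 i = 0.
  by move=> iS; have := vV i; rewrite /= /box (negbTE iS).
pose lam := phi v.
have vle i : i \in S -> (v *m K) 0 i <= lam * v 0 i.
  move=> iS; have vi := vS i iS.
  rewrite -ler_pdivrMr; last exact: lt_le_trans vi.
  have := le_bigmax_cond 0 (fun i => (v *m K) 0 i / Num.max (v 0 i) d) iS.
  by rewrite /= max_l.
have lam0 : 0 <= lam by exact: bigmax_ge_id.
have vKN i : i \notin S -> (v *m K) 0 i = 0.
  by move=> iS; rewrite mxE big1// => j _; rewrite KS ?mulr0// (negbTE iS) andbF.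
have LN i : i \notin S -> forall j, L j i = 0.
  by move=> iS j; exact: (primitive_on_col prK).
have eqv : v *m K = lam *: v.
  apply/eqP/negPn/negP => neq.
  pose w := lam *: v - v *m K.
  have w0 : mx_nonneg w.
    move=> i0 i; rewrite (ord1 i0) !mxE; have [iS|iS] := boolP (i \in S).
      by rewrite subr_ge0; have := vle i iS; rewrite mxE.
    have := vKN i iS; rewrite mxE => ->; rewrite vN// mulr0 subr0//.
  have [k kS wk] : exists2 k, k \in S & 0 < w 0 k.
    apply: contrapT => H; move: neq; apply/negP; rewrite negbK eq_sym -subr_eq0.
    apply/eqP/rowP => k; rewrite [RHS]mxE; apply/eqP; rewrite eq_le w0 andbT.
    have [kS|kS] := boolP (k \in S).
      by rewrite leNgt; apply/negP => ?; apply: H; exists k.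
    have := vKN k kS; rewrite !mxE => ->; rewrite vN// mulr0 subr0//.
  have wL j : j \in S -> 0 < (w *m L) 0 j.
    move=> jS; rewrite mxE (bigD1 k)//= ltr_pwDl ?mulr_gt0//; first exact: Km.
    by rewrite sumr_ge0// => i _; rewrite mulr_ge0.
  pose u := v *m L.
  pose c := \sum_(i in S) v 0 i.
  have c0 : 0 < c.
    rewrite /c (bigD1 s0)//= ltr_pwDl ?(lt_le_trans d0 (vS _ _))//.
    by rewrite sumr_ge0// => i /andP[iS _]; rewrite (le_trans (ltW d0))// vS.
  have vsum j : u 0 j = \sum_(i in S) v 0 i * L i j.
    rewrite mxE [LHS](bigID (mem S))/= [X in _ + X]big1 ?addr0// => i iS.
    by rewrite vN ?mul0r.
  have ua j : j \in S -> a * c <= u 0 j.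
    move=> jS; rewrite vsum mulr_sumr ler_sum// => i iS.
    by rewrite mulrC ler_wpM2l ?La// (le_trans (ltW d0) (vS _ _)).
  have ub j : u 0 j <= b * c.
    rewrite vsum mulr_sumr ler_sum// => i iS.
    by rewrite mulrC ler_wpM2r ?Lb// (le_trans (ltW d0) (vS _ _)).
  have ac0 : 0 < a * c by rewrite mulr_gt0.
  have bc0 : 0 < b * c by rewrite mulr_gt0.
  pose t := (b * c)^-1 *: u.
  have tV : V t.
    move=> i; rewrite /= /box mxE; case: ifP => iS /=.
      rewrite in_itv/= [_ * u 0 i]mulrC; apply/andP; split.
        rewrite ler_pdivlMr//; apply: le_trans (ua _ iS).
        by rewrite /d mulrA divfK ?gt_eqF.
      by rewrite ler_pdivrMr// mul1r ub.
    by rewrite mxE big1 ?mulr0// => j _; rewrite LN ?mulr0// iS.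
  have tle i : i \in S -> (t *m K) 0 i < lam * t 0 i.
    move=> iS; rewrite /t -scalemxAl /u -mulmxA.
    have -> : L *m K = K *m L by rewrite /L !mulmxE -exprSr exprS.
    have := wL i iS; rewrite /w mulmxBl -scalemxAl -!mulmxA.
    rewrite [X in 0 < X -> _]mxE [X in _ + X]mxE subr_gt0.
    rewrite [X in _ < X -> _]mxE => H.
    rewrite [X in X < _]mxE (_ : ((b * c)^-1 *: (v *m L)) 0 i =
      (b * c)^-1 * (v *m L) 0 i); last by rewrite mxE.
    by rewrite mulrCA ltr_pM2l ?invr_gt0// mulmxA.
  have := vmin t; rewrite inE => /(_ tV); rewrite leNgt => /negP; apply.
  rewrite /phi; apply/bigmax_ltP; split.
    have lamE : lam != 0 -> 0 < lam by move=> lamN; rewrite lt_neqAle eq_sym lamN.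
    apply: lamE; apply/negP => /eqP l0; have := tle s0 s0S.
    rewrite l0 mul0r ltNge; apply/negP/negPn.
    rewrite mxE sumr_ge0// => j _; rewrite mulr_ge0//.
    have := tV j; rewrite /= /box; case: ifP => _; last by move=> ->.
    by rewrite /= in_itv/= => /andP[/(le_trans (ltW d0))].
  move=> i iS; have := tV i; rewrite /= /box iS /= in_itv/= => /andP[ti _].
  by rewrite (max_l ti) ltr_pdivrMr ?tle// (lt_le_trans d0).
exists lam, v; split=> //; last by move=> i iS; exact: lt_le_trans (vS _ iS).
rewrite lt_neqAle lam0 andbT; apply/negP => /eqP l0.
have : v *m L = 0.
  rewrite /L; case: (m) m0 => // k _.
  by rewrite exprS -mulmxE mulmxA eqv -l0 scale0r mul0mx.
move/rowP => /(_ s0); rewrite mxE [RHS]mxE => /eqP; apply/negP.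
rewrite gt_eqF// (bigD1 s0)//= ltr_pwDl//.
  by rewrite mulr_gt0 ?Km// (lt_le_trans d0) ?vS.
rewrite sumr_ge0// => j _; rewrite mulr_ge0//.
have [jS|jS] := boolP (j \in S); last by rewrite vN.
exact: le_trans (ltW d0) (vS _ jS).
Qed.

Definition perron_data S K (lam : R) v (h : 'cV[R]_n.+1) :=
  [/\ 0 < lam, v *m K = lam *: v, K *m h = lam *: h, (v *m h) 0 0 = 1 &
      forall i, if i \in S then 0 < v 0 i /\ 0 < h i 0
                else v 0 i = 0 /\ h i 0 = 0].

Lemma perron_pair S K m s0 : (0 < m)%N -> s0 \in S -> primitive_on S K m ->
  exists lam v h, perron_data S K lam v h.
Proof.
move=> m0 s0S prK.
have [lam [v [lam0 vK vS vN]]] := perron_left m0 s0S prK.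
have [lam' [w [lam'0 wK wS wN]]] := perron_left m0 s0S (primitive_on_trmx prK).
have Kw : K *m w^T = lam' *: w^T by rewrite -[K]trmxK -trmx_mul wK linearZ.
pose c := (v *m w^T) 0 0.
have c0 : 0 < c.
  rewrite /c mxE (bigD1 s0)//= ltr_pwDl ?mulr_gt0 ?mxE ?vS ?wS//.
  rewrite sumr_ge0// => j _; rewrite mxE; have [jS|jS] := boolP (j \in S).
    by rewrite mulr_ge0 ?ltW ?vS ?wS.
  by rewrite vN// mul0r.
have ll' : lam' = lam.
  apply: (mulIf (lt0r_neq0 c0)).
  have -> : lam' * c = (v *m K *m w^T) 0 0 by rewrite -mulmxA Kw -scalemxAr [in RHS]mxE.
  by rewrite vK -scalemxAl [in LHS]mxE.
exists lam, v, (c^-1 *: w^T); split=> //.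
- by rewrite -scalemxAr Kw ll' scalerA mulrC -scalerA.
- by rewrite -scalemxAr mxE mulVf// gt_eqF.
- move=> i; case: ifPn => iS; rewrite !mxE.
    by split; [exact: vS|rewrite mulr_gt0 ?invr_gt0 ?wS].
  by rewrite vN// wN// mulr0.
Qed.

Section Domination.
Variables (S : {set 'I_n.+1}) (K : 'M[R]_n.+1) (m : nat) (lam : R).
Variables (v : 'rV[R]_n.+1) (h : 'cV[R]_n.+1).
Hypotheses (m0 : (0 < m)%N) (prK : primitive_on S K m).
Hypothesis (pd : perron_data S K lam v h).

Lemma perron_ge0 : mx_nonneg v /\ mx_nonneg h.
Proof.
have [_ _ _ _ vh] := pd.
split=> i j.
  by rewrite (ord1 i); have := vh j; case: ifP => _ [vj _]; [exact: ltW|rewrite vj].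
by rewrite (ord1 j); have := vh i; case: ifP => _ [_ hi]; [exact: ltW|rewrite hi].
Qed.

Lemma perron_pow_right k : K ^+ k *m h = lam ^+ k *: h.
Proof.
have [_ _ Kh _ _] := pd; elim: k => [|k IH].
  by rewrite !expr0 mul1mx scale1r.
by rewrite exprS -mulmxE -mulmxA IH -scalemxAr Kh scalerA exprSr.
Qed.

Lemma perron_pow_left k : v *m K ^+ k = lam ^+ k *: v.
Proof.
have [_ vK _ _ _] := pd; elim: k => [|k IH].
  by rewrite !expr0 mulmx1 scale1r.
by rewrite exprSr -mulmxE mulmxA IH -scalemxAl vK scalerA exprSr.
Qed.

(** The powers of the normalised matrix [lam^-m K^m] converge to the rank-one
    projection [h v]: subtracting a small multiple [d] of the projection leaves
    a nonnegative matrix [Q] whose spectral radius is [1 - d], because [h] is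
    a positive eigenvector of [Q] for the eigenvalue [1 - d]. *)
Lemma perron_domination (eps : R) : 0 < eps -> exists2 N : nat, (0 < N)%N &
  forall i j, (K ^+ N) i j <= lam ^+ N * (1 + eps) * (h i 0 * v 0 j).
Proof.
move=> eps0; have [lam0 vK Kh vh1 vh] := pd; have [v0 h0] := perron_ge0.
have [K0 KS Km] := prK.
pose P := h *m v.
have PE i j : P i j = h i 0 * v 0 j by rewrite mxE big_ord_recl big_ord0 addr0.
have PP : P *m P = P.
  rewrite /P mulmxA -[h *m v *m h]mulmxA.
  have -> : v *m h = 1%:M by apply/matrixP => i j; rewrite !ord1 vh1 mxE.
  by rewrite mulmx1.
pose A := lam ^- m *: K ^+ m.
have lm0 : 0 < lam ^+ m by rewrite exprn_gt0.
have AP : A *m P = P.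
  rewrite /A /P -scalemxAl mulmxA perron_pow_right -scalemxAl scalerA.
  by rewrite mulVf ?scale1r// gt_eqF.
have PA : P *m A = P.
  rewrite /A /P -scalemxAr -mulmxA perron_pow_left -scalemxAr scalerA.
  by rewrite mulVf ?scale1r// gt_eqF.
have [d [d0 d1 dA]] : exists d : R, [/\ 0 < d, d < 1 & forall i j, d * P i j <= A i j].
  pose F (ij : 'I_n.+1 * 'I_n.+1) := A ij.1 ij.2 / (1 + P ij.1 ij.2).
  have P1 i j : 0 < 1 + P i j by rewrite ltr_pwDl// PE mulr_ge0.
  exists (\big[Num.min/2^-1]_(ij | (ij.1 \in S) && (ij.2 \in S)) F ij); split.
  - apply: lt_bigmin => [|[i j] /andP[iS jS]]; first by rewrite invr_gt0.
    by rewrite divr_gt0 ?P1// mxE mulr_gt0 ?invr_gt0 ?Km.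
  - by rewrite (le_lt_trans (bigmin_le_id _ _ _ _))// invf_lt1 ?ltr1n.
  - move=> i j; have [/andP[iS jS]|/nandP nS] := boolP ((i \in S) && (j \in S)).
      have Sij : [pred ij : 'I_n.+1 * 'I_n.+1 | (ij.1 \in S) && (ij.2 \in S)] (i, j).
        by rewrite /= iS.
      have /= H := bigmin_le_cond 2^-1 F Sij.
      apply: (@le_trans _ _ (F (i, j) * P i j)).
        by rewrite ler_wpM2r// PE mulr_ge0.
      rewrite /F /= mulrAC ler_pdivrMr ?P1// ler_wpM2l ?lerDr//.
      by rewrite mxE mulr_ge0 ?invr_ge0 ?ltW// Km.
    have -> : P i j = 0.
      rewrite PE; case: nS => iS; first by have := vh i; rewrite (negbTE iS) => -[_ ->]; rewrite mul0r.
      by have := vh j; rewrite (negbTE iS) => -[-> _]; rewrite mulr0.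
    by rewrite mulr0 mxE mulr_ge0 ?invr_ge0 ?(ltW lm0)//; exact: mx_nonneg_exp.
have Ah : A *m h = h.
  by rewrite -scalemxAl perron_pow_right scalerA mulVf ?gt_eqF// scale1r.
have Ph : P *m h = h.
  rewrite -mulmxA; have -> : v *m h = 1%:M.
    by apply/matrixP => i j; rewrite !ord1 vh1 mxE.
  by rewrite mulmx1.
have KE q : K ^+ (m * q) = lam ^+ (m * q) *: A ^+ q.
  by rewrite /A exprZn scalerA exprVn -!exprM mulfV ?scale1r ?gt_eqF ?exprn_gt0.
clearbody A P.
pose Q := A - d *: P.
have Q0 : mx_nonneg Q by move=> i j; rewrite !mxE subr_ge0.
have AkP k : A ^+ k *m P = P.
  elim: k => [|k IH]; first by rewrite expr0 mul1mx.
  by rewrite exprS -mulmxE -mulmxA IH.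
have QE k : A ^+ k = Q ^+ k + (1 - (1 - d) ^+ k) *: P.
  elim: k => [|k IH]; first by rewrite !expr0 subrr scale0r addr0.
  have -> : Q ^+ k.+1 = (A ^+ k - (1 - (1 - d) ^+ k) *: P) *m Q.
    by rewrite IH addrK exprSr.
  rewrite /Q mulmxBl -scalemxAl !mulmxBr -!scalemxAr PA PP AkP.
  rewrite mulmxE -exprSr; apply/matrixP => i j; rewrite !mxE [(1 - d) ^+ k.+1]exprS; ring.
have Qh k : Q ^+ k *m h = (1 - d) ^+ k *: h.
  elim: k => [|k IH]; first by rewrite !expr0 mul1mx scale1r.
  rewrite exprSr -mulmxE -mulmxA.
  have -> : Q *m h = (1 - d) *: h.
    by rewrite mulmxBl -scalemxAl Ah Ph scalerBl scale1r.
  by rewrite -scalemxAr IH scalerA -exprS.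
pose C := 1 + \sum_(j in S) (h j 0 * v 0 j)^-1.
have Cj j : j \in S -> (h j 0)^-1 <= C * v 0 j.
  move=> jS; have := vh j; rewrite jS => -[vj hj].
  rewrite -ler_pdivrMr// -invfM /C (bigD1 j)//=.
  set x := _^-1; set y := \sum_(_ | _) _.
  have : 0 <= y by rewrite sumr_ge0// => i _; rewrite invr_ge0 mulr_ge0.
  by lra.
have C0 : 0 < C.
  by rewrite ltr_pwDl// sumr_ge0// => i _; rewrite invr_ge0 mulr_ge0.
have [k [k0 kC]] : exists k, (0 < k)%N /\ (1 - d) ^+ k * C <= eps.
  have : (1 - d) ^+ k @[k --> \oo] --> 0 by apply: cvg_expr; rewrite ger0_norm; lra.
  move=> /cvgrPdist_le /(_ (eps / C)); rewrite divr_gt0// => /(_ isT)[k _ Hk].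
  exists k.+1; split => //; rewrite -ler_pdivlMr//.
  have := Hk k.+1 (leqnSn _); rewrite sub0r normrN ger0_norm// exprn_ge0//; lra.
exists (m * k)%N; first by rewrite muln_gt0 m0.
move=> i j; have [jS|jS] := boolP (j \in S); last first.
  have mk0 : (0 < m * k)%N by rewrite muln_gt0 m0.
  have -> : (K ^+ (m * k)) i j = 0.
    case: (m * k)%N mk0 => // q _; rewrite exprSr mxE big1// => r _.
    by rewrite KS ?mulr0// (negbTE jS) andbF.
  by rewrite !mulr_ge0// ?ltW ?exprn_gt0// addr_gt0.
rewrite KE mxE.
rewrite -mulrA ler_pM2l ?exprn_gt0// QE !mxE -PE.
rewrite [X in _ <= X]mulrDl mul1r [X in X <= _]addrC lerD//.
  rewrite ler_piMl//; first by rewrite PE mulr_ge0.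
  by rewrite lerBlDr lerDl exprn_ge0//; lra.
have := vh j; rewrite jS => -[vj hj].
have Qij : (Q ^+ k) i j * h j 0 <= (1 - d) ^+ k * h i 0.
  have := Qh k => /matrixP/(_ i 0); rewrite [RHS]mxE => <-.
  rewrite mxE (bigD1 j)//= lerDl sumr_ge0// => r _.
  by rewrite mulr_ge0//; exact: mx_nonneg_exp.
move: Qij; rewrite -ler_pdivlMr// => /le_trans; apply.
rewrite PE mulrCA mulrAC [X in X <= _]mulrC ler_wpM2l//.
apply: (@le_trans _ _ ((1 - d) ^+ k * (C * v 0 j))).
  by rewrite ler_wpM2l ?Cj// exprn_ge0//; lra.
by rewrite mulrA ler_wpM2r.
Qed.

End Domination.
End PerronFrobenius.

(** * Stationary laws on words *)

Section WordSums.
Context {T : finType}.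

(** recursive on the length, so that splitting words into consecutive pieces is
    an induction *)
Fixpoint wsum {V : nmodType} (n : nat) (F : seq T -> V) : V :=
  if n is n'.+1 then \sum_a wsum n' (fun w => F (a :: w)) else F [::].

Lemma eq_wsum {V : nmodType} n (F G : seq T -> V) :
  (forall w, size w = n -> F w = G w) -> wsum n F = wsum n G.
Proof.
elim: n F G => [|n IH] F G FG /=; first exact: FG.
by apply: eq_bigr => a _; apply: IH => w sw; rewrite FG//= sw.
Qed.

Lemma wsum_cat {V : nmodType} m n (F : seq T -> V) :
  wsum (m + n) F = wsum m (fun u => wsum n (fun w => F (u ++ w))).
Proof. by elim: m F => [//|m IH] F /=; apply: eq_bigr => a _; rewrite IH. Qed.

Lemma wsum_sum {V : nmodType} n (I : finType) (F : I -> seq T -> V) :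
  wsum n (fun w => \sum_i F i w) = \sum_i wsum n (F i).
Proof.
elim: n F => [//|n IH] F /=; rewrite exchange_big /=.
by apply: eq_bigr => a _; rewrite IH.
Qed.

Lemma exchange_wsum {V : nmodType} m n (F : seq T -> seq T -> V) :
  wsum m (fun u => wsum n (F u)) = wsum n (fun w => wsum m (fun u => F u w)).
Proof.
elim: m F => [//|m IH] F /=; rewrite wsum_sum.
by apply: eq_bigr => a _; rewrite IH.
Qed.

Lemma wsumD {V : nmodType} n (F G : seq T -> V) :
  wsum n (fun w => F w + G w) = wsum n F + wsum n G.
Proof.
elim: n F G => [//|n IH] F G /=; rewrite -big_split /=.
by apply: eq_bigr => a _; rewrite IH.
Qed.

Context {R : realType}.
Implicit Types F G : seq T -> R.

Lemma wsumZ n c F : wsum n (fun w => c * F w) = c * wsum n F.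
Proof.
elim: n F => [//|n IH] F /=; rewrite mulr_sumr.
by apply: eq_bigr => a _; rewrite IH.
Qed.

Lemma ler_wsum n F G : (forall w, size w = n -> F w <= G w) ->
  wsum n F <= wsum n G.
Proof.
elim: n F G => [|n IH] F G FG /=; first exact: FG.
by apply: ler_sum => a _; apply: IH => w sw; apply: FG; rewrite /= sw.
Qed.

Lemma wsum_ge0 n F : (forall w, size w = n -> 0 <= F w) -> 0 <= wsum n F.
Proof.
move=> F0; apply: (@le_trans _ _ (wsum n (fun=> 0 * 0))).
  by rewrite wsumZ mul0r.
by apply: ler_wsum => w sw; rewrite mulr0 F0.
Qed.

Lemma wsum_delta n v F : size v = n -> wsum n (fun w => F w * (w == v)%:R) = F v.
Proof.
elim: n v F => [|n IH] [|b v] F //=; first by rewrite mulr1.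
move=> [sv]; rewrite (bigD1 b)//= [X in _ + X]big1 ?addr0.
  rewrite -[RHS](IH v (fun w => F (b :: w)) sv); apply: eq_wsum => w _.
  by rewrite eqseq_cons eqxx.
move=> a ab; rewrite -[RHS](mul0r (wsum n (fun=> 0))) -wsumZ.
by apply: eq_wsum => w _; rewrite eqseq_cons (negbTE ab) mulr0 mul0r.
Qed.

Fixpoint words (n : nat) : seq (seq T) :=
  if n is n'.+1 then [seq a :: w | a <- enum T, w <- words n'] else [:: [::]].

Lemma wsum_words n F : wsum n F = \sum_(w <- words n) F w.
Proof.
elim: n F => [|n IH] F /=; first by rewrite big_seq1.
by rewrite big_allpairs_dep big_enum; apply: eq_bigr => a _; rewrite IH.
Qed.

Lemma mem_words n w : (w \in words n) = (size w == n).
Proof.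
elim: n w => [|n IH] [|a w] //=.
  by apply/negP => /allpairsP[[b v] /= [_ _]].
rewrite eqSS -IH; apply/allpairsP/idP => [[[b v] /= [_ vn [_ ->]]]//|wn].
by exists (a, w); rewrite /= mem_enum.
Qed.

Lemma uniq_words n : uniq (words n).
Proof.
elim: n => [//|n IH] /=; apply: allpairs_uniq; rewrite ?enum_uniq//.
by move=> [a v] [b w] _ _ /= [-> ->].
Qed.

End WordSums.

Section WordDistributions.
Context {T : finType} {R : realType}.
Implicit Types (nu : seq T -> R) (u v w z : seq T).

(** the values on cylinders of a shift-invariant probability measure *)
Definition stationary_dist nu :=
  [/\ forall w, 0 <= nu w, nu [::] = 1,
      forall w, nu w = \sum_a nu (rcons w a) & forall w, nu w = \sum_a nu (a :: w)].

(** upper psi-mixing: a gap of suitable length makes two events independent up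
    to a factor close to 1 *)
Definition psi_mixing nu := forall eps, 0 < eps -> exists L, forall u z,
  wsum L (fun w => nu (u ++ w ++ z)) <= (1 + eps) * (nu u * nu z).

Lemma wsum_dist_right nu : stationary_dist nu ->
  forall n u, wsum n (fun w => nu (u ++ w)) = nu u.
Proof.
move=> [_ _ nur _]; elim=> [|n IH] u /=; first by rewrite cats0.
by rewrite [RHS]nur; apply: eq_bigr => a _; rewrite -IH; apply: eq_wsum => w _; rewrite cat_rcons.
Qed.

Lemma wsum_dist_left nu : stationary_dist nu ->
  forall n u, wsum n (fun w => nu (w ++ u)) = nu u.
Proof.
move=> [_ _ _ nul] n; elim: n => [//|n IH] u /=.
by rewrite -wsum_sum -[RHS]IH; apply: eq_wsum => w _; rewrite [RHS]nul.
Qed.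

Lemma wsum_dist nu : stationary_dist nu -> forall n, wsum n nu = 1.
Proof.
by move=> snu n; rewrite -[RHS](let: And4 _ h _ _ := snu in h) -(wsum_dist_right snu n).
Qed.

(** Only the visits to [v] at multiples of [N] count: when [N] exceeds the
    length of [v], the gaps make these visits almost independent for a mixing
    law. *)
Fixpoint hits v N J w : nat :=
  if J is J'.+1 then ((take (size v) w == v) + hits v N J' (drop N w))%N else 0.

Definition hits_mgf nu v N (tau : R) J : R :=
  wsum (J * N) (fun w => nu w * expR (tau * (hits v N J w)%:R)).

Lemma hits_split v L J x u z : size x = size v -> size u = L ->
  hits v (size v + L) J.+1 (x ++ u ++ z) =
  ((x == v) + hits v (size v + L) J z)%N.
Proof.
move=> sx su /=; rewrite -sx take_size_cat//.
by rewrite catA drop_size_cat// size_cat su.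
Qed.

(** The gap of length [L] after the first block decouples it from the following
    ones, so each block contributes one factor. *)
Lemma hits_mgf_upper nu v L (tau eps : R) : stationary_dist nu -> 0 <= eps ->
  (forall u z, wsum L (fun w => nu (u ++ w ++ z)) <= (1 + eps) * (nu u * nu z)) ->
  forall J, hits_mgf nu v (size v + L) tau J <=
    ((1 + eps) * (1 + (expR tau - 1) * nu v)) ^+ J.
Proof.
move=> snu eps0 mix; have [nu0 nu1 _ _] := snu.
elim=> [|J IH]; first by rewrite /hits_mgf /= mulr0 expR0 mulr1 nu1 expr0.
rewrite exprS /hits_mgf mulSn -addnA wsum_cat.
rewrite (_ : wsum (size v) _ = wsum (size v) (fun x =>
    wsum (J * (size v + L)) (fun z => (expR (tau * (x == v)%:R) *
      expR (tau * (hits v (size v + L) J z)%:R)) *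
      wsum L (fun u => nu (x ++ u ++ z))))); last first.
  apply: eq_wsum => x sx; rewrite wsum_cat exchange_wsum; apply: eq_wsum => z sz.
  rewrite -wsumZ; apply: eq_wsum => u su.
  by rewrite hits_split// natrD mulrDr expRD mulrC.
pose A := wsum (size v) (fun x => nu x * expR (tau * (x == v)%:R)).
have AE : A = 1 + (expR tau - 1) * nu v.
  rewrite /A -[X in _ = X + _](wsum_dist snu (size v)).
  rewrite -(@wsum_delta _ _ (size v) v nu)// -wsumZ -wsumD; apply: eq_wsum => x _.
  by case: (x == v); rewrite /= ?mulr1 ?mulr0 ?expR0; ring.
apply: (@le_trans _ _ ((1 + eps) * (A * hits_mgf nu v (size v + L) tau J))).
  rewrite [A * _]mulrC -!wsumZ; apply: ler_wsum => x _.
  rewrite [X in _ <= X](_ : _ = (1 + eps) * (nu x * expR (tau * (x == v)%:R)) *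
    hits_mgf nu v (size v + L) tau J); last by ring.
  rewrite -wsumZ; apply: ler_wsum => z _.
  rewrite [X in _ <= X](_ : _ = (expR (tau * (x == v)%:R) *
    expR (tau * (hits v (size v + L) J z)%:R)) * ((1 + eps) * (nu x * nu z))).
    by rewrite ler_wpM2l// mulr_ge0// expR_ge0.
  ring.
rewrite mulrA AE ler_wpM2l// -AE mulr_ge0 ?addr_ge0//.
by apply: wsum_ge0 => x _; rewrite mulr_ge0// expR_ge0.
Qed.

Lemma hits_mean nu v L : stationary_dist nu -> forall J,
  wsum (J * (size v + L)) (fun w => nu w * (hits v (size v + L) J w)%:R) =
  J%:R * nu v.
Proof.
move=> snu; elim=> [|J IH]; first by rewrite /= mulr0 mul0r.
rewrite mulSn -addnA.
transitivity (wsum (size v + (L + J * (size v + L))) (fun w =>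
    nu w * (take (size v) w == v)%:R) +
  wsum ((size v + L) + J * (size v + L)) (fun w =>
    nu w * (hits v (size v + L) J (drop (size v + L) w))%:R)).
  by rewrite -addnA -wsumD; apply: eq_wsum => w _; rewrite /= natrD mulrDr.
rewrite wsum_cat [X in _ + X]wsum_cat -natr1 mulrDl mul1r addrC; congr (_ + _).
  rewrite exchange_wsum -IH; apply: eq_wsum => z _.
  rewrite -(wsum_dist_left snu (size v + L) z) mulrC -wsumZ.
  by apply: eq_wsum => y sy; rewrite drop_size_cat// mulrC.
rewrite -[RHS](@wsum_delta _ _ (size v) v nu)//; apply: eq_wsum => x sx.
rewrite -(wsum_dist_right snu (L + J * (size v + L)) x) mulrC -wsumZ.
by apply: eq_wsum => y _; rewrite take_size_cat// mulrC.
Qed.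

(** Jensen's inequality, through the tangent line of the exponential *)
Lemma hits_mgf_lower nu v L (tau : R) : stationary_dist nu -> forall J,
  expR (tau * (J%:R * nu v)) <= hits_mgf nu v (size v + L) tau J.
Proof.
move=> snu J; set c := tau * _; have [nu0 _ _ _] := snu.
pose N := (J * (size v + L))%N.
pose H w : R := (hits v (size v + L) J w)%:R.
apply: (@le_trans _ _ (wsum N (fun w => expR c * (1 - c) * nu w +
                                        expR c * tau * (nu w * H w)))).
  rewrite wsumD !wsumZ (wsum_dist snu) hits_mean// -[expR c * tau * _]mulrA -/c.
  by rewrite le_eqVlt; apply/orP; left; apply/eqP; ring.
apply: ler_wsum => w _; have := expR_ge1Dx (tau * H w - c).
rewrite expRD expRN => h.
rewrite [X in X <= _](_ : _ = nu w * (expR c * (1 + (tau * H w - c)))); last by ring.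
rewrite ler_wpM2l// mulrC -ler_pdivlMr ?expR_gt0//.
Qed.

(** A stationary law that is dominated, up to a subexponential factor, by an
    upper psi-mixing one coincides with it: the mixing law bounds the
    exponential moments of the number of visits to a word [v] by those of
    independent trials of probability [nu v], while the dominated law has, by
    convexity, exponential moments at least those of its mean number of
    visits. *)
Lemma subexp_dominated_eq nu nu' (D : nat -> R) :
  stationary_dist nu -> stationary_dist nu' -> psi_mixing nu ->
  (forall w, (0 < size w)%N -> nu' w <= expR (D (size w)) * nu w) ->
  D n / n%:R @[n --> \oo] --> 0 -> nu' =1 nu.
Proof.
move=> snu snu' mix dom D0.
have [nu0 nu1 _ _] := snu; have [nu'0 nu'1 _ _] := snu'.
have nu'le1 v : nu' v <= 1.
  rewrite -(wsum_dist snu' (size v)) -(@wsum_delta _ _ (size v) v nu')//.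
  by apply: ler_wsum => w _; case: eqP => _; rewrite ?mulr1// mulr0.
suff le_nu v : (0 < size v)%N -> nu' v <= nu v.
  move=> v; case: (posnP (size v)) => [/size0nil ->|v0]; first by rewrite nu1.
  apply/eqP; rewrite eq_le le_nu//= -subr_le0.
  rewrite -(@wsum_delta _ _ (size v) v (fun w => nu w - nu' w))//.
  apply: (@le_trans _ _ (wsum (size v) (fun w => nu w + (-1) * nu' w))).
    apply: ler_wsum => w sw; rewrite mulN1r ler_piMr ?subr_ge0 ?le_nu ?sw//.
    by case: (w == v).
  by rewrite wsumD wsumZ (wsum_dist snu) (wsum_dist snu') mulN1r subrr.
move=> v0; have key tau : 0 < tau -> tau * nu' v <= (expR tau - 1) * nu v.
  move=> tau0; apply/ler_addgt0Pr => e e0.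
  have [L HL] := mix (e / 2) (divr_gt0 e0 (ltr0n _ 2)).
  pose N := (size v + L)%N; have N0 : (0 < N)%N by rewrite addn_gt0 v0.
  have eN0 : 0 < e / 2 / N%:R by rewrite !divr_gt0// ltr0n.
  move/cvgrPdist_le : D0 => /(_ _ eN0)[n _ Hn].
  pose J := n.+1; have nJ : (n <= J * N)%N.
    by rewrite (leq_trans (leqnSn n))// leq_pmulr.
  have JN0 : (0 < J * N)%N by rewrite muln_gt0.
  have DJ : D (J * N)%N <= J%:R * (e / 2).
    have := Hn (J * N)%N nJ; rewrite sub0r normrN => /(le_trans (ler_norm _)).
    rewrite ler_pdivrMr ?ltr0n// => /le_trans; apply.
    have N00 : N%:R != 0 :> R by rewrite pnatr_eq0 -lt0n.
    by rewrite natrM mulrCA divfK.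
  have e20 : 0 <= e / 2 by rewrite ltW// divr_gt0.
  have ex0 : 0 <= (expR tau - 1) * nu v.
    by rewrite mulr_ge0//; have := expR_ge1Dx tau; lra.
  have E : expR (tau * (J%:R * nu' v)) <=
      expR (J%:R * (e / 2) + J%:R * (e / 2 + (expR tau - 1) * nu v)).
    apply: (le_trans (hits_mgf_lower v L tau snu' J)).
    rewrite expRD; apply: (@le_trans _ _ (expR (D (J * N)%N) * hits_mgf nu v N tau J)).
      rewrite /hits_mgf -wsumZ; apply: ler_wsum => w sw.
      rewrite mulrA ler_wpM2r ?expR_ge0// (le_trans (dom w _)) ?sw//.
    apply: ler_pM; rewrite ?expR_ge0 ?ler_expR//.
      by apply: wsum_ge0 => w _; rewrite mulr_ge0// expR_ge0.
    apply: le_trans (hits_mgf_upper v tau snu e20 HL J) _.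
    rewrite -mulr_natl expRM_natl; apply: lerXn2r.
    - by rewrite nnegrE; nra.
    - by rewrite nnegrE expR_ge0.
    rewrite expRD; apply: ler_pM; rewrite ?expR_ge1Dx//; lra.
  have J0 : 0 < J%:R :> R by rewrite ltr0n.
  move: E; rewrite ler_expR => E; rewrite -(ler_pM2l J0); lra.
apply/ler_addgt0Pr => tau tau0.
have := key tau tau0; have := expR_ge1Dx (- tau).
have et : expR tau * expR (- tau) = 1 by rewrite -expRD subrr expR0.
have := nu'le1 v; have := nu'0 v; have := nu0 v; have := expR_gt0 (- tau).
set a := expR tau in et *; set b := expR (- tau) in et *; set x := nu v; set y := nu' v.
move=> b0 x0 y0 y1 Hb Hk.
have H1 : tau * y * b <= tau * x.
  apply: (@le_trans _ _ ((a - 1) * x * b)); first by rewrite ler_wpM2r// ltW.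
  by rewrite mulrAC mulrBl et mul1r ler_wpM2r// lerBlDr -lerBlDl// ; lra.
have H2 : y * b <= x by rewrite -(ler_pM2l tau0) mulrA.
have : y * (1 - tau) <= y * b by rewrite ler_wpM2l.
nra.
Qed.
End WordDistributions.

(** * Topology and measures on a symbolic space *)

Section SymbolicTopology.
Context {k : nat}.
Implicit Types (x y : symseq k) (w : seq 'I_k).

Lemma wordS x n : word x n.+1 = rcons (word x n) (x n).
Proof. by rewrite /word mkseqS. Qed.

Lemma word_cons x n : word x n.+1 = x 0%N :: word (shift x) n.
Proof. by rewrite /word /mkseq /= (iotaDl 1 0) -map_comp. Qed.

Lemma size_word x n : size (word x n) = n.
Proof. exact: size_mkseq. Qed.

Lemma iter_shift x n i : iter n shift x i = x (i + n)%N.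
Proof. by elim: n i => [|n IH] i; rewrite ?addn0//= /shift IH addSnnS. Qed.

Lemma word_cat x m n : word x (m + n) = word x m ++ word (iter m shift x) n.
Proof.
elim: m x => [//|m IH] x.
by rewrite addSn !word_cons IH iterSr.
Qed.

Lemma eq_word x y n : word x n = word y n -> forall i, (i < n)%N -> x i = y i.
Proof.
move=> E i ltin; have := congr1 (fun s => nth (x 0%N) s i) E.
by rewrite !nth_mkseq.
Qed.

Lemma sft_shift (A : 'M[bool]_k) x : sft A x -> sft A (shift x).
Proof. by move=> Ax n; exact: Ax. Qed.

Lemma sft_iter (A : 'M[bool]_k) x n : sft A x -> sft A (iter n shift x).
Proof. by move=> Ax; elim: n => [//|n IH]; exact: sft_shift. Qed.

Lemma word_eqP x y n : (forall i, (i < n)%N -> x i = y i) -> word x n = word y n.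
Proof.
by move=> E; apply/eq_in_map => i; rewrite mem_iota add0n => /andP[_ /E].
Qed.

(** a neighbourhood in a product constrains finitely many coordinates *)
Lemma nbhs_symseq x (U : set (symseq k)) :
  nbhs x U <-> exists n, [set y | word y n = word x n] `<=` U.
Proof.
split; last first.
  move=> [n nU]; apply: (filterS nU); elim: n {nU} => [|n IH].
    by apply: filterE => y; rewrite /word /mkseq.
  have : nbhs x (proj n @^-1` [set x n]).
    exact/proj_continuous/discrete_set1.
  move=> H; near=> y; rewrite /= !wordS; congr rcons.
    by near: y.
  by near: y.
pose F : set_system (symseq k) :=
  [set V | exists n, [set y | word y n = word x n] `<=` V].
have FF : Filter F.
  split=> [|P Q [n Pn] [m Qm]|P Q PQ [n Pn]]; first by exists 0%N.
    exists (maxn n m) => y /= /eq_word xy; split.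
      by apply: Pn => /=; apply: word_eqP => i ltin; rewrite xy// leq_max ltin.
    by apply: Qm => /=; apply: word_eqP => i ltin; rewrite xy// leq_max ltin orbT.
  by exists n; exact: subset_trans PQ.
suff : F --> x by apply.
apply/cvg_sup => i.
have surj : (fun f : symseq k => f i) @` setT = setT.
  by rewrite eqEsubset; split=> // a _; exists (fun=> a).
apply/(cvg_image _ FF surj) => V /nbhs_singleton Vx.
exists ((fun f : symseq k => f i) @^-1` V); last exact: image_preimage.
by exists i.+1 => y /= /eq_word ->.
Unshelve. all: by end_near.
Qed.

Lemma continuous_shift : continuous (@shift k).
Proof.
move=> x U /nbhs_symseq[n nU]; apply/nbhs_symseq; exists n.+1 => y.
by rewrite /= !word_cons => -[_ yx]; apply: nU.
Qed.

Lemma locally_constant_continuous (T : topologicalType) (f : symseq k -> T) n :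
  (forall x y, word x n = word y n -> f x = f y) -> continuous f.
Proof.
move=> fn x U /nbhs_singleton fxU; apply/nbhs_symseq; exists n => y /fn.
by move=> /= ->.
Qed.

Lemma open_cylinder w : open (cylinder (@setT (symseq k)) w).
Proof.
rewrite openE => x [_ xw]; apply/nbhs_symseq; exists (size w) => y /= yx.
by split=> //; rewrite yx.
Qed.

Lemma cylinder_setI (Y : set (symseq k)) w :
  cylinder Y w = Y `&` cylinder (@setT (symseq k)) w.
Proof. by rewrite eqEsubset; split=> y [Yy]; [|case=> _]. Qed.

Lemma cylinder_nil : cylinder (@setT (symseq k)) [::] = setT.
Proof. by rewrite eqEsubset. Qed.

Lemma open_cylinders (U : set (symseq k)) : open U ->
  U = \bigcup_(w in [set w | cylinder (@setT (symseq k)) w `<=` U])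
        cylinder (@setT (symseq k)) w.
Proof.
rewrite openE => oU; rewrite eqEsubset; split=> [x /oU/nbhs_symseq[n nU]|x].
  exists (word x n); last by split=> //; rewrite size_word.
  by move=> y [_]; rewrite size_word; exact: nU.
by move=> [w /= wU]; exact: wU.
Qed.

End SymbolicTopology.

Section SymbolicMeasure.
Context {k : nat} {R : realType}.
Local Notation seqT := (borel_symseq k).
Implicit Types (m : probability seqT R) (w : seq 'I_k.+1).

Definition cyl w : set seqT := cylinder (@setT (symseq k.+1)) w.

Lemma measurable_open (U : set (symseq k.+1)) : open U -> measurable (U : set seqT).
Proof. by move=> oU; exact: sub_sigma_algebra. Qed.

Lemma measurable_cyl w : measurable (cyl w).
Proof. by apply: measurable_open; exact: open_cylinder. Qed.

Lemma measurable_borelE :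
  @measurable _ seqT = <<s [set A | A = set0 \/ exists w, A = cyl w] >>.
Proof.
rewrite eqEsubset; split.
  apply: smallest_sub; first exact: smallest_sigma_algebra.
  move=> U oU; rewrite (open_cylinders oU).
  set G := [set A | _]; set P := [set w | _].
  have [s0 _ sU] := @smallest_sigma_algebra seqT setT G.
  pose F n : set seqT := if unpickle n is Some w then
    (if w \in P then cyl w else set0) else set0.
  have -> : \bigcup_(w in P) cylinder [set: symseq k.+1] w = \bigcup_n F n.
    rewrite eqEsubset; split=> [x [w Pw xw]|x [n _]].
      by exists (pickle w) => //; rewrite /F pickleK mem_set.
    by rewrite /F; case: unpickle => // w; case: ifPn => // /set_mem Pw xw; exists w.
  apply: sU => n; rewrite /F; case: unpickle => [w|]; last exact: s0.
  by case: ifPn => _; [apply: sub_gen_smallest; right; exists w|exact: s0].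
apply: smallest_sub; first exact: sigma_algebra_measurable.
by move=> A [->|[w ->]]; [exact: measurable0|exact: measurable_cyl].
Qed.

Lemma cyl_setI u w : (size u <= size w)%N ->
  cyl u `&` cyl w = if take (size u) w == u then cyl w else set0.
Proof.
move=> uw.
have tk x : word x (size w) = w -> take (size u) w = word x (size u).
  by move=> <-; rewrite -(subnKC uw) word_cat take_size_cat ?size_word.
case: eqP => [E|NE]; rewrite eqEsubset; split=> // x.
- by move=> [_ xw]; split=> //; split=> //; rewrite -(tk x).
- by move=> [[_ xu] [_ xw]]; apply: NE; rewrite (tk x).
Qed.

(** cylinders form a pi-system, so they determine a finite measure *)
Lemma eq_measure_cyl (m1 m2 : {measure set seqT -> \bar R}) :
  (m1 setT < +oo)%E -> (forall w, m1 (cyl w) = m2 (cyl w)) ->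
  forall B, measurable B -> m1 B = m2 B.
Proof.
move=> m1oo E; set G := [set A : set seqT | A = set0 \/ exists w, A = cyl w].
apply: (@measure_unique _ R seqT G (fun=> setT)).
- exact: measurable_borelE.
- move=> _ _ [->|[u ->]] [->|[w ->]]; rewrite ?set0I ?setI0; try by left.
  have [uw|/ltnW wu] := leqP (size u) (size w).
    by rewrite cyl_setI//; case: ifP => _; [right; exists w|left].
  by rewrite setIC cyl_setI//; case: ifP => _; [right; exists u|left].
- by move=> _; right; exists [::]; rewrite /cyl cylinder_nil.
- by rewrite eqEsubset; split=> // x _; exists 0%N.
- by move=> _ [->|[w ->]]; rewrite ?measure0.
- by move=> _.
Qed.

Lemma measurable_shift : measurable_fun [set: seqT] (@shift k.+1 : seqT -> seqT).
Proof.
apply: (@measurability _ _ seqT seqT setT (@shift k.+1 : seqT -> seqT) (@open (symseq k.+1))) => //.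
move=> _ [U oU <-]; rewrite setTI; apply: measurable_open.
by have /continuousP := @continuous_shift k.+1; exact.
Qed.

Definition word_law m w : R := fine (m (cyl w)).

Lemma word_lawE m w : m (cyl w) = (word_law m w)%:E.
Proof. by rewrite fineK// fin_num_measure//; exact: measurable_cyl. Qed.

Lemma word_law_ge0 m w : 0 <= word_law m w.
Proof. by rewrite fine_ge0. Qed.

Lemma word_law_nil m : word_law m [::] = 1.
Proof. by rewrite /word_law /cyl cylinder_nil probability_setT. Qed.

Lemma law_partition m (A : set seqT) (F : 'I_k.+1 -> set seqT)
    (e : seqT -> 'I_k.+1) :
  measurable A -> (forall a, measurable (F a)) ->
  (forall a x, F a x <-> A x /\ e x = a) -> (m A = \sum_a m (F a))%E.
Proof.
move=> mA mF FE; have AE : A = \big[setU/set0]_(a < k.+1) F a.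
  rewrite -bigcup_mkord_ord eqEsubset; split=> x.
    by move=> Ax; exists (e x) => /=; [exact: ltn_ord|rewrite inord_val; apply/FE].
  by move=> [i _ /FE[]].
rewrite {1}AE measure_semi_additive_ord// -?AE//.
by apply/trivIsetP => i j _ _ ij; rewrite -subset0 => x [/FE[_ ei] /FE[_ ej]]; rewrite -ei -ej eqxx in ij.
Qed.

Lemma word_law_rcons m w : word_law m w = \sum_a word_law m (rcons w a).
Proof.
apply: EFin_inj; rewrite -word_lawE -sumEFin.
rewrite (@law_partition m _ (fun a => cyl (rcons w a)) (fun x => x (size w))).
- by apply: eq_bigr => a _; rewrite word_lawE.
- exact: measurable_cyl.
- by move=> a; exact: measurable_cyl.
move=> a x; rewrite /cyl /cylinder /= size_rcons wordS; split.
  by move=> [_ /eqP]; rewrite eqseq_rcons => /andP[/eqP xw /eqP xa].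
by move=> [[_ ->] ->].
Qed.

Lemma word_law_cons m w :
  (forall B : set seqT, measurable B -> m (shift @^-1` B) = m B) ->
  word_law m w = \sum_a word_law m (a :: w).
Proof.
move=> inv; apply: EFin_inj; rewrite -word_lawE -sumEFin -inv; last exact: measurable_cyl.
rewrite (@law_partition m _ (fun a => cyl (a :: w)) (fun x => x 0%N)).
- by apply: eq_bigr => a _; rewrite word_lawE.
- by rewrite -[X in measurable X]setTI; apply: measurable_shift => //; exact: measurable_cyl.
- by move=> a; exact: measurable_cyl.
move=> a x; rewrite /cyl /cylinder /= word_cons; split.
  by move=> [_ [xa xw]].
by move=> [[_ ->] ->].
Qed.

Lemma stationary_word_law m :
  (forall B : set seqT, measurable B -> m (shift @^-1` B) = m B) ->
  stationary_dist (word_law m).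
Proof.
move=> inv; split; [exact: word_law_ge0|exact: word_law_nil| |].
  exact: word_law_rcons.
by move=> w; exact: word_law_cons.
Qed.

Lemma invariant_word_law m :
  (forall w, word_law m w = \sum_a word_law m (a :: w)) ->
  forall B : set seqT, measurable B -> m (shift @^-1` B) = m B.
Proof.
move=> cons B mB.
apply: (eq_measure_cyl (m1 := pushforward m (shift : seqT -> seqT))) => //.
  exact: measurable_shift.
  move=> ms; rewrite /= /pushforward preimage_setT probability_setT; exact: ltry.
move=> ms w; rewrite /= /pushforward.
rewrite (@law_partition m _ (fun a => cyl (a :: w)) (fun x => x 0%N)).
- rewrite word_lawE cons -sumEFin; apply: eq_bigr => a _; exact: word_lawE.
- by rewrite -[X in measurable X]setTI; apply: measurable_shift => //; exact: measurable_cyl.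
- by move=> a; exact: measurable_cyl.
move=> a x; rewrite /cyl /cylinder /= word_cons; split.
  by move=> [_ [xa xw]].
by move=> [[_ ->] ->].
Qed.

(** The complement of a closed set is a countable union of cylinders that miss
    the set. *)
Lemma closed_full_measure m (Y : set (symseq k.+1)) : closed Y ->
  (forall w, cylinder Y w = set0 -> word_law m w = 0) ->
  measurable (Y : set seqT) /\ m Y = 1%E.
Proof.
move=> cY nul; have oY : open (~` Y) by rewrite openC.
have mY : measurable (Y : set seqT).
  by rewrite -[Y]setCK; apply: measurableC; exact: measurable_open.
split=> //; rewrite -[Y]setCK probability_setC; last exact: measurableC.
suff -> : m (~` (Y : set seqT)) = 0%E by rewrite sube0.
pose P := [set w | cylinder (@setT (symseq k.+1)) w `<=` ~` Y].
pose F n : set seqT := if unpickle n is Some w then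
  (if w \in P then cyl w else set0) else set0.
have FE : ~` Y = \bigcup_n F n.
  rewrite (open_cylinders oY) eqEsubset; split=> [x [w Pw xw]|x [n _]].
    by exists (pickle w) => //; rewrite /F pickleK mem_set.
  by rewrite /F; case: unpickle => // w; case: ifPn => // /set_mem Pw xw; exists w.
have mF n : measurable (F n).
  by rewrite /F; case: unpickle => // w; case: ifP => // _; exact: measurable_cyl.
have F0 n : m (F n) = 0%E.
  rewrite /F; case: unpickle => [w|]; last by rewrite measure0.
  case: ifPn => [/set_mem Pw|_]; last by rewrite measure0.
  rewrite word_lawE nul// cylinder_setI -subset0 => x [Yx /Pw]; exact.
apply/eqP; rewrite eq_le measure_ge0 andbT FE.
apply: (@le_trans _ _ (\sum_(n <oo) m (F n))%E).
  by apply: measure_sigma_subadditive => //; exact: bigcup_measurable.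
by rewrite eseries0.
Qed.

End SymbolicMeasure.

(** * Extension of a law on words to a measure *)

Lemma ord2_cases (a : 'I_2) : a = 0 \/ a = 1.
Proof. by case: a => [[|[|//]] i]; [left|right]; exact: val_inj. Qed.

Section Coding.
Context {R : realType}.
Variable nu : seq 'I_2 -> R.
Hypotheses (nu_ge0 : forall w, 0 <= nu w) (nu_nil : nu [::] = 1).
Hypothesis nu_rcons : forall w, nu w = \sum_a nu (rcons w a).

(** The words of length [n] label consecutive intervals of lengths [nu w]
    covering the half-open unit interval; [left_end] is the left end point, the
    argument [u] being the part of the word already read. *)
Fixpoint left_end (u w : seq 'I_2) : R :=
  if w is a :: w' then
    (if a == 0 then 0 else nu (rcons u 0)) + left_end (rcons u a) w'
  else 0.

Lemma left_end_rcons u w a : left_end u (rcons w a) =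
  left_end u w + (if a == 0 then 0 else nu (rcons (u ++ w) 0)).
Proof.
elim: w u => [|b w IH] u /=; first by rewrite cats0 addr0 add0r.
by rewrite IH addrA cat_rcons.
Qed.

Lemma nu_split w : nu w = nu (rcons w 0) + nu (rcons w 1).
Proof. by rewrite nu_rcons big_ord_recl big_ord1; congr (_ + nu (rcons w _)); apply: val_inj. Qed.

Definition next_letter (t : R) w : 'I_2 :=
  if t < left_end [::] w + nu (rcons w 0) then 0 else 1.

Fixpoint coding_word (t : R) n : seq 'I_2 :=
  if n is n'.+1 then rcons (coding_word t n') (next_letter t (coding_word t n'))
  else [::].

Definition coding (t : measurableTypeR R) : borel_symseq 1 :=
  (fun n => next_letter t (coding_word t n)) : symseq 2.

Lemma word_coding t n : word (coding t) n = coding_word t n.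
Proof. by elim: n => [//|n IH]; rewrite wordS IH. Qed.

Lemma coding_interval t : 0 <= t < 1 -> forall w,
  (coding_word t (size w) == w) =
  (left_end [::] w <= t < left_end [::] w + nu w).
Proof.
move=> t01; elim/last_ind => [|w a IH].
  by rewrite /= add0r nu_nil t01 eqxx.
rewrite size_rcons /= eqseq_rcons; case: (eqVneq _ w) IH => [-> IH|nw IH] /=.
  rewrite left_end_rcons /next_letter; have := nu_split w.
  have /esym/andP[lt tr] := IH => split; rewrite /=.
  have [->|a1] := ord2_cases a.
  - by rewrite eqxx addr0 lt /=; case: ifP.
  - rewrite a1 /= [X in _ = (X && _)]leNgt.
    have -> : left_end [::] w + nu (rcons w 0) + nu (rcons w 1) = left_end [::] w + nu w.
      by rewrite split addrA.
    by rewrite tr andbT; case: ifP.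
apply/esym/negP; rewrite left_end_rcons => /andP[h1 h2]; move: IH => /esym/negP; apply.
have := nu_split w; have := nu_ge0 (rcons w 0); have := nu_ge0 (rcons w 1).
have [a0|a1] : a = 0 \/ a = 1.
- by case: a {h1 h2} => [[|[|//]] i]; [left|right]; apply: val_inj.
- by move: h1 h2; rewrite a0 eqxx; lra.
- by move: h1 h2; rewrite a1 /=; lra.
Qed.

Lemma left_end_bounds w : 0 <= left_end [::] w /\ left_end [::] w + nu w <= 1.
Proof.
elim/last_ind: w => [|w a [IH1 IH2]]; first by rewrite /= nu_nil; lra.
have := nu_split w; have := nu_ge0 (rcons w 0); have := nu_ge0 (rcons w 1).
rewrite left_end_rcons; have [->|->] := ord2_cases a.
- by rewrite eqxx; lra.
- by rewrite /=; lra.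
Qed.

Lemma measurable_coding : measurable_fun [set: measurableTypeR R] coding.
Proof.
apply: (@measurability _ _ _ _ _ _
  [set A | A = set0 \/ exists w : seq 'I_2, A = cyl w]).
  exact: measurable_borelE.
move=> _ [_ [->|[w ->]] <-]; rewrite setTI ?preimage_set0//.
rewrite (_ : _ @^-1` _ = [set t | coding_word t (size w) = w]); last first.
  rewrite eqEsubset; split=> t; rewrite /cyl /cylinder /= word_coding; first by case.
  by split.
elim/last_ind: w => [|w a IH].
  by rewrite (_ : mkset _ = setT)// eqEsubset.
pose c := left_end [::] w + nu (rcons w 0).
rewrite (_ : mkset _ = [set t | coding_word t (size w) = w] `&`
   (if a == 0 then [set` `]-oo, c[] else [set` `[c, +oo[])); last first.
  rewrite eqEsubset; split=> t /=; rewrite size_rcons /=.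
    move=> /eqP; rewrite eqseq_rcons => /andP[/eqP tw /eqP <-]; split=> //.
    rewrite tw /next_letter -/c.
    by case: (ltP t c) => tc /=; rewrite in_itv/= ?tc.
  move=> [tw]; rewrite tw /next_letter -/c => ac; congr rcons; move: ac.
  have [->|->] := ord2_cases a.
  - by rewrite eqxx /= in_itv/= => ->.
  - by rewrite /= in_itv/= andbT leNgt => /negbTE ->.
by apply: measurableI => //; case: ifP => _; exact: measurable_itv.
Qed.

HB.instance Definition _ := isMeasurableFun.Build _ _ _ _ coding measurable_coding.

Definition unit_itv_measure := mrestr (@lebesgue_measure R) (measurable_itv `[0, 1[).

HB.instance Definition _ := Measure.on unit_itv_measure.

Lemma unit_itv_measureT : unit_itv_measure setT = 1%E.
Proof.
by rewrite /unit_itv_measure /mrestr setTI lebesgue_measure_itv/= lte01 oppr0 adde0.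
Qed.

HB.instance Definition _ :=
  Measure_isProbability.Build _ _ _ unit_itv_measure unit_itv_measureT.

(** Kolmogorov extension: a consistent family of word probabilities is the law
    of a random sequence, here the coding of a uniformly distributed point. *)
Lemma word_law_exists :
  exists m : probability (borel_symseq 1) R, word_law m =1 nu.
Proof.
exists (distribution unit_itv_measure coding) => w.
rewrite /word_law /= /distribution /pushforward /unit_itv_measure /mrestr.
have -> : coding @^-1` cyl w `&` `[0, 1[%classic =
    [set` `[left_end [::] w, left_end [::] w + nu w[].
  have [l0 l1] := left_end_bounds w.
  rewrite eqEsubset; split=> t; rewrite /cyl /cylinder /= word_coding !in_itv/=.
    by move=> [[_ tw] t01]; rewrite -coding_interval// tw.
  move=> tI; have t01 : 0 <= t < 1 by move: tI => /andP[]; lra.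
  by split=> //; split=> //; apply/eqP; rewrite coding_interval.
rewrite lebesgue_measure_itv/= lte_fin; case: ifP => [_|].
  by rewrite -EFinD /= addrAC subrr add0r.
by rewrite ltrDl => /negbT; rewrite -leNgt => h; apply/eqP; rewrite eq_le h nu_ge0.
Qed.

End Coding.

(** * The hidden chain *)

Definition letter (i : 'I_3) : 'I_2 := if i == 0 then 0 else 1.

(** The Markov chain on three states with transition probabilities
    [K i j * h j / (lam * h i)], seen through [letter].  It is kept in
    unnormalised form, which is linear in the data of a potential. *)
Record hidden_chain (R : realType) := HiddenChain {
  hc_K : 'M[R]_3;
  hc_S : {set 'I_3};
  hc_m : nat;
  hc_lam : R;
  hc_l : 'rV[R]_3;
  hc_h : 'cV[R]_3;
  hc_m_gt0 : (0 < hc_m)%N;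
  hc_0S : 0 \in hc_S;
  hc_prim : primitive_on hc_S hc_K hc_m;
  hc_perron : perron_data hc_S hc_K hc_lam hc_l hc_h }.

Section HiddenChain.
Context {R : realType} (c : hidden_chain R).
Local Notation K := (hc_K c).
Local Notation S := (hc_S c).
Local Notation lam := (hc_lam c).
Local Notation l := (hc_l c).
Local Notation h := (hc_h c).
Implicit Types (u w : seq 'I_2) (i j : 'I_3).

Definition emit (a : 'I_2) : 'M[R]_3 :=
  \matrix_(i, j) (if letter i == a then K i j else 0).

Definition emits w : 'M[R]_3 := \prod_(a <- w) emit a.

Definition weight w : R := (l *m emits w *m h) 0 0.

(** the law of the words emitted by the stationary chain, whose state [i] has
    probability [l i * h i] *)
Definition chain_law w : R := lam ^- size w * weight w.

Lemma emits_nil : emits [::] = 1. Proof. by rewrite /emits big_nil. Qed.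

Lemma emits_cons a w : emits (a :: w) = emit a *m emits w.
Proof. by rewrite /emits big_cons. Qed.

Lemma emits_cat u w : emits (u ++ w) = emits u *m emits w.
Proof. by rewrite /emits big_cat. Qed.

Lemma sum_emit : \sum_a emit a = K.
Proof.
apply/matrixP => i j; rewrite summxE (bigD1 (letter i))//= mxE eqxx big1 ?addr0//.
by move=> a; rewrite eq_sym mxE => /negbTE ->.
Qed.

Lemma wsum_mxE p q n (F : seq 'I_2 -> 'M[R]_(p, q)) (i : 'I_p) (j : 'I_q) :
  wsum n F i j = wsum n (fun w => F w i j).
Proof.
elim: n F => [//|n IH] F /=.
by rewrite summxE; apply: eq_bigr => a _; rewrite IH.
Qed.

Lemma wsum_mxl p q r n (F : seq 'I_2 -> 'M[R]_(p, q)) (A : 'M[R]_(q, r)) :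
  wsum n F *m A = wsum n (fun w => F w *m A).
Proof.
elim: n F => [//|n IH] F /=.
by rewrite mulmx_suml; apply: eq_bigr => a _; rewrite IH.
Qed.

Lemma wsum_mxr p q r n (A : 'M[R]_(p, q)) (F : seq 'I_2 -> 'M[R]_(q, r)) :
  A *m wsum n F = wsum n (fun w => A *m F w).
Proof.
elim: n F => [//|n IH] F /=.
by rewrite mulmx_sumr; apply: eq_bigr => a _; rewrite IH.
Qed.

Lemma wsum_emits n : wsum n emits = K ^+ n.
Proof.
elim: n => [|n IH] /=; first by rewrite emits_nil expr0.
rewrite exprS -mulmxE -IH -{1}sum_emit mulmx_suml; apply: eq_bigr => a _.
by rewrite wsum_mxr; apply: eq_wsum => w _; rewrite emits_cons.
Qed.

Lemma lam_gt0 : 0 < lam. Proof. by have [] := hc_perron c. Qed.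

Lemma l_ge0 : mx_nonneg l. Proof. by have [] := perron_ge0 (hc_perron c). Qed.

Lemma h_ge0 : mx_nonneg h. Proof. by have [] := perron_ge0 (hc_perron c). Qed.

Lemma lh_gt0 i : i \in S -> 0 < l 0 i /\ 0 < h i 0.
Proof. by move=> iS; have [_ _ _ _ /(_ i)] := hc_perron c; rewrite iS. Qed.

Lemma lh_eq0 i : i \notin S -> l 0 i = 0 /\ h i 0 = 0.
Proof. by move=> iS; have [_ _ _ _ /(_ i)] := hc_perron c; rewrite (negbTE iS). Qed.

Lemma emit_ge0 a : mx_nonneg (emit a).
Proof. by move=> i j; rewrite mxE; case: ifP => // _; have [] := hc_prim c. Qed.

Lemma emits_ge0 w : mx_nonneg (emits w).
Proof.
elim: w => [|a w IH]; last first.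
  by rewrite emits_cons; apply: mx_nonneg_mul => //; exact: emit_ge0.
by rewrite emits_nil => i j; rewrite mxE; case: eqP.
Qed.

Lemma weightE w : weight w = \sum_i \sum_j l 0 i * emits w i j * h j 0.
Proof.
rewrite /weight mxE; under eq_bigr do rewrite mxE mulr_suml.
by rewrite exchange_big.
Qed.

Lemma weight_ge0 w : 0 <= weight w.
Proof.
rewrite weightE sumr_ge0// => i _; rewrite sumr_ge0// => j _.
by rewrite !mulr_ge0// ?l_ge0 ?h_ge0// emits_ge0.
Qed.

Lemma ler_weight w i j : l 0 i * emits w i j * h j 0 <= weight w.
Proof.
have nn i' j' : 0 <= l 0 i' * emits w i' j' * h j' 0.
  by rewrite !mulr_ge0// ?l_ge0 ?h_ge0// emits_ge0.
rewrite weightE (bigD1 i)//= (bigD1 j)//= -addrA lerDl addr_ge0//.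
  by rewrite sumr_ge0.
by rewrite sumr_ge0// => i' _; rewrite sumr_ge0.
Qed.

Lemma weight_nil : weight [::] = 1.
Proof. by rewrite /weight emits_nil mulmx1; have [] := hc_perron c. Qed.

Lemma chain_law_stationary : stationary_dist chain_law.
Proof.
have [lam0 lK Kh lh _] := hc_perron c.
split=> [w||w|w].
- by rewrite mulr_ge0 ?weight_ge0// invr_ge0 exprn_ge0// ltW.
- by rewrite /chain_law weight_nil expr0 invr1 mulr1.
- under eq_bigr do rewrite /chain_law size_rcons.
  rewrite -mulr_sumr /chain_law.
  have -> : \sum_a weight (rcons w a) = lam * weight w.
    under eq_bigr do rewrite /weight -cats1 emits_cat emits_cons emits_nil mulmx1 -!mulmxA.
    rewrite -summxE -!mulmx_sumr -mulmx_suml sum_emit Kh -!scalemxAr mxE.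
    by rewrite /weight mulmxA.
  by rewrite exprSr invfM mulrA divfK// gt_eqF.
- under eq_bigr do rewrite /chain_law /=.
  rewrite -mulr_sumr /chain_law.
  have -> : \sum_a weight (a :: w) = lam * weight w.
    under eq_bigr do rewrite /weight emits_cons !mulmxA.
    rewrite -summxE -!mulmx_suml -mulmx_sumr sum_emit lK -!scalemxAl mxE.
    by rewrite /weight.
  by rewrite exprSr invfM mulrA divfK// gt_eqF.
Qed.

Lemma emits_row_out u i j : (0 < size u)%N -> i \notin S -> emits u i j = 0.
Proof.
case: u => // a u _ iS; rewrite emits_cons mxE big1// => k _.
rewrite mxE; case: ifP => _; last by rewrite mul0r.
by have [_ KS _] := hc_prim c; rewrite KS ?mul0r// (negbTE iS).
Qed.

(** a long gap inserts a power of [K], which is, up to normalisation, at most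
    [1 + eps] times the rank-one matrix that separates the two words *)
Lemma chain_law_mixing : psi_mixing chain_law.
Proof.
move=> eps eps0.
have [N N0 HN] := perron_domination (hc_m_gt0 c) (hc_prim c) (hc_perron c) eps0.
exists N => u z.
pose x := l *m emits u; pose y := emits z *m h.
have x0 : mx_nonneg x by apply: mx_nonneg_mul; [exact: l_ge0|exact: emits_ge0].
have y0 : mx_nonneg y by apply: mx_nonneg_mul; [exact: emits_ge0|exact: h_ge0].
have E : wsum N (fun w => weight (u ++ w ++ z)) = (x *m K ^+ N *m y) 0 0.
  rewrite -wsum_emits wsum_mxr wsum_mxl wsum_mxE.
  by apply: eq_wsum => w _; rewrite /weight !emits_cat !mulmxA.
have le : (x *m K ^+ N *m y) 0 0 <= lam ^+ N * (1 + eps) * (weight u * weight z).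
  have -> : weight z = (l *m y) 0 0 by rewrite /weight mulmxA.
  have -> : weight u * (l *m y) 0 0 = (x *m h *m l *m y) 0 0.
    by rewrite -[RHS]/((x *m h *m l *m y) 0 0) -[x *m h *m l *m y]mulmxA [RHS]mxE big_ord1.
  rewrite -[x *m h *m l]mulmxA !mxE mulr_sumr; apply: ler_sum => j _.
  rewrite mulrA ler_wpM2r//.
  rewrite !mxE mulr_sumr; apply: ler_sum => i _.
  rewrite mulrCA ler_wpM2l//.
  by rewrite [X in _ <= _ * X]mxE big_ord1 HN.
have lam0 := lam_gt0.
rewrite (_ : wsum N _ = lam ^- (size u + N + size z) *
    wsum N (fun w => weight (u ++ w ++ z))); last first.
  rewrite -wsumZ; apply: eq_wsum => w sw.
  by rewrite /chain_law !size_cat sw addnA.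
rewrite E /chain_law; apply: le_trans (ler_wpM2l _ le) _.
  by rewrite invr_ge0 exprn_ge0// ltW.
rewrite le_eqVlt; apply/orP; left; apply/eqP.
rewrite !exprD !invfM; field.
by rewrite !expf_neq0// gt_eqF.
Qed.

(** A path that emits [u ++ w] is a pair of paths with a common state; the
    constant makes up for the factors [l] and [h] of this state. *)
Lemma weight_submul : exists2 C : R, 0 < C &
  forall u w, weight (u ++ w) <= C * (weight u * weight w).
Proof.
pose C := 1 + \sum_(i in S) (l 0 i * h i 0)^-1.
have C0 : 0 < C.
  rewrite ltr_pwDl// sumr_ge0// => i _.
  by rewrite invr_ge0 mulr_ge0 ?l_ge0 ?h_ge0.
exists C => // u w.
have [->|w0] := eqVneq w [::].
  rewrite cats0 weight_nil mulr1 ler_peMl ?weight_ge0//.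
  rewrite lerDl sumr_ge0// => i _; by rewrite invr_ge0 mulr_ge0 ?l_ge0 ?h_ge0.
pose x := l *m emits u; pose y := emits w *m h.
have x0 : mx_nonneg x by apply: mx_nonneg_mul; [exact: l_ge0|exact: emits_ge0].
have y0 : mx_nonneg y by apply: mx_nonneg_mul; [exact: emits_ge0|exact: h_ge0].
have -> : weight (u ++ w) = (x *m y) 0 0 by rewrite /weight emits_cat !mulmxA.
have -> : weight u * weight w = (x *m h) 0 0 * (l *m y) 0 0.
  by rewrite /weight !mulmxA.
rewrite [(x *m y) 0 0]mxE.
apply: (@le_trans _ _ (\sum_(i in S) x 0 i * y i 0)).
  rewrite [X in X <= _](bigID (mem S))/= [X in _ + X]big1 ?addr0// => i iS.
  rewrite /y [(_ *m h) i 0]mxE big1 ?mulr0// => j _.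
  by rewrite emits_row_out ?mul0r// lt0n size_eq0.
apply: (@le_trans _ _ (\sum_(i in S) (l 0 i * h i 0)^-1 * ((x *m h) 0 0 * (l *m y) 0 0))).
  apply: ler_sum => i iS; have [li hi] := lh_gt0 iS.
  rewrite [X in _ <= X]mulrC ler_pdivlMr ?mulr_gt0//.
  rewrite (_ : _ * _ * _ = (x 0 i * h i 0) * (l 0 i * y i 0)); last by ring.
  apply: ler_pM; rewrite ?mulr_ge0// ?(ltW li) ?(ltW hi)//.
    by rewrite [X in _ <= X]mxE (bigD1 i)//= lerDl sumr_ge0// => j _; rewrite mulr_ge0// h_ge0.
  by rewrite [X in _ <= X]mxE (bigD1 i)//= lerDl sumr_ge0// => j _; rewrite mulr_ge0// l_ge0.
rewrite -mulr_suml ler_wpM2r ?mulr_ge0 ?lerDr//.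
  exact: (mx_nonneg_mul x0 h_ge0).
exact: (mx_nonneg_mul l_ge0 y0).
Qed.

(** As only state 0 emits the letter 0, weights factor at each such letter. *)
Definition weight_before u : R := (l *m emits u) 0 0.
Definition weight_from w : R := (emits w *m h) 0 0.
Definition loop_weight w : R := emits w 0 0.

Lemma emits0_row w i j : i != 0 -> emits (0 :: w) i j = 0.
Proof.
move=> i0; rewrite emits_cons mxE big1// => k _.
by rewrite mxE /letter (negbTE i0) mul0r.
Qed.

Lemma weight_renewal u w : weight (u ++ 0 :: w) = weight_before u * weight_from (0 :: w).
Proof.
have -> : weight (u ++ 0 :: w) = (l *m emits u *m (emits (0 :: w) *m h)) 0 0.
  by rewrite /weight emits_cat !mulmxA.
rewrite mxE (bigD1 0)//= big1 ?addr0// => k k0.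
by rewrite [(emits (0 :: w) *m h) k 0]mxE big1 ?mulr0// => j _; rewrite emits0_row ?mul0r.
Qed.

Lemma weight_from_renewal u w :
  weight_from (u ++ 0 :: w) = loop_weight u * weight_from (0 :: w).
Proof.
have -> : weight_from (u ++ 0 :: w) = (emits u *m (emits (0 :: w) *m h)) 0 0.
  by rewrite /weight_from emits_cat !mulmxA.
rewrite mxE (bigD1 0)//= big1 ?addr0// => k k0.
by rewrite [(emits (0 :: w) *m h) k 0]mxE big1 ?mulr0// => j _; rewrite emits0_row ?mul0r.
Qed.

Lemma loop_weight_ge0 w : 0 <= loop_weight w. Proof. exact: emits_ge0. Qed.

Lemma loop_weight_le w : l 0 0 * loop_weight w * h 0 0 <= weight w.
Proof. exact: ler_weight. Qed.

Lemma weight_power w n : weight (flatten (nseq n.+1 (0 :: w))) =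
  l 0 0 * (loop_weight (0 :: w) ^+ n * weight_from (0 :: w)).
Proof.
rewrite [flatten _](_ : _ = [::] ++ 0 :: (w ++ flatten (nseq n (0 :: w))))//.
rewrite weight_renewal /weight_before emits_nil mulmx1; congr (_ * _).
elim: n => [|n IH]; first by rewrite cats0 expr0 mul1r.
rewrite (_ : 0 :: _ = (0 :: w) ++ 0 :: (w ++ flatten (nseq n (0 :: w))))//.
by rewrite weight_from_renewal IH exprS mulrA.
Qed.

(** the chain lives above the shift of finite type with transition matrix [B],
    in which only the transition from 0 to 0 may be forbidden *)
Definition carried (B : 'M[bool]_2) :=
  [/\ forall a, B a 1, forall a, B 1 a,
      forall i j, 0 < K i j -> B (letter i) (letter j) &
      forall y, sft B y -> forall n, 0 < weight (word y n)].

Section Carried.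
Variable B : 'M[bool]_2.
Hypothesis cB : carried B.
Local Notation Y := (sft B).

Lemma sft_path y a n : Y y -> (B a (y 0%N)) -> path (fun a b => B a b) a (word y n).
Proof.
elim: n y a => [//|n IH] y a Yy Ba; rewrite word_cons /= Ba /=.
by apply: IH; [exact: sft_shift|exact: Yy].
Qed.

Lemma emits_path a w i j : 0 < emits (a :: w) i j ->
  letter i = a /\ path (fun a b => B a b) a (rcons w (letter j)).
Proof.
have [_ _ KB _] := cB; have [K0 _ _] := hc_prim c.
have ea b x y : 0 < emit b x y -> letter x = b /\ 0 < K x y.
  by rewrite mxE; case: eqP => // _; rewrite ltxx.
elim: w a i => [|b w IH] a i; rewrite emits_cons.
  by rewrite emits_nil mulmx1 => /ea[<- /KB Bab]; rewrite /= Bab.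
move=> /mx_nonneg_mul_gt0[||k [/ea[<- /KB Bik] /IH[<- pk]]].
- exact: emit_ge0.
- exact: emits_ge0.
by rewrite /= Bik.
Qed.

(** the word is continued by the letter 1 forever *)
Lemma weight_gt0_point w : 0 < weight w -> exists2 y, Y y & word y (size w) = w.
Proof.
have [B1 B1' _ _] := cB => w0.
pose y : symseq 2 := fun i : nat => nth 1 w i; exists y; last first.
  apply: (@eq_from_nth _ 1) => [|i]; rewrite size_word// => iw.
  by rewrite nth_mkseq.
have pw : forall a s, w = a :: s -> path (fun a b => B a b) a s.
  move=> a s E; move: w0; rewrite E weightE => /lt0r_neq0/eqP/psumr_neq0P[i _|i].
    by rewrite sumr_ge0// => j _; rewrite !mulr_ge0// ?l_ge0 ?h_ge0// emits_ge0.
  move=> /= /lt0r_neq0/eqP/psumr_neq0P[j _|j /= e0].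
    by rewrite !mulr_ge0// ?l_ge0 ?h_ge0// emits_ge0.
  have : 0 < emits (a :: s) i j.
    rewrite lt_neqAle emits_ge0 andbT eq_sym; apply/negP => /eqP E0.
    by rewrite E0 mulr0 mul0r ltxx in e0.
  by move=> /emits_path[_]; rewrite rcons_path => /andP[].
move=> n; rewrite /y; case: (ltnP n.+1 (size w)) => [nw|wn]; last first.
  by rewrite [X in B _ X]nth_default.
case: w pw nw {w0 y} => [//|a s] /(_ a s erefl) /(pathP 1) H /= nw.
exact: H.
Qed.

Definition cyclic_seq w : symseq 2 := fun i : nat => nth 0 w (i %% size w)%N.

Lemma periodic_sft w : path (fun a b => B a b) 0 (rcons w 0) -> Y (cyclic_seq (0 :: w)).
Proof.
move=> /(pathP 0); rewrite size_rcons => H n; rewrite /cyclic_seq.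
set N := size (0 :: w); have nN : (n %% N < N)%N by rewrite ltn_pmod.
have := H (n %% N)%N nN.
have -> : nth 0 (0 :: rcons w 0) (n %% N) = nth 0 (0 :: w) (n %% N).
  by rewrite -rcons_cons nth_rcons nN.
have -> // : nth 0 (rcons w 0) (n %% N) = nth 0 (0 :: w) (n.+1 %% N).
have -> : (n.+1 %% N = (n %% N).+1 %% N)%N by rewrite -(addn1 (n %% N)%N) modnDml addn1.
rewrite nth_rcons.
have [lt|ge] := ltnP (n %% N) (size w); first by rewrite (@modn_small (n %% N).+1 N).
have -> : (n %% N).+1 = N by apply/eqP; rewrite eqn_leq nN ltnS.
by rewrite modnn; case: ifP => // _; rewrite if_same.
Qed.

Lemma word_periodic_add w n : (0 < size w)%N ->
  word (cyclic_seq w) (size w + n) = w ++ word (cyclic_seq w) n.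
Proof.
move=> w0; rewrite word_cat; congr (_ ++ _).
  apply: (@eq_from_nth _ 0) => [|i]; rewrite size_word// => iw.
  by rewrite nth_mkseq// /cyclic_seq modn_small.
by apply: word_eqP => i _; rewrite iter_shift /cyclic_seq modnDr.
Qed.

Lemma iter_shift_periodic w : iter (size w) shift (cyclic_seq w) = cyclic_seq w.
Proof. by apply/funext => i; rewrite iter_shift /cyclic_seq modnDr. Qed.

Lemma word_periodic w n : (0 < size w)%N ->
  word (cyclic_seq w) (n * size w) = flatten (nseq n w).
Proof. by move=> w0; elim: n => [//|n IH]; rewrite mulSn word_periodic_add// IH. Qed.

Lemma sft_no00 y : (forall i : nat, y i = 1 \/ y i.+1 = 1) -> Y y.
Proof. by have [B1 B1' _ _] := cB => H i; case: (H i) => ->. Qed.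

(** a loop of weight 0 could not be run through twice *)
Lemma loop_weight_gt0 w : Y (cyclic_seq (0 :: w)) -> 0 < loop_weight (0 :: w).
Proof.
have [_ _ _ pos] := cB.
move=> /pos/(_ (2 * (size w).+1)%N); rewrite (@word_periodic (0 :: w))//.
rewrite weight_power expr1 => lw0.
rewrite lt_neqAle loop_weight_ge0 andbT eq_sym.
by apply/negP => /eqP E; rewrite E mul0r mulr0 ltxx in lw0.
Qed.

End Carried.
End HiddenChain.

(** * The chain of a factor map *)

Section PathWeights.
Context {R : realType} (c : hidden_chain R).
Local Notation K := (hc_K c).
Local Notation l := (hc_l c).
Local Notation h := (hc_h c).

Fixpoint path_prod (i : 'I_3) (u : seq 'I_3) : R :=
  if u is j :: u' then K i j * path_prod j u' else 1.

(** The factor [lam * h] is the transition out of the last state [i], being the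
    sum over the next states [j] of [K i j * h j]. *)
Definition path_weight (u : seq 'I_3) : R :=
  if u is i :: u' then l 0 i * (path_prod i u' * (hc_lam c * h (last i u') 0)) else 0.

Lemma weight_paths a w : weight c (a :: w) =
  wsum (size w).+1 (fun u => path_weight u * (map letter u == a :: w)%:R).
Proof.
have key : forall w a i, (emits c (a :: w) *m h) i 0 = (letter i == a)%:R *
    wsum (size w) (fun u => path_prod i u * (hc_lam c * h (last i u) 0) *
      (map letter u == w)%:R).
  elim=> [|b w' IH] a' i.
    have [_ _ Kh _ _] := hc_perron c.
    rewrite emits_cons emits_nil mulmx1 /= mul1r mulr1.
    transitivity ((letter i == a')%:R * (K *m h) i 0); last by rewrite Kh mxE.
    rewrite !mxE mulr_sumr; apply: eq_bigr => j _; rewrite mxE.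
    by case: eqP => _; rewrite ?mul1r// !mul0r.
  rewrite emits_cons -mulmxA mxE /= mulr_sumr; apply: eq_bigr => j _.
  rewrite IH -!wsumZ; apply: eq_wsum => u _.
  rewrite mxE eqseq_cons; case: (letter i == a'); case: (letter j == b);
    rewrite /= ?mulr0 ?mul0r//; ring.
have -> : weight c (a :: w) = (l *m (emits c (a :: w) *m h)) 0 0.
  by rewrite /weight mulmxA.
rewrite mxE /=; apply: eq_bigr => i _; rewrite key -!wsumZ.
apply: eq_wsum => u _; rewrite eqseq_cons; case: (letter i == a) => /=.
  by rewrite mul1r mulrA.
by rewrite !mul0r !mulr0.
Qed.

Lemma path_prod_rcons i u j : path_prod i (rcons u j) = path_prod i u * K (last i u) j.
Proof. by elim: u i => [|k u IH] i /=; rewrite ?mul1r ?mulr1// IH mulrA. Qed.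

Lemma path_prod_ge0 i u : 0 <= path_prod i u.
Proof.
by elim: u i => [|k u IH] i //=; rewrite mulr_ge0//; have [] := hc_prim c.
Qed.

End PathWeights.

Section RelativePressure.
Context {R : realType}.
Variables (A : 'M[bool]_3) (f : symseq 3 -> R) (c : hidden_chain R).
Local Notation X := (sft A).
Hypothesis hf : two_coordinates X f.

(** The transition matrix of an irreducible shift may have symbols that start no
    point, and may then fail to be irreducible itself. *)
Definition live : {set 'I_3} := [set i | `[< exists2 x, X x & x 0%N = i >]].

Lemma liveP i : reflect (exists2 x, X x & x 0%N = i) (i \in live).
Proof. by rewrite inE; exact: asboolP. Qed.

Lemma mem_live x n : X x -> x n \in live.
Proof.
move=> Xx; apply/liveP; exists (iter n shift x).
  by move=> i; rewrite !iter_shift; exact: Xx.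
by rewrite iter_shift.
Qed.

Definition live_mx : 'M[R]_3 := \matrix_(i, j)
  (if (i \in live) && (j \in live) then potential_mx A f i j else 0).

Definition scons (i : 'I_3) (x : symseq 3) : symseq 3 :=
  fun n : nat => if n is n'.+1 then x n' else i.

Lemma live_mxE x n : X x -> live_mx (x n) (x n.+1) = expR (f (iter n shift x)).
Proof.
move=> Xx; rewrite mxE !mem_live//= mxE (Xx n) mulr1; congr expR.
have w2 : word (iter n shift x) 2 = [:: x n; x n.+1].
  by rewrite /word /mkseq /= !iter_shift.
have [Xg wg] : cylinder X [:: x n; x n.+1] (get (cylinder X [:: x n; x n.+1])).
  by apply: getPex; exists (iter n shift x); split; first exact: sft_iter.
by rewrite /two_coord_val; apply: hf => //; [exact: sft_iter|rewrite w2].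
Qed.

Lemma live_mx_gt0 i j : (0 < live_mx i j) = [&& i \in live, j \in live & A i j].
Proof.
rewrite mxE; case: (i \in live); case: (j \in live) => //=; rewrite ?ltxx// mxE.
by case: (A i j); rewrite ?mulr1 ?expR_gt0// mulr0 ltxx.
Qed.

Lemma live_mx_ge0 : mx_nonneg live_mx.
Proof.
move=> i j; rewrite mxE; case: ifP => // _; rewrite mxE mulr_ge0 ?expR_ge0//.
Qed.

Hypotheses (cK : hc_K c = live_mx) (cS : hc_S c = live).

Lemma expR_birkhoff x n : X x ->
  expR (birkhoff n f x) = path_prod c (x 0%N) (word (shift x) n).
Proof.
move=> Xx; elim: n => [|n IH]; first by rewrite /birkhoff big_ord0 expR0.
rewrite wordS path_prod_rcons -IH /birkhoff big_ord_recr expRD.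
congr (_ * _); rewrite -live_mxE// -cK.
case: n {IH} => [|n]; first by [].
by rewrite wordS last_rcons.
Qed.

Lemma path_prod_cylinder i u : 0 < path_prod c i u -> last i u \in live ->
  cylinder X (i :: u) !=set0.
Proof.
elim: u i => [|j u IH] i /=.
  by move=> _ /liveP[x Xx <-]; exists x; split.
move=> p0 lu; have pj : 0 < path_prod c j u.
  rewrite lt_neqAle path_prod_ge0 andbT eq_sym; apply/negP => /eqP E.
  by rewrite E mulr0 ltxx in p0.
have Kij : 0 < live_mx i j by rewrite -cK; move: p0; rewrite pmulr_lgt0.
have [x [Xx xu]] := IH j pj lu.
move: Kij; rewrite live_mx_gt0 => /and3P[_ _ Aij].
exists (scons i x); split.
  case=> [|n] /=; last exact: Xx.
  by move: xu; rewrite /= word_cons => -[-> _].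
by rewrite /= word_cons; congr (_ :: _).
Qed.

(** Both sides are products of the same entries of [K], except at the two ends
    of the word, where finitely many values occur. *)
Lemma path_weight_bounds : exists2 C : R, 0 < C & forall x n, X x ->
  path_weight c (word x n.+1) <= C * expR (birkhoff n.+1 f x) /\
  expR (birkhoff n.+1 f x) <= C * path_weight c (word x n.+1).
Proof.
pose F (ij : 'I_3 * 'I_3) := hc_l c 0 ij.1 * (hc_lam c * hc_h c ij.2 0).
pose C := 1 + \sum_ijk (F ijk.1 / live_mx ijk.1.2 ijk.2) +
          \sum_ijk (live_mx ijk.1.2 ijk.2 / F ijk.1).
have F0 ij : 0 <= F ij.
  by rewrite mulr_ge0 ?l_ge0// mulr_ge0 ?h_ge0// ltW// lam_gt0.
have r1 ijk : 0 <= F ijk.1 / live_mx ijk.1.2 ijk.2 by rewrite divr_ge0// live_mx_ge0.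
have r2 ijk : 0 <= live_mx ijk.1.2 ijk.2 / F ijk.1 by rewrite divr_ge0// live_mx_ge0.
have s1 : 0 <= \sum_ijk (F ijk.1 / live_mx ijk.1.2 ijk.2) by exact: sumr_ge0.
have s2 : 0 <= \sum_ijk (live_mx ijk.1.2 ijk.2 / F ijk.1) by exact: sumr_ge0.
have C1 ijk : F ijk.1 / live_mx ijk.1.2 ijk.2 <= C.
  rewrite /C -addrA addrCA (bigD1 ijk)//= -addrA lerDl.
  by rewrite !addr_ge0// sumr_ge0.
have C2 ijk : live_mx ijk.1.2 ijk.2 / F ijk.1 <= C.
  rewrite /C addrC (bigD1 ijk)//= -addrA lerDl.
  by rewrite !addr_ge0// sumr_ge0.
have C0 : 0 < C by rewrite /C -addrA ltr_pwDl// addr_ge0.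
exists C => // x n Xx; rewrite expR_birkhoff// [word (shift x) _]wordS path_prod_rcons.
rewrite [word x _]word_cons /= cK; set P := path_prod _ _ _.
have -> : last (x 0%N) (word (shift x) n) = x n.
  by case: n {P} => [//|n]; rewrite wordS last_rcons.
have K0 : 0 < live_mx (x n) (shift x n).
  rewrite live_mx_gt0 (mem_live n Xx) (mem_live n.+1 Xx).
  exact: (Xx n).
have F00 : 0 < F (x 0%N, x n).
  have l0 i : i \in live -> 0 < hc_l c 0 i /\ 0 < hc_h c i 0.
    by rewrite -cS; exact: lh_gt0.
  have [l1 _] := l0 _ (mem_live 0 Xx); have [_ h1] := l0 _ (mem_live n Xx).
  by rewrite /F mulr_gt0//= mulr_gt0//; exact: lam_gt0.
have P0 : 0 <= P by exact: path_prod_ge0.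
rewrite (_ : hc_l c 0 (x 0%N) * _ = P * F (x 0%N, x n)); last by rewrite /F /=; ring.
split.
  rewrite [C * _]mulrCA ler_wpM2l// -ler_pdivrMr//.
  exact: (C1 ((x 0%N, x n), shift x n)).
rewrite [C * _]mulrCA ler_wpM2l// -ler_pdivrMr//.
exact: (C2 ((x 0%N, x n), shift x n)).
Qed.

(** The sum over a section has one term for each path above the word
    [word y n], comparable to the weight of this path. *)
Lemma relative_g_bounds (p : 'I_3 -> 'I_2) : p =1 letter ->
  exists2 C : R, 0 < C & forall n y, (0 < n)%N ->
    (exists2 x, X x & map p (word x n) = word y n) ->
    weight c (word y n) <= C * relative_g X p f n y /\
    relative_g X p f n y <= C * weight c (word y n).
Proof.
move=> pE; have [C C0 HC] := path_weight_bounds.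
exists C => // n y n0 [x0 Xx0 x0y].
pose cond u := `[< cylinder X u !=set0 >] && (map p u == word y n).
pose sec E := is_section X p n y E.
have wE : weight c (word y n) = \sum_(u <- words (T:='I_3) n | cond u) path_weight c u.
  case: n n0 @cond @sec x0y => // n _ cond sec x0y.
  rewrite word_cons weight_paths wsum_words size_word -word_cons.
  rewrite [RHS]big_mkcond; apply: eq_big_seq => u; rewrite mem_words /cond => /eqP su.
  rewrite (eq_map pE); case: eqP => _; last by rewrite andbF mulr0.
  rewrite andbT mulr1; case: ifPn => // /asboolP ne.
  case: u su ne => [//|i u] _ ne /=.
  have [lu|lu] := boolP (last i u \in live); last first.
    rewrite -cS in lu; have [_ ->] := lh_eq0 lu; by rewrite !mulr0.
  have [->|pn] := eqVneq (path_prod c i u) 0; first by rewrite mul0r mulr0.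
  exfalso; apply: ne; apply: path_prod_cylinder => //.
  by rewrite lt_neqAle path_prod_ge0 eq_sym pn.
have sumE E : sec E -> exists2 xi : seq 'I_3 -> symseq 3,
    (forall u, size u = n -> cond u -> cylinder X u (xi u)) &
    \sum_(x \in E) expR (birkhoff n f x) =
    \sum_(u <- words (T:='I_3) n | cond u) expR (birkhoff n f (xi u)).
  move=> [EX Eu]; pose xi u := get (E `&` cylinder X u).
  have xiP u : size u = n -> cond u -> (E `&` cylinder X u) (xi u).
    move=> su /andP[/asboolP ne /eqP pu].
    have [x [[Ex cx] _]] := Eu u su ne pu.
    by apply: getPex; exists x.
  exists xi; first by move=> u su cu; have [] := xiP u su cu.
  rewrite [RHS](_ : _ =
    \sum_(x <- map xi [seq u <- words n | cond u]) expR (birkhoff n f x)); last first.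
    by rewrite big_map big_filter.
  have mf u : u \in [seq u <- words n | cond u] -> size u = n /\ cond u.
    by rewrite mem_filter mem_words => /andP[? /eqP].
  rewrite [RHS]fsbig_seq; last first.
    rewrite map_inj_in_uniq ?filter_uniq ?uniq_words// => u v.
    move=> /mf[su cu] /mf[sv cv] uv.
    have [_ [_ wu]] := xiP u su cu; have [_ [_ wv]] := xiP v sv cv.
    by rewrite -wu -wv su sv uv.
  suff -> : [set` [seq xi u | u <- [seq u <- words n | cond u]]] = E by [].
  rewrite eqEsubset; split=> x /=.
    by move=> /mapP[u /mf[su cu] ->]; have [] := xiP u su cu.
  move=> Ex; have [Xx xy] := EX x Ex.
  have nx : cylinder X (word x n) !=set0 by exists x; split=> //; rewrite size_word.
  have cx : cond (word x n) by rewrite /cond xy eqxx andbT; exact/asboolP.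
  apply/mapP; exists (word x n); first by rewrite mem_filter cx mem_words size_word eqxx.
  have [z [_ uz]] := Eu (word x n) (size_word x n) nx xy.
  apply: (etrans (esym (uz x _))); first by split=> //; split=> //; rewrite size_word.
  by apply: uz; exact: (xiP (word x n) (size_word x n) cx).
have bnd E : sec E ->
    weight c (word y n) <= C * \sum_(x \in E) expR (birkhoff n f x) /\
    \sum_(x \in E) expR (birkhoff n f x) <= C * weight c (word y n).
  move=> /sumE[xi xiP ->]; rewrite wE !mulr_sumr.
  have key u : u \in words n -> cond u ->
      path_weight c u <= C * expR (birkhoff n f (xi u)) /\
      expR (birkhoff n f (xi u)) <= C * path_weight c u.
    rewrite mem_words => /eqP su cu; have [Xx xu] := xiP u su cu.
    by have := HC (xi u) n.-1 Xx; rewrite prednK// (_ : word (xi u) n = u)// -su.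
  by split; rewrite big_seq_cond [X in _ <= X]big_seq_cond;
    apply: ler_sum => u /andP[uw cu]; have [] := key u uw cu.
have [E0 sE0] : exists E, sec E.
  pose ch u := get (cylinder X u).
  exists [set x | exists u, [/\ size u = n, cylinder X u !=set0, map p u = word y n & x = ch u]].
  split.
    move=> _ [u [su /getPex [Xu wu] pu ->]]; split=> //.
    by rewrite (_ : word (ch u) n = u)// -[in LHS]su.
  move=> u su ne pu; have cu := getPex ne; exists (ch u); split.
    by split=> //; exists u.
  move=> x [[v [sv nv pv ->]] [_ wx]]; have [_ wv] := getPex nv.
  suff -> : u = v by [].
  by rewrite -wx su -sv wv.
have hs : has_sup [set \sum_(x \in E) expR (birkhoff n f x) | E in sec].
  split; first by exists (\sum_(x \in E0) expR (birkhoff n f x)); exists E0.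
  by exists (C * weight c (word y n)) => _ [E /bnd[_ +] <-].
split.
  apply: le_trans (proj1 (bnd E0 sE0)) _; rewrite ler_pM2l//.
  by apply: ub_le_sup; [case: hs|exists E0].
by apply: ge_sup; [case: hs|move=> _ [E /bnd[_ +] <-]].
Qed.

End RelativePressure.

Section ChainOfFactor.
Context {R : realType}.
Variables (A : 'M[bool]_3) (B : 'M[bool]_2) (f : symseq 3 -> R).
Variables (pi : symseq 3 -> symseq 2) (p : 'I_3 -> 'I_2).
Local Notation X := (sft A).
Local Notation Y := (sft B).
Hypotheses (hX : irreducible X) (hB : Y = setT \/ B = golden_mx).
Hypotheses (hpi : factor_map X Y pi) (hp : one_block X pi p).
Hypotheses (p0 : p 0 = 0) (p1 : p 1 = 1) (p2 : p 2%:R = 1).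
Hypothesis hf : two_coordinates X f.
Local Notation K := (live_mx A f).
Local Notation S := (live A).

Lemma ord3_cases (i : 'I_3) : [\/ i = 0, i = 1 | i = 2%:R].
Proof.
by case: i => [[|[|[|//]]] i]; [constructor 1|constructor 2|constructor 3]; apply: val_inj.
Qed.

Lemma letterE : p =1 letter.
Proof. by move=> i; case: (ord3_cases i) => ->; rewrite /letter ?p0 ?p1 ?p2. Qed.

Lemma transition_1 a : B a 1 /\ B 1 a.
Proof.
case: hB => [YT|->]; last by rewrite !mxE orbT.
have Yall y : Y y by rewrite YT.
by split; [have := Yall (fun n => if n is 0 then a else 1) 0%N|
           have := Yall (fun n => if n is 0 then 1 else a) 0%N].
Qed.

Lemma factor_lift y : Y y -> exists2 x, X x & forall n, letter (x n) = y n.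
Proof.
have [_ piX _] := hpi; rewrite -piX => -[x Xx <-]; exists x => // n.
by rewrite -letterE hp.
Qed.

Lemma factor_point x : X x -> Y (pi x) /\ forall n, letter (x n) = pi x n.
Proof.
have [_ piX _] := hpi => Xx; split; first by rewrite -piX; exists x.
by move=> n; rewrite -letterE hp.
Qed.

Lemma letter_eq0 i : letter i = 0 -> i = 0.
Proof. by rewrite /letter; case: eqP. Qed.

Let reach n i j := 0 < (K ^+ n) i j.

Lemma reachD n m i j k : reach n i j -> reach m j k -> reach (n + m) i k.
Proof.
rewrite /reach exprD => ij jk; apply/mx_nonneg_mul_gt0; last by exists j.
  exact/mx_nonneg_exp/live_mx_ge0.
exact/mx_nonneg_exp/live_mx_ge0.
Qed.

Lemma reach_point x k n : X x -> reach n (x k) (x (k + n)%N).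
Proof.
move=> Xx; elim: n => [|n IH]; first by rewrite /reach expr0 addn0 mxE eqxx.
rewrite -addn1 addnA; apply: (reachD IH); rewrite /reach expr1 addn1 live_mxE//.
exact: expR_gt0.
Qed.

(** the lift to [X] of the periodic point that repeats a 0 and [k] letters 1 *)
Lemma reach_return k : (0 < k)%N -> reach k.+1 0 0 /\ 0 \in S.
Proof.
move=> k0; pose y : symseq 2 := fun n => if (n %% k.+1 == 0)%N then 0 else 1.
have Yy : Y y.
  move=> n; rewrite /y; case: ifP => n0; case: ifP => n1; rewrite ?(transition_1 _).1 ?(transition_1 _).2//.
  exfalso; move: n0 n1; rewrite -(addn1 n) -modnDml => /eqP ->.
  by rewrite add0n modn_small// ltnS.
have [x Xx xy] := factor_lift Yy.
have x0 : x 0%N = 0 by apply: letter_eq0; rewrite xy /y mod0n.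
have xk : x k.+1 = 0 by apply: letter_eq0; rewrite xy /y modnn.
split; last by rewrite -x0; exact: mem_live.
by have := reach_point 0 k.+1 Xx; rewrite add0n x0 xk.
Qed.

Lemma reach_live i j : i \in S -> j \in S -> exists n, reach n i j.
Proof.
move=> /liveP[x Xx xi] /liveP[x' Xx' xj].
have bl z : X z -> blocks X [:: z 0%N] by move=> Xz; exists z, 0%N.
have [w _ [z [n [Xz zw]]]] := hX (bl x Xx) (bl x' Xx').
set t := iter n shift z in zw; have Xt : X t by exact: sft_iter.
have t0 : t 0%N = i by move: zw; rewrite /= word_cons => -[-> _].
have tj : t (size w).+1 = j.
  have := congr1 (last 0) zw; rewrite catA size_cat addn1 wordS cats1 !last_rcons.
  by rewrite xj.
by exists (size w).+1; rewrite -t0 -tj -[(size w).+1]add0n; exact: reach_point.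
Qed.

(** The loops of lengths 2 and 3 at 0 give loops of every length at least 2, so
    the lengths of the paths between two states can be made equal. *)
Lemma live_mx_primitive : exists2 m, (0 < m)%N & primitive_on S K m.
Proof.
have S0 : 0 \in S by have [] := @reach_return 1.
have re n : (1 < n)%N -> reach n 0 0.
  elim/ltn_ind: n => n IH n1; have [n4|n4] := ltnP n 4.
    have : n \in [:: 2; 3]%N by rewrite !inE; lia.
    by rewrite !inE => /orP[] /eqP ->; exact: (reach_return _).1.
  rewrite (_ : n = (2 + (n - 2))%N); last by lia.
  apply: reachD; first exact: (reach_return _).1.
  by apply: IH; lia.
have [a Ha] : {a : 'I_3 -> nat & forall i, i \in S -> reach (a i) i 0}.
  apply: (@boolp.choice _ _ (fun i n => i \in S -> reach n i 0)) => i.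
  have [iS|] := boolP (i \in S); last by exists 0%N.
  by have [n Hn] := reach_live iS S0; exists n.
have [b Hb] : {b : 'I_3 -> nat & forall i, i \in S -> reach (b i) 0 i}.
  apply: (@boolp.choice _ _ (fun i n => i \in S -> reach n 0 i)) => i.
  have [iS|] := boolP (i \in S); last by exists 0%N.
  by have [n Hn] := reach_live S0 iS; exists n.
exists (\sum_i a i + \sum_i b i + 2)%N; first by rewrite addn2.
split; first exact: live_mx_ge0.
  by move=> i j /negbTE h; rewrite mxE h.
move=> i j iS jS; rewrite (bigD1 i)//= [X in (_ + X + _)%N](bigD1 j)//=.
set u := (\sum_(_ | _) _)%N; set v := (\sum_(_ | _) _)%N.
rewrite (_ : (_ + _)%N = (a i + ((u + v + 2) + b j))%N); last by lia.
apply: reachD; first exact: Ha.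
by apply: reachD; [apply: re; lia|exact: Hb].
Qed.

Lemma chain_of_factor : exists c : hidden_chain R,
  [/\ hc_K c = K, hc_S c = S, carried c B &
      forall y, Y y -> forall n, exists2 x, X x & map p (word x n) = word y n].
Proof.
have S0 : 0 \in S by have [] := @reach_return 1.
have [m m0 pK] := live_mx_primitive.
have [lam [v [h pd]]] := perron_pair m0 S0 pK.
pose c := HiddenChain m0 S0 pK pd.
exists c; split=> //; last first.
  move=> y Yy n; have [x Xx xy] := factor_lift Yy; exists x => //.
  rewrite /word /mkseq -map_comp; apply: eq_map => i /=.
  by rewrite letterE xy.
split; [by move=> a; have [] := transition_1 a|by move=> a; have [] := transition_1 a| |].
  move=> i j; rewrite /= live_mx_gt0 => /and3P[_ /liveP[x Xx <-] Aix].
  have Xs : X (scons i x) by case.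
  have [Ys ls] := factor_point Xs.
  by have := Ys 0%N; rewrite -!ls.
move=> y Yy n; have [x Xx xy] := factor_lift Yy.
have pos : forall n x y, X x -> (forall n, letter (x n) = y n) ->
    0 < emits c (word y n) (x 0%N) (x n).
  elim=> [|k IH] z t Xz zt; first by rewrite /word /mkseq /= emits_nil mxE eqxx.
  rewrite word_cons emits_cons; apply/mx_nonneg_mul_gt0.
  - exact: emit_ge0.
  - exact: emits_ge0.
  exists (z 1%N); split.
    rewrite mxE zt eqxx /= live_mxE//; exact: expR_gt0.
  exact: (IH (shift z) (shift t) (fun n => Xz n.+1) (fun n => zt n.+1)).
apply: lt_le_trans (ler_weight c (word y n) (x 0%N) (x n)).
have xS k : x k \in hc_S c by exact: mem_live.
by rewrite !mulr_gt0//; [have [] := lh_gt0 (xS 0%N)|exact: pos|have [] := lh_gt0 (xS n)].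
Qed.

End ChainOfFactor.

(** * The potential *)

Section Growth.
Context {R : realType}.

(** Fekete's lemma for almost additive sequences, with the error kept *)
Lemma almost_additive_rate (s D : nat -> R) :
  (forall n m, (0 < n)%N -> (0 < m)%N -> `|s (n + m)%N - s n - s m| <= D n) ->
  exists L, forall n, (0 < n)%N -> `|s n - n%:R * L| <= D n.
Proof.
move=> H.
have mult n k : (0 < n)%N -> `|s (k.+1 * n)%N - k.+1%:R * s n| <= k%:R * D n.
  move=> n0; elim: k => [|k IH]; first by rewrite mul1n mul1r subrr normr0 mul0r.
  have := H n (k.+1 * n)%N n0; rewrite muln_gt0 n0 => /(_ isT) h.
  rewrite mulSn; move: h IH; set S := s (n + _)%N; set S1 := s (k.+1 * n)%N => h IH.
  rewrite (_ : S - _ = (S - s n - S1) + (S1 - k.+1%:R * s n)); last first.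
    by rewrite -[k.+2%:R]natr1; ring.
  rewrite (_ : k.+1%:R * D n = D n + k%:R * D n); last by rewrite -natr1; ring.
  by apply: le_trans (ler_normD _ _) _; rewrite lerD.
have D0 n : (0 < n)%N -> 0 <= D n.
  by move=> n0; apply: le_trans (H n n n0 n0); exact: normr_ge0.
have mult' n k : (0 < n)%N -> (0 < k)%N -> `|s (k * n)%N - k%:R * s n| <= k%:R * D n.
  case: k => // k n0 _; apply: le_trans (mult n k n0) _.
  by rewrite ler_wpM2r ?D0// ler_nat.
have cmp n m : (0 < n)%N -> (0 < m)%N -> (s n - D n) / n%:R <= (s m + D m) / m%:R.
  move=> n0 m0; have n0R : 0 < n%:R :> R by rewrite ltr0n.
  have m0R : 0 < m%:R :> R by rewrite ltr0n.
  rewrite ler_pdivrMr// mulrAC ler_pdivlMr//.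
  have := mult' n m n0 m0; have := mult' m n m0 n0; rewrite mulnC !ler_norml; nra.
pose P := [set (s n.+1 - D n.+1) / n.+1%:R | n in setT].
have hs : has_sup P.
  split; first by exists ((s 1%N - D 1%N) / 1); exists 0%N.
  by exists ((s 1%N + D 1%N) / 1) => _ [n _ <-]; exact: cmp.
exists (sup P) => -[//|n] _; have n0R : 0 < n.+1%:R :> R by rewrite ltr0n.
rewrite ler_norml; apply/andP; split.
  have : sup P <= (s n.+1 + D n.+1) / n.+1%:R.
    by apply: ge_sup; [case: hs|move=> _ [m _ <-]; exact: cmp].
  rewrite ler_pdivlMr//; lra.
have : (s n.+1 - D n.+1) / n.+1%:R <= sup P.
  by apply: ub_le_sup; [case: hs|exists n].
rewrite ler_pdivrMr//; lra.
Qed.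

End Growth.

Section RunLength.
Implicit Types y : symseq 2.

Definition run_is y j := y j = 0 /\ forall i, (i < j)%N -> y i = 1.

Lemma ord2_neq0 (a : 'I_2) : a != 0 -> a = 1.
Proof. by case: a => [[|[|//]] i] //= _; apply: val_inj. Qed.

Lemma run_exists y T : y T = 0 -> exists2 j, (j <= T)%N & run_is y j.
Proof.
move=> yT; have ex : exists n, y n == 0 by exists T; rewrite yT.
have [j /eqP yj jmin] := ex_minnP ex.
exists j; first by apply: jmin; rewrite yT.
split=> // i ij; apply: ord2_neq0; apply/negP => /jmin; by rewrite leqNgt ij.
Qed.

Lemma run_unique y j k : run_is y j -> run_is y k -> j = k.
Proof.
move=> [yj lj] [yk lk]; case: (ltngtP j k) => // [/lk|/lj]; rewrite ?yj ?yk//.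
Qed.

Definition run y : nat := get (run_is y).

Lemma runE y j : run_is y j -> run y = j.
Proof. by move=> yj; apply: (run_unique _ yj); exact: (getPex (ex_intro _ j yj)). Qed.

Lemma run_is_shift y j : y 0%N = 1 -> run_is (shift y) j <-> run_is y j.+1.
Proof.
move=> y0; split=> -[yj lj]; split=> // i; first by case: i => [//|i] /lj.
by move=> ij; exact: (lj i.+1).
Qed.

Lemma word_run y j T : run_is y j -> (j <= T)%N ->
  word y T.+1 = nseq j 1 ++ word (iter j shift y) (T - j).+1.
Proof.
move=> [_ lj] jT; rewrite -{1}(subnKC jT) -addnS word_cat; congr (_ ++ _).
apply: (@eq_from_nth _ 0); first by rewrite size_word size_nseq.
by move=> i; rewrite size_word => ij; rewrite nth_mkseq// nth_nseq ij lj.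
Qed.

End RunLength.

Section Potential.
Context {R : realType} (c : hidden_chain R) (B : 'M[bool]_2).
Hypothesis cB : carried c B.
Local Notation Y := (sft B).
Implicit Types y : symseq 2.

Definition log_weight y n : R := ln (weight c (word y n)).

Definition return_weight j : R := loop_weight c (0 :: nseq j 1).

(** The return word without letters 1 may be forbidden, so the telescoping starts
    from 1 instead; [potential] takes this return into account at its 0. *)
Definition run_weight j : R := if j is 0 then 1 else return_weight j.

(** When [y] starts with a run of [j > 0] letters 1 followed by 0, the
    exponential of [potential y] is the ratio of the weights of the return words
    with [j] and with [j - 1] letters 1, the latter being replaced by 1 when
    [j = 1].  These ratios telescope along a run, so
    that the Birkhoff sums add up the logarithms of the weights of the completed
    returns.  The number [L] is the value at the sequence of 1s. *)
Definition potential (L : R) y : R :=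
  if y 0%N == 0 then (if y 1%N == 0 then ln (return_weight 0) else 0)
  else if `[< exists j, run_is y j >] then
    ln (run_weight (run y)) - ln (run_weight (run y).-1)
  else L.

(** The logarithm of the weight of the first [T + 1] letters, except that the
    initial run of 1s counts as a completed return: this quantity, unlike the
    weight, changes by [potential] when the first letter is dropped. *)
Definition return_log y T : R :=
  ln (run_weight (run y)) +
  ln (weight_from c (word (iter (run y) shift y) (T - run y).+1)).

Lemma birkhoffS k (g : symseq k -> R) n x :
  birkhoff n.+1 g x = g x + birkhoff n g (shift x).
Proof.
rewrite /birkhoff big_ord_recl; congr (_ + _); apply: eq_bigr => i _.
by rewrite lift0 iterSr.
Qed.

Lemma birkhoffD k (g : symseq k -> R) m n x :
  birkhoff (m + n) g x = birkhoff m g x + birkhoff n g (iter m shift x).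
Proof.
elim: m x => [|m IH] x; first by rewrite /birkhoff big_ord0 add0r.
by rewrite addSn !birkhoffS IH iterSr addrA.
Qed.

Lemma weight_factors_gt0 u w : 0 < weight c (u ++ 0 :: w) ->
  0 < weight_before c u /\ 0 < weight_from c (0 :: w).
Proof.
rewrite weight_renewal.
have := mx_nonneg_mul (l_ge0 c) (emits_ge0 c u) 0 0.
have := mx_nonneg_mul (emits_ge0 c (0 :: w)) (h_ge0 c) 0 0.
rewrite -/(weight_before c u) -/(weight_from c (0 :: w)).
by rewrite !le_eqVlt => /orP[/eqP <-|->] /orP[/eqP <-|->]; rewrite ?mulr0 ?mul0r ?ltxx.
Qed.

Lemma run_split y T : Y y -> y T = 0 ->
  [/\ (run y <= T)%N, run_is y (run y),
      0 < weight_before c (nseq (run y) 1),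
      0 < weight_from c (word (iter (run y) shift y) (T - run y).+1) &
      weight c (word y T.+1) = weight_before c (nseq (run y) 1) *
        weight_from c (word (iter (run y) shift y) (T - run y).+1)].
Proof.
have [_ _ _ pos] := cB => Yy yT.
have [j jT yj] := run_exists yT; rewrite (runE yj).
have := pos y Yy T.+1; rewrite (word_run yj jT) word_cons iter_shift add0n (proj1 yj).
by move=> /weight_factors_gt0[? ?]; split=> //; exact: weight_renewal.
Qed.

Lemma return_point j : (0 < j)%N -> Y (cyclic_seq (0 :: nseq j 1)).
Proof.
have [B1 B1' _ _] := cB => j0; apply: periodic_sft.
case: j j0 => // j _; rewrite /= B1 /=; elim: j => [|j IH]; first by rewrite /= B1'.
by rewrite /= B1.
Qed.

Lemma return_weight_gt0 j : (0 < j)%N -> 0 < return_weight j.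
Proof. by move=> j0; apply: (loop_weight_gt0 cB); exact: return_point. Qed.

Lemma return_log_step L y T : Y y -> y T.+1 = 0 ->
  return_log y T.+1 = potential L y + return_log (shift y) T.
Proof.
move=> Yy yT; have Ysy := sft_shift Yy.
have [jT yj _ _ _] := run_split Yy yT.
have [kT yk _ fk _] := run_split Ysy (yT : shift y T = 0).
rewrite /potential; case: eqP => [y0|/eqP/ord2_neq0 y0]; last first.
  have E : run y = (run (shift y)).+1 by apply: runE; apply/run_is_shift.
  case: asboolP => [_|[]]; last by exists (run y).
  by rewrite /return_log E subSS /= -iterSr; ring.
have r0 : run y = 0%N by apply: runE; split.
have [_ _ _ pos] := cB.
rewrite /return_log r0 /= ln1 add0r subn0 word_cons.
rewrite (word_run yk kT) y0 -cat_cons.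
rewrite word_cons (_ : iter _ _ _ 0%N = 0) in fk *; last by rewrite iter_shift; exact: (proj1 yk).
rewrite weight_from_renewal -/(return_weight _).
have ret0 : 0 < return_weight (run (shift y)).
  case: (run (shift y)) yk => [|k] yk; last exact: return_weight_gt0.
  have := pos y Yy 2; rewrite word_cons word_cons y0 (proj1 yk) (_ : word _ 0 = [::])//.
  rewrite (weight_renewal c [::]) (weight_from_renewal c [:: 0]) => h.
  rewrite lt_neqAle loop_weight_ge0 andbT; apply/negP => /eqP E.
  by rewrite (esym E : loop_weight c [:: 0] = 0) mul0r mulr0 ltxx in h.
rewrite lnM ?posrE// addrA; congr (_ + _).
case E : (run (shift y)) yk => [|k] yk.
  by rewrite (proj1 yk : y 1%N = 0) eqxx /= ln1 addr0.
have -> : y 1%N = 1 by have := proj2 yk 0%N; exact.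
by rewrite /= add0r.
Qed.

Lemma birkhoff_potential L y n T : Y y -> y T = 0 -> (n <= T)%N ->
  birkhoff n (potential L) y = return_log y T - return_log (iter n shift y) (T - n).
Proof.
elim: n y T => [|n IH] y T Yy yT nT.
  by rewrite /birkhoff big_ord0 subn0 subrr.
case: T yT nT => // T yT nT.
rewrite birkhoffS (IH _ T)//; last exact: sft_shift.
by rewrite (return_log_step L Yy yT) subSS iterSr addrA.
Qed.

Variable D : nat -> R.
Hypotheses (D0 : forall n, 0 <= D n) (Dmono : forall n m, (n <= m)%N -> D n <= D m).
Hypothesis QM : forall y n m, Y y ->
  `|log_weight y (n + m) - log_weight y n - log_weight (iter n shift y) m| <= D n.

Definition boundary_const : R :=
  D 1 + `|ln (weight_from c [:: 0])| + `|ln (weight_before c [::])|.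

(** The error of almost additivity depends on the first word alone, so that
    putting a 0 before a run of 1s changes its weight by a bounded factor,
    however long the run. *)
Lemma run_weight_close y T : Y y -> y T = 0 ->
  `|ln (run_weight (run y)) - ln (weight_before c (nseq (run y) 1))| <= boundary_const.
Proof.
move=> Yy yT; case: (run y) => [|j].
  rewrite /run_weight ln1 sub0r normrN /boundary_const.
  by rewrite lerDr addr_ge0.
have Yp := return_point (ltn0Sn j); set q := cyclic_seq _ in Yp.
have [_ _ _ pos] := cB.
have wq : word q (1 + j.+2) = 0 :: nseq j.+1 1 ++ [:: 0].
  pose s : seq 'I_2 := 0 :: nseq j.+1 1.
  have -> : (1 + j.+2 = size s + 1)%N by rewrite /= size_nseq addn1.
  by rewrite (@word_periodic_add s).
have wq1 : word q 1 = [:: 0] by [].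
have wsq : word (iter 1 shift q) j.+2 = nseq j.+1 1 ++ [:: 0].
  have := word_cat q 1 j.+2; rewrite wq wq1 => /(congr1 behead)/= <-//.
have H := QM 1 j.+2 Yp; rewrite /log_weight wq wq1 wsq in H.
have p1 := pos q Yp 1%N; have p2 := pos q Yp (1 + j.+2)%N.
have p3 := pos _ (sft_iter 1 Yp) j.+2.
rewrite wq1 -[[:: 0]]cat0s in p1; rewrite wq -[0 :: _ ++ _]cat0s in p2; rewrite wsq in p3.
have [b0 f0] := weight_factors_gt0 p1; have [_ f1] := weight_factors_gt0 p2.
have [b1 _] := weight_factors_gt0 p3.
have r0 : 0 < return_weight j.+1 by exact: return_weight_gt0.
move: H; rewrite -[[:: 0]]cat0s -[0 :: nseq _ _ ++ _]cat0s !weight_renewal.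
have -> : weight_from c (0 :: nseq j.+1 1 ++ [::] ++ [:: 0]) =
    return_weight j.+1 * weight_from c [:: 0].
  by rewrite -[RHS]weight_from_renewal.
rewrite !lnM ?posrE ?mulr_gt0// => H.
rewrite /run_weight /boundary_const.
have := ler_norm (ln (weight_from c [:: 0])); have := ler_norm (- ln (weight_from c [:: 0])).
rewrite normrN; have := normr_ge0 (ln (weight_before c [::])).
move: H; rewrite !ler_norml; lra.
Qed.

Lemma return_log_close y T : Y y -> y T = 0 ->
  `|return_log y T - log_weight y T.+1| <= boundary_const.
Proof.
move=> Yy yT; have [_ _ b0 f0 wE] := run_split Yy yT.
rewrite /log_weight wE lnM ?posrE// /return_log opprD addrACA subrr addr0.
exact: run_weight_close yT.
Qed.

Variable L : R.
Hypothesis HL : forall n, `|log_weight (fun=> 1) n - n%:R * L| <= D n.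

Lemma birkhoff_ones y n : (forall i, y i = 1) -> birkhoff n (potential L) y = n%:R * L.
Proof.
elim: n y => [|n IH] y y1; first by rewrite /birkhoff big_ord0 mul0r.
rewrite birkhoffS IH => [|i]; last exact: y1.
have -> : potential L y = L.
  rewrite /potential y1 /=; case: asboolP => // -[j [yj _]].
  by rewrite y1 in yj.
by rewrite -natr1; ring.
Qed.

(** If a 0 occurs from position [n] on, the Birkhoff sum telescopes up to that
    return.  Otherwise [y] is cut after its last 0, which is followed by 1s
    only. *)
Lemma potential_bound y n : Y y ->
  `|birkhoff n (potential L) y - log_weight y n| <= 2 * D n + 2 * boundary_const.
Proof.
move=> Yy; have bc : 0 <= boundary_const by rewrite !addr_ge0.
have Dn := D0 n.
have [[T [nT yT]]|noT] := pselect (exists T, (n <= T)%N /\ y T = 0).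
  rewrite (birkhoff_potential L Yy yT nT).
  have h1 := return_log_close Yy yT.
  have yTn : iter n shift y (T - n)%N = 0 by rewrite iter_shift subnK.
  have h2 := return_log_close (sft_iter n Yy) yTn.
  have := QM n (T - n).+1 Yy; rewrite addnS subnKC//.
  move: h1 h2; rewrite !ler_norml; lra.
have late i : (n <= i)%N -> y i = 1.
  by move=> ni; apply: ord2_neq0; apply/negP => /eqP yi; apply: noT; exists i.
have [ex|no0] := pselect (exists t, y t == 0); last first.
  have y1 i : y i = 1 by apply: ord2_neq0; apply/negP => yi; apply: no0; exists i.
  rewrite birkhoff_ones// /log_weight (_ : word y n = word (fun=> 1) n).
    by rewrite distrC; apply: le_trans (HL n) _; lra.
  by apply: word_eqP => i _; rewrite y1.
have bnd : forall t, y t == 0 -> (t <= n)%N.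
  by move=> t yt; rewrite leqNgt; apply/negP => /ltnW/late E; rewrite E in yt.
have [t /eqP yt tmax] := ex_maxnP ex bnd.
have tn : (t < n)%N.
  have tn : (t <= n)%N by apply: bnd; rewrite yt.
  rewrite ltn_neqAle tn andbT; apply/negP => /eqP E.
  by have := late t; rewrite yt E leqnn => /(_ isT).
pose m := (n - t.+1)%N; have nE : n = (t.+1 + m)%N by rewrite /m subnKC.
have y1 i : iter t.+1 shift y i = 1.
  rewrite iter_shift; apply: ord2_neq0; apply/negP => /tmax.
  by rewrite addnS ltnNge leq_addl.
have St : birkhoff t.+1 (potential L) y = return_log y t - ln (weight_from c [:: 0]).
  rewrite -(addn1 t) birkhoffD (birkhoff_potential L Yy yt)// subnn.
  have r0 : run (iter t shift y) = 0%N by apply: runE; split=> //; rewrite iter_shift.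
  rewrite {2}/return_log r0 /= ln1 add0r word_cons iter_shift add0n yt.
  rewrite (_ : word _ 0 = [::])// /birkhoff big_ord1 /= /potential iter_shift add0n yt eqxx.
  by rewrite (_ : iter t shift y 1%N = 1) ?addr0//; have := y1 0%N; rewrite !iter_shift !add0n add1n.
rewrite {1}nE birkhoffD St birkhoff_ones//.
have h1 := return_log_close Yy yt.
have h2 := QM t.+1 m Yy; rewrite -nE in h2.
have h3 : `|log_weight (iter t.+1 shift y) m - m%:R * L| <= D m.
  rewrite /log_weight (_ : word _ m = word (fun=> 1) m); first exact: HL.
  by apply: word_eqP => i _; rewrite y1.
have d1 : D t.+1 <= D n by apply: Dmono.
have d2 : D m <= D n by apply: Dmono; rewrite /m leq_subr.
have h4 : `|ln (weight_from c [:: 0])| <= boundary_const.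
  by rewrite /boundary_const -addrA [X in _ <= _ + X]addrC addrA; rewrite lerDr addr_ge0.
move: h1 h2 h3 h4; rewrite !ler_norml; lra.
Qed.

End Potential.

(** * Gibbs measures *)

Section GibbsMeasures.
Context {R : realType} (c : hidden_chain R) (B : 'M[bool]_2).
Hypothesis cB : carried c B.
Local Notation Y := (sft B).
Implicit Types (y : symseq 2) (m : probability (borel_symseq 1) R).

Lemma closed_sft : closed (Y : set (symseq 2)).
Proof.
rewrite -openC openE => y /= /existsNP[n nB].
apply/nbhs_symseq; exists n.+2 => z /= /eq_word zy Yz; apply: nB.
by have := Yz n; rewrite !zy.
Qed.

Lemma weight_out w : cylinder Y w = set0 -> weight c w = 0.
Proof.
move=> w0; apply/eqP; rewrite eq_le weight_ge0 andbT leNgt; apply/negP.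
move=> /(weight_gt0_point cB)[y Yy yw].
by have : cylinder Y w y by []; rewrite w0.
Qed.

(** the stationary measure of the chain, observed through the letters *)
Lemma chain_measure : exists m, invariant_on Y m /\ word_law m =1 chain_law c.
Proof.
have sc := chain_law_stationary c; have [c0 c1 cr cl] := sc.
have [m mE] := word_law_exists c0 c1 cr.
exists m; split=> //; split.
  have [] // := @closed_full_measure 1 R m Y closed_sft.
  by move=> w /weight_out w0; rewrite mE /chain_law w0 mulr0.
apply: invariant_word_law => w; rewrite mE cl.
by apply: eq_bigr => a _; rewrite mE.
Qed.

Lemma measure_cylinder m y n : m Y = 1%E -> Y y ->
  fine (m (cylinder Y (word y n))) = word_law m (word y n).
Proof.
move=> mY Yy; rewrite cylinder_setI /word_law; congr fine.
have mYm : measurable (Y : set (borel_symseq 1)).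
  rewrite -[Y]setCK; apply: measurableC; apply: measurable_open.
  by rewrite openC; exact: closed_sft.
have mcyl := @measurable_cyl 1 (word y n).
have mYC : m (~` (Y : set (borel_symseq 1))) = 0%E.
  by rewrite probability_setC// mY subee.
rewrite setIC [RHS](measureDI m mcyl mYm) [X in (X + _)%E](_ : _ = 0%E) ?add0e//.
apply/eqP; rewrite eq_le measure_ge0 andbT -mYC; apply: le_measure.
- by rewrite inE; exact: measurableD.
- by rewrite inE; exact: measurableC.
- by move=> z [].
Qed.

Definition follows (g : symseq 2 -> R) (E : nat -> R) :=
  forall y n, Y y -> (0 < n)%N -> `|birkhoff n g y - log_weight c y n| <= E n.

Lemma follows_gibbs_bound g E m : follows g E -> invariant_on Y m ->
  word_law m =1 chain_law c ->
  gibbs_bound Y g m (ln (hc_lam c)) (fun n => expR (E n)).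
Proof.
have [_ _ _ pos] := cB => fg [mY _] mE y n Yy n0.
rewrite measure_cylinder// mE /chain_law size_word.
have -> : hc_lam c ^- n = expR (- (n%:R * ln (hc_lam c))).
  by rewrite expRN expRM_natl lnK// posrE; exact: lam_gt0.
have -> : weight c (word y n) = expR (log_weight c y n).
  by rewrite /log_weight lnK// posrE; exact: pos.
rewrite -expRN -expRD -expRN -expRD !ler_expR.
have := fg y n Yy n0; rewrite ler_norml; lra.
Qed.

Lemma word_law_out m w : invariant_on Y m -> cylinder Y w = set0 -> word_law m w = 0.
Proof.
move=> [mY _] w0; rewrite /word_law.
have mYm : measurable (Y : set (borel_symseq 1)).
  rewrite -[Y]setCK; apply: measurableC; apply: measurable_open.
  by rewrite openC; exact: closed_sft.
suff -> : m (cyl w) = 0%E by [].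
have mYC : m (~` (Y : set (borel_symseq 1))) = 0%E.
  by rewrite probability_setC// mY subee.
apply/eqP; rewrite eq_le measure_ge0 andbT -mYC; apply: le_measure.
- by rewrite inE; exact: measurable_cyl.
- by rewrite inE; exact: measurableC.
- move=> y yw Yy; have : cylinder Y w y by rewrite cylinder_setI.
  by rewrite w0.
Qed.

(** Summing the Gibbs bounds over the words of a given length identifies the
    constants [P]; then [m'] and [m] give the same weight to words up to
    subexponential factors, and [m] is mixing. *)
Lemma follows_weak_gibbs_unique g E m m' : follows g E ->
  E n / n%:R @[n --> \oo] --> (0 : R) ->
  invariant_on Y m -> word_law m =1 chain_law c ->
  weak_gibbs Y g m' -> forall A : set (borel_symseq 1), measurable A -> m' A = m A.
Proof.
have [_ _ _ pos] := cB => fg E0 im mE [im' [P [C [C0 lnC0 gb]]]].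
have [mY inv] := im; have [m'Y inv'] := im'.
have smm' := stationary_word_law inv'; have sc := chain_law_stationary c.
pose Q := ln (hc_lam c); pose F n := E n + ln (C n).
have F0 : F n / n%:R @[n --> \oo] --> (0 : R).
  under eq_fun do rewrite /F mulrDl.
  by rewrite -[0]addr0; apply: cvgD.
have two w : (0 < size w)%N ->
    word_law m' w <= expR ((size w)%:R * (Q - P) + F (size w)) * chain_law c w /\
    chain_law c w <= expR ((size w)%:R * (P - Q) + F (size w)) * word_law m' w.
  move=> w0; have [ne|/nonemptyPn e0] := pselect (cylinder Y w !=set0); last first.
    by rewrite (word_law_out im' e0) /chain_law (weight_out e0) !mulr0; split.
  have [y [Yy yw]] := ne; have := gb y _ Yy w0; have := follows_gibbs_bound fg im mE Yy w0.
  rewrite !measure_cylinder// yw -mE => /andP[a1 a2] /andP[b1 b2].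
  set n := size w in a1 a2 b1 b2 *; set S := birkhoff n g y in a1 a2 b1 b2.
  have Cn : 0 < C n by exact: C0.
  have lnC : C n = expR (ln (C n)) by rewrite lnK.
  move: a1 a2 b1 b2; rewrite [C n]lnC.
  rewrite !ler_pdivlMr ?expR_gt0// !ler_pdivrMr ?expR_gt0// -!expRN -!expRD => a1 a2 b1 b2.
  split.
    apply: le_trans b2 _.
    apply: le_trans (ler_wpM2l (expR_ge0 (n%:R * (Q - P) + F n)) a1).
    by rewrite -expRD ler_expR /F /Q; lra.
  apply: le_trans a2 _.
  apply: le_trans (ler_wpM2l (expR_ge0 (n%:R * (P - Q) + F n)) b1).
  by rewrite -expRD ler_expR /F /Q; lra.
have sum1 (nu nu' : seq 'I_2 -> R) (t : R) n : stationary_dist nu -> stationary_dist nu' ->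
    (forall w, size w = n -> nu' w <= expR t * nu w) -> 0 <= t.
  move=> snu snu' le; rewrite -ler_expR expR0 -(wsum_dist snu' n).
  by rewrite -[expR t]mulr1 -(wsum_dist snu n) -wsumZ; exact: ler_wsum.
have PQ : P = Q.
  apply/eqP; rewrite -subr_eq0 -normr_le0; apply/ler_addgt0Pr => e e0; rewrite add0r.
  move/cvgrPdist_le : F0 => /(_ e e0)[n _ Hn].
  have := Hn n.+1 (leqnSn n); rewrite sub0r normrN => /(le_trans (ler_norm _)).
  have n0 : 0 < n.+1%:R :> R by rewrite ltr0n.
  rewrite ler_pdivrMr// => Fn.
  have h1 : 0 <= n.+1%:R * (Q - P) + F n.+1.
    apply: (sum1 _ _ _ n.+1 sc smm') => w sw.
    by have := (two w _).1; rewrite sw; exact.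
  have h2 : 0 <= n.+1%:R * (P - Q) + F n.+1.
    apply: (sum1 _ _ _ n.+1 smm' sc) => w sw.
    by have := (two w _).2; rewrite sw; exact.
  rewrite ler_norml; apply/andP; split; rewrite -(ler_pM2l n0); lra.
have lawE : word_law m' =1 chain_law c.
  apply: (subexp_dominated_eq sc smm' (chain_law_mixing c) _ F0) => w w0.
  by have := (two w w0).1; rewrite PQ subrr mulr0 add0r.
move=> A mA; apply: eq_measure_cyl => // [|w].
  by apply: le_lt_trans (probability_le1 m' measurableT) _; exact: ltry.
by rewrite [LHS](word_lawE m' w) [RHS](word_lawE m w) lawE mE.
Qed.

Lemma potential_locally_constant L y z j : run_is y j -> word z j.+2 = word y j.+2 ->
  potential c L z = potential c L y.
Proof.
move=> yj /eq_word zy.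
have zj : run_is z j.
  by split; [rewrite zy; [exact: (proj1 yj)|exact: ltnW]|
     move=> i ij; rewrite zy; [exact: (proj2 yj)|rewrite ltnW// ltnW]].
rewrite /potential (runE yj) (runE zj) (zy 0%N)// (zy 1%N)//.
have -> : `[< exists j, run_is z j >] = true by apply/asboolP; exists j.
by have -> : `[< exists j, run_is y j >] = true by apply/asboolP; exists j.
Qed.

Lemma potential_ones L y : (forall j, ~ run_is y j) -> (forall i, y i = 1) /\ potential c L y = L.
Proof.
move=> nr; have y1 i : y i = 1.
  apply: ord2_neq0; apply/negP => /eqP /run_exists[j _ yj]; exact: (nr j).
by split=> //; rewrite /potential y1 /=; case: asboolP => // -[j /nr].
Qed.

(** the potential is continuous on the open set of the sequences with a letter 0
    and constant outside *)
Lemma measurable_potential L : borel_on Y (potential c L).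
Proof.
pose O := [set y : symseq 2 | exists j, run_is y j].
have oO : open O.
  rewrite openE => y [j yj]; apply/nbhs_symseq; exists j.+1 => z /= /eq_word zy.
  exists j; split; first by rewrite zy ?(proj1 yj).
  by move=> i ij; rewrite zy ?(proj2 yj)// ltnW.
have mO : measurable (O : set (borel_symseq 1)) by exact: measurable_open.
suff mp : measurable_fun [set: borel_symseq 1] (potential c L : borel_symseq 1 -> R).
  by apply: measurable_funS mp.
move=> _ U _; rewrite setTI.
rewrite (_ : _ @^-1` U = ((O : set (borel_symseq 1)) `&` (potential c L @^-1` U)) `|`
    (if `[< U L >] then ~` (O : set (borel_symseq 1)) else set0)); last first.
  have out y : ~ O y -> potential c L y = L.
    by move=> Oy; apply: (potential_ones L _).2 => j yj; apply: Oy; exists j.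
  rewrite eqEsubset; split=> y.
    move=> Uy; have [Oy|Oy] := pselect (O y); [by left|right].
    by case: asboolP => //; rewrite -(out y Oy).
  by move=> [[]//|]; case: asboolP => // UL Oy; rewrite /= (out y Oy).
apply: measurableU; last by case: asboolP => // _; exact: measurableC.
apply: measurable_open; rewrite openE => y [[j yj] Uy].
apply/nbhs_symseq; exists j.+2 => z /= zy; split.
  exists j; move/eq_word: zy => zy; split; first by rewrite zy ?(proj1 yj)// ltnW.
  by move=> i ij; rewrite zy ?(proj2 yj)// ltnW// ltnW.
by rewrite /preimage /= (potential_locally_constant L yj zy).
Qed.

(** A limit of sequences with longer and longer initial runs of 1s is the
    sequence of 1s, and at every other sequence the potential is locally
    constant. *)
Lemma continuous_potential L :
  ln (run_weight c n.+1) - ln (run_weight c n) @[n --> \oo] --> L ->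
  continuous (potential c L).
Proof.
move=> lim y; have [[j yj]|nO] := pselect (exists j, run_is y j).
  move=> U /nbhs_singleton Uy; apply/nbhs_symseq; exists j.+2 => z /= zy.
  by rewrite (potential_locally_constant L yj zy).
have [y1 yL] : (forall i, y i = 1) /\ potential c L y = L.
  by apply: potential_ones => j yj; apply: nO; exists j.
move=> U /nbhs_ballP[e /= e0 eU].
move/cvgrPdist_lt : lim => /(_ e e0)[N _ HN].
apply/nbhs_symseq; exists N.+2 => z /= /eq_word zy; apply: eU; rewrite yL.
rewrite -ball_normE /=.
have [[j zj]|nz] := pselect (exists j, run_is z j); last first.
  have [_ ->] : (forall i, z i = 1) /\ potential c L z = L.
    by apply: potential_ones => j zj; apply: nz; exists j.
  by rewrite subrr normr0.
have Nj : (N.+1 < j)%N.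
  by rewrite ltnNge; apply/negP => jN; have := proj1 zj; rewrite zy// y1.
rewrite /potential zy// y1 /=; case: asboolP => [_|[]]; last by exists j.
rewrite (runE zj); case: j Nj {zj} => // j; rewrite ltnS => Nj.
by apply: HN; rewrite /= ltnW.
Qed.

End GibbsMeasures.

Section LogAsymptotic.
Context {R : realType} {k : nat}.
Implicit Types (Y : set (symseq k)) (F : nat -> symseq k -> R) (g : symseq k -> R).

Lemma log_asymptotic_of_bound Y F g (E : nat -> R) : Y !=set0 ->
  (forall n y, Y y -> (0 < n)%N -> `|ln (F n y) - birkhoff n g y| <= E n) ->
  E n / n%:R @[n --> \oo] --> (0 : R) -> log_asymptotic Y F g.
Proof.
move=> [y0 Yy0] bnd E0; rewrite /log_asymptotic.
apply: (@squeeze_cvge _ _ _ _ (fun=> 0%E) _ (fun n => (E n / n%:R)%:E)).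
- near=> n; have n0 : (0 < n)%N by near: n; exists 1%N.
  have ni : 0 <= (n%:R^-1 : R) by rewrite invr_ge0.
  apply/andP; split.
    apply: mule_ge0; first by rewrite lee_fin.
    apply: le_trans (ereal_sup_ubound _); last by exists y0.
    by rewrite lee_fin.
  rewrite mulrC EFinM lee_pmul2l// ?lte_fin ?invr_gt0 ?ltr0n//.
  by apply: ge_ereal_sup => _ [y Yy <-]; rewrite lee_fin bnd.
- exact: cvg_cst.
- by apply: cvg_EFin => //; apply: nearW.
Unshelve. all: by end_near.
Qed.

Lemma log_asymptotic_bound Y F g : log_asymptotic Y F g ->
  forall e, 0 < e -> exists N : nat, forall n y, (N <= n)%N -> (0 < n)%N -> Y y ->
    `|ln (F n y) - birkhoff n g y| <= n%:R * e.
Proof.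
move=> /fine_cvgP[[N1 _ fin] lim] e e0.
move/cvgrPdist_le : lim => /(_ e e0)[N2 _ HN].
exists (maxn N1 N2) => n y; rewrite geq_max => /andP[n1 n2] n0 Yy.
have fn := fin n n1; have := HN n n2; rewrite /= sub0r normrN.
move=> /(le_trans (ler_norm _)) le.
have n0R : 0 < n%:R :> R by rewrite ltr0n.
rewrite -ler_pdivrMl// -lee_fin.
apply: (@le_trans _ _ (n%:R^-1%:E * sup_norm Y (fun y => (ln (F n y) - birkhoff n g y)%R))%E).
  rewrite EFinM lee_pmul2l// ?lte_fin ?invr_gt0//.
  by apply: ereal_sup_ubound; exists y.
by rewrite -[X in (X <= _)%E]fineK// lee_fin.
Qed.

(** This makes the error of weak almost additivity nondecreasing: the bound for
    a word uses the errors for its shorter pieces. *)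
Lemma running_max_sublinear (C : nat -> R) : C n / n%:R @[n --> \oo] --> (0 : R) ->
  (\big[Num.max/0]_(i < n) C i.+1) / n%:R @[n --> \oo] --> (0 : R).
Proof.
move=> C0; apply/cvgrPdist_le => e e0.
move/cvgrPdist_le : C0 => /(_ e e0)[N _ HN].
(* the terms before [N], which a large denominator makes negligible *)
pose A := \big[Num.max/0]_(i < N) C i.+1.
have A0 : 0 <= A by exact: bigmax_ge_id.
have [N' HN'] : exists N' : nat, A / e <= N'%:R.
  by exists (Num.bound (A / e)); rewrite ltW// archi_boundP// divr_ge0// ltW.
exists (maxn N N').+1 => // n /= nN; rewrite sub0r normrN.
have n0 : 0 < n%:R :> R by rewrite ltr0n (leq_trans _ nN).
have m0 : 0 <= \big[Num.max/0]_(i < n) C i.+1 by exact: bigmax_ge_id.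
rewrite ger0_norm ?divr_ge0 ?(ltW n0)// ler_pdivrMr//.
have An : A <= e * n%:R.
  move: HN'; rewrite ler_pdivrMr// => /le_trans; apply.
  by rewrite mulrC ler_wpM2l ?(ltW e0)// ler_nat (leq_trans _ (ltnW nN)) ?leq_maxr.
apply: bigmax_le => [|i _]; first by rewrite mulr_ge0 ?ltW.
have [iN|Ni] := ltnP i N.
  by apply: le_trans An; exact: (le_bigmax _ (fun i : 'I_N => C i.+1) (Ordinal iN)).
have := HN i.+1 (leqW Ni); rewrite /= sub0r normrN => /(le_trans (ler_norm _)).
rewrite ler_pdivrMr ?ltr0n// => /le_trans; apply.
by rewrite ler_wpM2l ?(ltW e0)// ler_nat.
Qed.

End LogAsymptotic.

Section QuasiMultiplicativity.
Context {R : realType} (c : hidden_chain R) (B : 'M[bool]_2).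
Hypothesis cB : carried c B.
Local Notation Y := (sft B).
Variables (F : nat -> symseq 2 -> R) (kap : R).
Hypothesis F0 : forall n y, (0 < n)%N -> Y y -> 0 < F n y.
Hypothesis Fw : forall n y, (0 < n)%N -> Y y -> `|ln (F n y) - log_weight c y n| <= kap.

Lemma log_weight0 y : log_weight c y 0 = 0.
Proof. by rewrite /log_weight weight_nil ln1. Qed.

Lemma log_weight_almost_additive (C D : nat -> R) :
  (forall n, 0 <= D n) -> (forall n, (0 < n)%N -> C n + 3 * kap <= D n) ->
  (forall y n m, Y y -> (0 < n)%N -> (0 < m)%N ->
    expR (- C n) * (F n y * F m (iter n shift y)) <= F (n + m)%N y <=
    expR (C n) * (F n y * F m (iter n shift y))) ->
  forall y n m, Y y ->
  `|log_weight c y (n + m) - log_weight c y n - log_weight c (iter n shift y) m| <= D n.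
Proof.
move=> D0 CD aa y [|n] m Yy.
  by rewrite add0n log_weight0 subr0 subrr normr0.
case: m => [|m]; first by rewrite addn0 log_weight0 subr0 subrr normr0.
apply: le_trans (CD n.+1 isT).
have := aa y n.+1 m.+1 Yy isT isT.
have a0 := F0 (ltn0Sn n) Yy; have b0 := F0 (ltn0Sn m) (sft_iter n.+1 Yy).
have c0 : 0 < F (n.+1 + m.+1)%N y by apply: F0.
have h1 := Fw (ltn0Sn n) Yy; have h2 := Fw (ltn0Sn m) (sft_iter n.+1 Yy).
have h3 : `|ln (F (n.+1 + m.+1)%N y) - log_weight c y (n.+1 + m.+1)| <= kap by apply: Fw.
rewrite -[F n.+1 y]lnK// -[F m.+1 _]lnK// -[F (_ + _)%N y]lnK// -!expRD !ler_expR.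
move: h1 h2 h3; rewrite !ler_norml; lra.
Qed.

End QuasiMultiplicativity.

Section Existence.
Context {R : realType} (c : hidden_chain R) (B : 'M[bool]_2).
Hypothesis cB : carried c B.
Local Notation Y := (sft B).

Lemma follows_unique_weak_gibbs g (E : nat -> R) : follows c B g E ->
  E n / n%:R @[n --> \oo] --> (0 : R) ->
  exists_unique_measure (R := R) (weak_gibbs Y g).
Proof.
move=> fg E0; have [m [im mE]] := chain_measure cB.
exists m; last by move=> m' wm' A mA; exact: (follows_weak_gibbs_unique cB fg E0 im mE).
split=> //; exists (ln (hc_lam c)), (fun n => expR (E n)); split.
- by move=> n _; exact: expR_gt0.
- by under eq_fun do rewrite expRK.
- exact: follows_gibbs_bound.
Qed.

Lemma cst_sublinear (x : R) : x / n%:R @[n --> \oo] --> (0 : R).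
Proof.
apply/cvgrPdist_le => e e0.
exists (Num.bound (`|x| / e)).+1 => // n /= nN; rewrite sub0r normrN normrM normfV.
have n0 : 0 < n%:R :> R by rewrite ltr0n (leq_trans _ nN).
rewrite (ger0_norm (ltW n0)) ler_pdivrMr// mulrC -ler_pdivrMr//.
apply: le_trans (ltW (archi_boundP _)) _; first by rewrite divr_ge0// ltW.
by rewrite ler_nat ltnW.
Qed.

Lemma affine_sublinear (D : nat -> R) (a x : R) : D n / n%:R @[n --> \oo] --> (0 : R) ->
  (a * D n + x) / n%:R @[n --> \oo] --> (0 : R).
Proof.
move=> D0; under eq_fun do rewrite mulrDl -mulrA.
suff : a * (D n / n%:R) + x / n%:R @[n --> \oo] --> a * 0 + 0 by rewrite mulr0 addr0.
by apply: cvgD; [exact: cvgMr|exact: cst_sublinear].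
Qed.

Lemma gibbs_weak_gibbs g (m : probability (borel_symseq 1) R) :
  gibbs Y g m -> weak_gibbs Y g m.
Proof.
move=> [im [P [C [C0 gb]]]]; split=> //; exists P, (fun=> C); split=> //.
exact: cst_sublinear.
Qed.

Lemma follows_unique_gibbs g (E : R) : follows c B g (fun=> E) ->
  exists_unique_measure (R := R) (gibbs Y g).
Proof.
move=> fg; have [m [im mE]] := chain_measure cB.
exists m; last first.
  move=> m' /gibbs_weak_gibbs wm' A mA.
  exact: (follows_weak_gibbs_unique cB fg (cst_sublinear E) im mE).
split=> //; exists (ln (hc_lam c)), (expR E); split; first exact: expR_gt0.
exact: follows_gibbs_bound.
Qed.

Lemma sft_ones : Y (fun=> 1).
Proof. by apply: (sft_no00 cB) => i; left. Qed.

(** The weights of [1^n] and of the return word with [n] letters 1 differ by a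
    subexponential factor, and by Cesaro averaging the limit of the ratios of the
    latter is their rate of growth. *)
Lemma return_rate_unique (D : nat -> R) (L L' : R) :
  (forall n, 0 <= D n) -> (forall n m, (n <= m)%N -> D n <= D m) ->
  (forall y n m, Y y -> `|log_weight c y (n + m) - log_weight c y n -
     log_weight c (iter n shift y) m| <= D n) ->
  (forall n, `|log_weight c (fun=> 1) n - n%:R * L| <= D n) ->
  D n / n%:R @[n --> \oo] --> (0 : R) ->
  ln (run_weight c n.+1) - ln (run_weight c n) @[n --> \oo] --> L' -> L' = L.
Proof.
move=> D0 Dm QM HL Dlim lim.
pose bc := boundary_const c D.
have bnd n : `|ln (run_weight c n) - n%:R * L| <= 3 * D n + 2 * bc.
  pose y : symseq 2 := fun i : nat => if (i == n)%N then 0 else 1.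
  have Yy : Y y.
    apply: (sft_no00 cB) => i; rewrite /y; case: (eqVneq i n) => [->|]; last by left.
    by right; rewrite gtn_eqF.
  have yn : y n = 0 by rewrite /y eqxx.
  have rn : run_is y n by split=> // i ltin; rewrite /y ltn_eqF.
  have := potential_bound cB D0 Dm QM HL n Yy.
  rewrite (birkhoff_potential cB L Yy yn (leqnn n)) subnn /return_log (runE rn).
  have -> : run (iter n shift y) = 0%N.
    by apply: runE; split=> //; rewrite iter_shift add0n.
  rewrite /= subnn ln1 add0r addrK.
  have -> : log_weight c y n = log_weight c (fun=> 1) n.
    by rewrite /log_weight; congr (ln (weight _ _)); apply: word_eqP => i /(proj2 rn).
  by have := HL n; rewrite -/bc !ler_norml; lra.
have c1 : ln (run_weight c n.+1) / n.+1%:R @[n --> \oo] --> L'.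
  have := cesaro lim; apply: cvg_trans; apply: near_eq_cvg; apply: nearW => n.
  rewrite /arithmetic_mean /= mulrC; congr (_ * _).
  rewrite seriesEnat /= telescope_sumr// /= ln1 subr0//.
have c2 : ln (run_weight c n.+1) / n.+1%:R @[n --> \oo] --> L.
  have E0 := affine_sublinear 3 (2 * bc) Dlim.
  apply/cvgrPdist_le => e e0.
  move/cvgrPdist_le : E0 => /(_ e e0)[N _ HN].
  exists N => // n /= Nn; have := HN n.+1 (leqW Nn); rewrite /= sub0r normrN.
  have n0 : 0 < n.+1%:R :> R by rewrite ltr0n.
  move=> /(le_trans (ler_norm _)); rewrite ler_pdivrMr// => h.
  rewrite -(ler_pM2r n0) -[X in _ * X]ger0_norm ?(ltW n0)// -normrM mulrBl divfK ?gt_eqF//.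
  by rewrite distrC mulrC; exact: le_trans (bnd n.+1) h.
exact: (cvg_unique _ c1 c2).
Qed.

End Existence.

(** * From a Gibbs measure to almost additivity *)

Section Converse.
Context {R : realType} (c : hidden_chain R) (B : 'M[bool]_2).
Hypothesis cB : carried c B.
Local Notation Y := (sft B).
Variable g : symseq 2 -> R.
Variables (F : nat -> symseq 2 -> R) (kap : R).
Hypothesis Fw : forall n y, (0 < n)%N -> Y y -> `|ln (F n y) - log_weight c y n| <= kap.
Hypothesis asym : log_asymptotic Y F g.

Lemma birkhoff_cyclic w n : birkhoff (n * size w) g (cyclic_seq w) =
  n%:R * birkhoff (size w) g (cyclic_seq w).
Proof.
elim: n => [|n IH]; first by rewrite mul0n mul0r /birkhoff big_ord0.
by rewrite mulSn birkhoffD iter_shift_periodic IH -natr1; ring.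
Qed.

(** Along a periodic sequence both [log F] and the Birkhoff sums of [g] are
    additive, so an asymptotic equality is an equality. *)
Lemma loop_birkhoff w : Y (cyclic_seq (0 :: w)) ->
  ln (loop_weight c (0 :: w)) = birkhoff (size w).+1 g (cyclic_seq (0 :: w)).
Proof.
have [_ _ _ pos] := cB.
move=> Yq; set q := cyclic_seq _ in Yq *; set N := (size w).+1.
have lw0 : 0 < loop_weight c (0 :: w) by exact: (loop_weight_gt0 cB).
have l0 : 0 < hc_l c 0 0 by have [] := lh_gt0 (hc_0S c).
have f0 : 0 < weight_from c (0 :: w).
  have := pos q Yq (1 * N)%N; rewrite (@word_periodic (0 :: w))// weight_power.
  by rewrite expr0 mul1r pmulr_rgt0.
set x := ln (loop_weight c (0 :: w)); set s := birkhoff N g q.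
pose K := `|ln (hc_l c 0 0) + ln (weight_from c (0 :: w)) - x| + kap.
apply/eqP; rewrite -subr_eq0 -normr_le0; apply/ler_addgt0Pr => e e0; rewrite add0r.
have N0 : 0 < N%:R :> R by rewrite ltr0n.
have e2 : 0 < e / 2 by rewrite divr_gt0.
have [n0 Hn] := log_asymptotic_bound asym (divr_gt0 e2 N0).
have /cvgrPdist_le/(_ _ e2)[n1 _ Hn1] := cst_sublinear K.
pose k := (maxn n0 n1).+1; have k0 : 0 < k%:R :> R by rewrite ltr0n.
have kN : (n0 <= k * N)%N.
  by rewrite (leq_trans (leq_maxl n0 n1))// (leq_trans (leqnSn _))// leq_pmulr.
have kN0 : (0 < k * N)%N by rewrite muln_gt0.
have h1 := Hn (k * N)%N q kN kN0 Yq; have h2 := Fw kN0 Yq.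
have h3 : K <= k%:R * (e / 2).
  have := Hn1 k; rewrite /= sub0r normrN => /(_ _)/(le_trans (ler_norm _)).
  rewrite ler_pdivrMr// mulrC; apply; by rewrite (leq_trans (leq_maxr n0 n1)).
have h4 : log_weight c q (k * N) = ln (hc_l c 0 0) + (k.-1%:R * x + ln (weight_from c (0 :: w))).
  rewrite /log_weight (@word_periodic (0 :: w))// weight_power.
  rewrite !lnM ?posrE ?mulr_gt0 ?exprn_gt0// lnXn// mulr_natl//.
have h5 : birkhoff (k * N) g q = k%:R * s by exact: (birkhoff_cyclic (0 :: w)).
rewrite h5 natrM in h1; rewrite h4 in h2.
have h6 : k%:R = k.-1%:R + 1 :> R by rewrite natr1.
have E1 : k%:R * N%:R * (e / 2 / N%:R) = k%:R * (e / 2).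
  by rewrite -mulrA; congr (_ * _); rewrite mulrC divfK// gt_eqF.
rewrite E1 in h1.
rewrite -(ler_pM2l k0) -[X in X * `|_|](ger0_norm (ltW k0)) -normrM.
move: h1 h2 h3; rewrite /K.
have := ler_norm (ln (hc_l c 0 0) + ln (weight_from c (0 :: w)) - x).
have := ler_norm (- (ln (hc_l c 0 0) + ln (weight_from c (0 :: w)) - x)).
rewrite normrN !ler_norml h6; lra.
Qed.

Variables (V bd : R).
Hypothesis g_bd : forall y, Y y -> `|g y| <= bd.
Hypothesis g_bowen : forall n y z, Y y -> Y z -> word y n = word z n ->
  `|birkhoff n g y - birkhoff n g z| <= V.

Lemma birkhoff_bd y n : Y y -> `|birkhoff n g y| <= n%:R * bd.
Proof.
elim: n y => [|n IH] y Yy; first by rewrite /birkhoff big_ord0 normr0 mul0r.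
rewrite birkhoffS (le_trans (ler_normD _ _))// -natr1 mulrDl mul1r addrC lerD//.
  by apply: IH; exact: sft_shift.
exact: g_bd.
Qed.

(** The letters of [s] and [t] contribute at most [bd] each, and along [u] two
    points of the same cylinder differ by at most [V]. *)
Lemma birkhoff_loop y u s t : Y y -> word y (size u) = u ->
  Y (cyclic_seq (s ++ u ++ t)) -> (0 < size (s ++ u ++ t))%N ->
  `|birkhoff (size (s ++ u ++ t)) g (cyclic_seq (s ++ u ++ t)) -
    birkhoff (size u) g y| <= V + (size s)%:R * bd + (size t)%:R * bd.
Proof.
move=> Yy yu Yq sz; set q := cyclic_seq _ in Yq *.
rewrite !size_cat !birkhoffD.
have Yq1 := sft_iter (size s) Yq.
have Yq2 := sft_iter (size u) Yq1.
have h1 := birkhoff_bd (size s) Yq; have h3 := birkhoff_bd (size t) Yq2.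
have wq : word (iter (size s) shift q) (size u) = word y (size u).
  have := word_periodic 1 sz; rewrite mul1n /= cats0 -/q => E.
  have := congr1 (fun v => take (size u) (drop (size s) v)) E.
  rewrite size_cat word_cat !drop_size_cat ?size_word// size_cat word_cat.
  by rewrite !take_size_cat ?size_word// yu.
have h2 := g_bowen Yq1 Yy wq.
move: h1 h2 h3; rewrite !ler_norml; lra.
Qed.

(** The word is closed up into a loop by the prefix 01 and the suffix 1, which
    is always allowed; the weight of the loop is at most a constant times that of
    the word. *)
Lemma weight_lower : exists G : R, forall y n, Y y ->
  birkhoff n g y <= log_weight c y n + G.
Proof.
have [B1 B1' _ pos] := cB.
have [C C0 sub] := weight_submul c.
have [l0 h0] := lh_gt0 (hc_0S c).
pose M := C ^+ 2 * weight c [:: 0; 1] * weight c [:: 1] / (hc_l c 0 0 * hc_h c 0 0).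
have w01 : 0 < weight c [:: 0; 1].
  have [y Yy <-] : exists2 y, Y y & word y 2 = [:: 0; 1].
    pose y : symseq 2 := fun n : nat => if n is 0%N then 0 else 1.
    have Yy : Y y by apply: (sft_no00 cB) => i; case: i => [|i]; [right|left].
    by exists y.
  exact: pos.
have w1 : 0 < weight c [:: 1].
  by have := pos (fun=> 1) (sft_ones cB) 1%N.
have M0 : 0 < M by rewrite divr_gt0 ?mulr_gt0 ?exprn_gt0.
exists (ln M + (V + 2 * bd + 1 * bd)) => y n Yy; pose u := word y n.
pose w := 1 :: u ++ [:: 1].
have Yw : Y (cyclic_seq (0 :: w)).
  apply: periodic_sft; rewrite /w /= B1 /= rcons_cat /= cat_path.
  by rewrite (sft_path n Yy (B1' _)) /= B1 B1'.
have lo := birkhoff_loop (u := u) (s := [:: 0; 1]) (t := [:: 1]) Yy.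
rewrite /u size_word in lo; have {lo} := lo erefl Yw isT.
rewrite -/u -[[:: 0; 1] ++ _]/(0 :: w) -(loop_birkhoff Yw) /=.
have wu : 0 < weight c u by exact: pos.
have : ln (loop_weight c (0 :: w)) <= ln M + log_weight c y n.
  have lw0 : 0 < loop_weight c (0 :: w) by exact: (loop_weight_gt0 cB).
  rewrite /log_weight -/u -lnM ?posrE// ler_ln ?posrE ?(mulr_gt0 M0 wu)//.
  have := loop_weight_le c (0 :: w).
  rewrite mulrAC [X in X <= _]mulrC -ler_pdivlMr ?mulr_gt0// => /le_trans; apply.
  rewrite /M mulrAC ler_pM2r ?invr_gt0 ?mulr_gt0//.
  apply: (le_trans (sub [:: 0; 1] (u ++ [:: 1]))).
  rewrite [X in _ <= X](_ : _ = C * (weight c [:: 0; 1] * (C * (weight c u * weight c [:: 1])))).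
    by rewrite ler_pM2l// ler_pM2l// sub.
  ring.
rewrite ler_norml; lra.
Qed.

(** Every path that emits the word is completed into loops at 0 by paths of the
    length for which [K] has a positive power, so the weight of the word is at
    most a constant times the sum of the weights of finitely many loops. *)
Lemma weight_upper : exists G : R, forall y n, Y y ->
  log_weight c y n <= birkhoff n g y + G.
Proof.
have [_ _ _ pos] := cB; have [K0 _ Km] := hc_prim c.
pose m := hc_m c; pose A := hc_K c ^+ m.
pose W := wsum m (fun _ : seq 'I_2 => wsum m (fun _ : seq 'I_2 => 1 : R)).
pose Q := 1 + \sum_(ij : 'I_3 * 'I_3)
  (hc_l c 0 ij.1 * hc_h c ij.2 0 / (A 0 ij.1 * A ij.2 0)).
have A0 : mx_nonneg A by exact: mx_nonneg_exp.
have q0 (ij : 'I_3 * 'I_3) : 0 <= hc_l c 0 ij.1 * hc_h c ij.2 0 / (A 0 ij.1 * A ij.2 0).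
  by rewrite divr_ge0// mulr_ge0// ?l_ge0 ?h_ge0.
have Q0 : 0 < Q by rewrite ltr_pwDl// sumr_ge0.
have lh i j : hc_l c 0 i * hc_h c j 0 <= Q * (A 0 i * A j 0).
  have [iS|iS] := boolP (i \in hc_S c); last first.
    by have [-> _] := lh_eq0 iS; rewrite mul0r !mulr_ge0// ltW.
  have [jS|jS] := boolP (j \in hc_S c); last first.
    by have [_ ->] := lh_eq0 jS; rewrite mulr0 !mulr_ge0// ltW.
  have Aij : 0 < A 0 i * A j 0 by rewrite mulr_gt0// Km// hc_0S.
  rewrite -ler_pdivrMr// /Q (bigD1 (i, j))//= addrCA lerDl addr_ge0// sumr_ge0//.
have W0 : 0 < W.
  have wpos k (f : seq 'I_2 -> R) : (forall w, 0 < f w) -> 0 < wsum k f.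
    elim: k f => [|k IH] f f0 /=; first exact: f0.
    by rewrite big_ord_recl ltr_pwDl ?IH// sumr_ge0// => i _; rewrite ltW// IH.
  by apply: (wpos m) => _; exact: (wpos m).
exists (ln (Q * W) + (V + m%:R * bd + m%:R * bd)) => y n Yy; pose u := word y n.
have wu : 0 < weight c u by exact: pos.
pose T := expR (birkhoff n g y + (V + m%:R * bd + m%:R * bd)).
have term s t : size s = m -> size t = m -> emits c (s ++ u ++ t) 0 0 <= T.
  move=> sm tm; have [le0|gt0] := leP (emits c (s ++ u ++ t) 0 0) 0.
    by apply: le_trans le0 _; exact: expR_ge0.
  case: s sm gt0 => [|a s] sm gt0; first by have := hc_m_gt0 c; rewrite -/m -sm.
  have [la pa] := emits_path cB gt0.
  have a0 : a = 0 by rewrite -la.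
  subst a; have Yq : Y (cyclic_seq (0 :: (s ++ u ++ t))) by exact: periodic_sft.
  have := birkhoff_loop (u := u) (s := 0 :: s) (t := t) Yy.
  rewrite /u size_word -/u => /(_ erefl Yq isT).
  have := loop_birkhoff Yq; rewrite /loop_weight => <-.
  rewrite sm tm -ler_ln ?posrE ?expR_gt0// expRK ler_norml; lra.
have le : weight c u <= Q * W * T.
  rewrite weightE.
  apply: (@le_trans _ _ (\sum_i \sum_j Q * (A 0 i * emits c u i j * A j 0))).
    apply: ler_sum => i _; apply: ler_sum => j _.
    rewrite mulrAC (_ : Q * _ = Q * (A 0 i * A j 0) * emits c u i j); last by ring.
    by rewrite ler_wpM2r ?lh// emits_ge0.
  rewrite (_ : \sum_i _ = Q * (A *m emits c u *m A) 0 0); last first.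
    rewrite mxE mulr_sumr; under [RHS]eq_bigr do rewrite mxE mulr_suml mulr_sumr.
    by rewrite exchange_big.
  rewrite -mulrA ler_pM2l//.
  have -> : (A *m emits c u *m A) 0 0 =
      wsum m (fun s => wsum m (fun t => emits c (s ++ u ++ t) 0 0)).
    rewrite /A -(wsum_emits c m) !wsum_mxl wsum_mxE; apply: eq_wsum => s _.
    rewrite wsum_mxr wsum_mxE; apply: eq_wsum => t _.
    by rewrite !emits_cat mulmxA.
  apply: (@le_trans _ _ (wsum m (fun _ : seq 'I_2 => wsum m (fun _ : seq 'I_2 => T * 1)))).
    by apply: ler_wsum => s sm; apply: ler_wsum => t tm; rewrite mulr1 term.
  rewrite [X in _ <= X]mulrC /W -wsumZ; apply: ler_wsum => s _.
  by rewrite wsumZ.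
rewrite /log_weight -/u -ler_expR lnK ?posrE//.
apply: le_trans le _; rewrite addrCA expRD lnK ?posrE ?mulr_gt0//.
Qed.

End Converse.

Section GibbsConverse.
Context {R : realType} (c : hidden_chain R) (B : 'M[bool]_2).
Hypothesis cB : carried c B.
Local Notation Y := (sft B).
Variables (g : symseq 2 -> R) (m : probability (borel_symseq 1) R).
Hypothesis gm : gibbs Y g m.

(** two points of a cylinder compare with the measure of the same cylinder *)
Lemma gibbs_bowen : exists V, forall n y z, Y y -> Y z -> word y n = word z n ->
  `|birkhoff n g y - birkhoff n g z| <= V.
Proof.
have [_ [P [C [C0 gb]]]] := gm; exists `|2 * ln C| => -[|n] y z Yy Yz yz.
  by rewrite /birkhoff !big_ord0 subrr normr0.
have := gb y n.+1 Yy isT; have := gb z n.+1 Yz isT; rewrite yz.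
set t := fine _; rewrite -[C]lnK// => /andP[z1 z2] /andP[y1 y2].
move: z1 z2 y1 y2; rewrite !ler_pdivlMr ?expR_gt0// !ler_pdivrMr ?expR_gt0//.
rewrite -!expRN -!expRD => z1 z2 y1 y2.
have := le_trans z1 y2; have := le_trans y1 z2.
rewrite !ler_expR; have := ler_norm (2 * ln C); rewrite expRK ler_norml; lra.
Qed.

(** [g] is its Birkhoff sum of length 1, and there are two cylinders of length
    1 *)
Lemma gibbs_bounded : exists bd, forall y, Y y -> `|g y| <= bd.
Proof.
have [V HV] := gibbs_bowen.
pose z : symseq 2 := fun n : nat => if n is 0%N then 0 else 1.
have Yz : Y z by apply: (sft_no00 cB) => i; case: i => [|i]; [right|left].
have Y1 := sft_ones cB; set o : symseq 2 := fun=> 1 in Y1.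
exists (V + `|g z| + `|g o|) => y Yy.
have b1 x : birkhoff 1 g x = g x by rewrite /birkhoff big_ord1.
have V0 : 0 <= V by have := HV 0%N o o Y1 Y1 erefl; exact: le_trans.
have [y0|/ord2_neq0 y0] := eqVneq (y 0%N) 0.
  have := HV 1%N y z Yy Yz; rewrite !b1 !word_cons y0 => /(_ erefl) h.
  rewrite -[g y](subrK (g z)) (le_trans (ler_normD _ _))//.
  by apply: (@le_trans _ _ (V + `|g z|)); [exact: lerD|rewrite lerDl].
have := HV 1%N y o Yy Y1; rewrite !b1 !word_cons y0 => /(_ erefl) h.
rewrite -[g y](subrK (g o)) (le_trans (ler_normD _ _))//.
by rewrite lerD// (le_trans h)// lerDl.
Qed.

Lemma gibbs_almost_additive (F : nat -> symseq 2 -> R) (kap : R) :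
  (forall n y, (0 < n)%N -> Y y -> 0 < F n y) ->
  (forall n y, (0 < n)%N -> Y y -> `|ln (F n y) - log_weight c y n| <= kap) ->
  log_asymptotic Y F g ->
  exists2 C : R, 0 < C & forall y n m, Y y -> (0 < n)%N -> (0 < m)%N ->
    expR (- C) * (F n y * F m (iter n shift y)) <= F (n + m)%N y <=
    expR C * (F n y * F m (iter n shift y)).
Proof.
move=> F0 Fw asym; have [V HV] := gibbs_bowen; have [bd Hbd] := gibbs_bounded.
have [G1 H1] := weight_lower cB Fw asym Hbd HV.
have [G2 H2] := weight_upper cB Fw asym Hbd HV.
pose G := `|G1| + `|G2| + `|kap|.
have close n y : (0 < n)%N -> Y y -> `|ln (F n y) - birkhoff n g y| <= G.
  move=> n0 Yy; have := Fw n y n0 Yy; have := H1 y n Yy; have := H2 y n Yy.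
  have := ler_norm G1; have := ler_norm G2; have := ler_norm kap.
  have := normr_ge0 G1; have := normr_ge0 G2; rewrite /G !ler_norml; lra.
have G0 : 0 <= G by rewrite !addr_ge0.
exists (3 * G + 1) => [|y n k Yy n0 k0]; first by lra.
have nk0 : (0 < n + k)%N by rewrite addn_gt0 n0.
have a0 := F0 n y n0 Yy; have b0 := F0 k _ k0 (sft_iter n Yy); have c0 := F0 _ y nk0 Yy.
rewrite -[F n y]lnK// -[F k _]lnK// -[F (n + k)%N y]lnK// -!expRD !ler_expR.
have := close n y n0 Yy; have := close k _ k0 (sft_iter n Yy); have := close _ y nk0 Yy.
rewrite birkhoffD !ler_norml; lra.
Qed.

End GibbsConverse.

(** * Return weights *)

Section LinearRecurrence.
Context {R : realType}.

(** The ratios of consecutive terms of a positive sequence satisfying a linear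
    recurrence of order two converge, when the sum of the two characteristic
    roots is positive: subtracting the smaller root [b], the terms
    [a (n+1) - b a n] form a geometric sequence for the larger root [r]. *)
Lemma recurrence_ratio_cvg (a : nat -> R) (t d : R) :
  (forall n, 0 < a n) -> (forall n, a n.+2 = t * a n.+1 - d * a n) ->
  0 < t -> 4 * d <= t ^+ 2 ->
  exists2 r : R, 0 < r & a n.+1 / a n @[n --> \oo] --> r.
Proof.
move=> a0 rec t0 disc.
pose s := Num.sqrt (t ^+ 2 - 4 * d).
have s0 : 0 <= s by exact: sqrtr_ge0.
have s2 : s ^+ 2 = t ^+ 2 - 4 * d by rewrite sqr_sqrtr// subr_ge0.
pose r := (t + s) / 2; pose b := (t - s) / 2.
have r0 : 0 < r by rewrite /r; lra.
have rb : r + b = t by rewrite /r /b; lra.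
have rbd : r * b = d.
  have -> : d = (t ^+ 2 - s ^+ 2) / 4 by rewrite s2; lra.
  by rewrite /r /b; field.
pose e := a 1%N - b * a 0%N.
have geo n : a n.+1 - b * a n = e * r ^+ n.
  elim: n => [|n IH]; first by rewrite expr0 mulr1.
  by rewrite exprSr mulrA -IH rec -rb -rbd; ring.
have rn n : 0 < r ^+ n by rewrite exprn_gt0.
(* the sequence is geometric for the smaller root [b], which must be positive *)
have [e0|e0] := eqVneq e 0.
  have step n : a n.+1 = b * a n by apply/eqP; rewrite -subr_eq0 geo e0 mul0r.
  exists b; first by rewrite -(pmulr_lgt0 _ (a0 0%N)) -step.
  under eq_fun do rewrite step mulfK ?gt_eqF//.
  exact: cvg_cst.
exists r => //; pose z n := a n / r ^+ n.
have z0 n : 0 < z n by rewrite divr_gt0.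
have ratio n : a n.+1 / a n = b + e / z n.
  have := geo n => /eqP; rewrite subr_eq => /eqP ->.
  by rewrite /z; field; rewrite !gt_eqF.
under eq_fun do rewrite ratio.
have zS n : z n.+1 = b / r * z n + e / r.
  have := geo n => /eqP; rewrite subr_eq => /eqP E.
  by rewrite /z E exprS; field; rewrite !gt_eqF.
(* a double root: [z] is affine in [n], and increasing as it stays positive *)
have [sz|sn] := eqVneq s 0.
  have br : b = r by rewrite /b /r sz; lra.
  have zE n : z n = z 0%N + n%:R * (e / r).
    elim: n => [|n IH]; first by rewrite mul0r addr0.
    by rewrite zS IH br divff ?gt_eqF// -natr1; ring.
  have e1 : 0 < e.
    rewrite lt_neqAle eq_sym e0 leNgt; apply/negP => en.
    pose n := Num.bound (z 0%N / (- e / r)).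
    have p : 0 < - e / r by rewrite divr_gt0// oppr_gt0.
    have := archi_boundP (ltW (divr_gt0 (z0 0%N) p)); rewrite -/n ltr_pdivrMr//.
    by have := z0 n; rewrite zE; lra.
  suff : b + e / z n @[n --> \oo] --> b + 0 by rewrite addr0 {2}br.
  apply: cvgD; first exact: cvg_cst.
  apply/cvgrPdist_le => eps eps0; exists (Num.bound (r / eps)).+1 => // n /= nN.
  rewrite sub0r normrN (ger0_norm (divr_ge0 (ltW e1) (ltW (z0 n)))).
  rewrite (ler_pdivrMr _ _ (z0 n)) zE.
  have n1 : r / eps <= n%:R.
    apply: le_trans (ltW (archi_boundP _)) _; first by rewrite divr_ge0 ?(ltW r0) ?ltW.
    by rewrite ler_nat ltnW.
  move: n1; rewrite ler_pdivrMr// => n1.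
  have h : e <= eps * (n%:R * (e / r)).
    have -> : eps * (n%:R * (e / r)) = (n%:R * eps) / r * e by field; rewrite gt_eqF.
    by rewrite ler_peMl ?(ltW e1)// ler_pdivlMr// mul1r.
  by apply: le_trans h _; rewrite ler_pM2l// lerDr ltW.
pose q := b / r; pose ze := e / s.
have q1 : `|q| < 1.
  rewrite /q normf_div (ger0_norm (ltW r0)) ltr_pdivrMr// mul1r.
  have sp : 0 < s by rewrite lt_neqAle eq_sym sn.
  by rewrite ltr_norml /b /r; apply/andP; split; lra.
have sE : s = r - b by rewrite /r /b; lra.
have zE n : z n = (z 0%N - ze) * q ^+ n + ze.
  elim: n => [|n IH]; first by rewrite expr0 mulr1 subrK.
  rewrite zS IH exprS /ze /q sE; field.
  by rewrite -sE sn gt_eqF.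
have zlim : z n @[n --> \oo] --> ze.
  under eq_fun do rewrite zE.
  suff : (z 0%N - ze) * q ^+ n + ze @[n --> \oo] --> (z 0%N - ze) * 0 + ze.
    by rewrite mulr0 add0r.
  by apply: cvgD; [apply: cvgMr; exact: cvg_expr|exact: cvg_cst].
have ze0 : ze != 0 by rewrite mulf_neq0// invr_eq0.
have -> : r = b + e / ze.
  by rewrite /ze invfM invrK mulrA mulfV// mul1r sE; lra.
apply: cvgD; first exact: cvg_cst.
by apply: cvgMr; exact: cvgV.
Qed.

End LinearRecurrence.

Section ReturnRatio.
Context {R : realType} (c : hidden_chain R) (B : 'M[bool]_2).
Hypothesis cB : carried c B.
Local Notation K := (hc_K c).

Let p j : R := emits c (nseq j 1) 1 0.
Let q j : R := emits c (nseq j 1) 2%:R 0.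

Lemma emits_ones_col a j i : letter i = a ->
  emits c (a :: nseq j.+1 1) i 0 = K i 1 * p j.+1 + K i 2%:R * q j.+1.
Proof.
move=> ia; have z : emits c (nseq j.+1 1) 0 0 = 0.
  by rewrite emits_cons mxE big1// => k _; rewrite mxE /letter eqxx mul0r.
rewrite emits_cons mxE !big_ord_recl big_ord0 addr0.
have -> : lift ord0 ord0 = 1 :> 'I_3 by exact: val_inj.
have -> : lift ord0 (lift ord0 ord0) = 2%:R :> 'I_3 by exact: val_inj.
by rewrite -[ord0]/(0 : 'I_3) z mulr0 add0r !mxE ia eqxx.
Qed.

Lemma emits_ones_step j : p j.+2 = K 1 1 * p j.+1 + K 1 2%:R * q j.+1 /\
  q j.+2 = K 2%:R 1 * p j.+1 + K 2%:R 2%:R * q j.+1.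
Proof. by split; exact: emits_ones_col. Qed.

Lemma return_weightE j : return_weight c j.+1 = K 0 1 * p j.+1 + K 0 2%:R * q j.+1.
Proof. exact: emits_ones_col. Qed.

Lemma return_ratio_cvg :
  (K 1 1 = 0 -> K 2%:R 2%:R = 0 -> 0 < K 1 2%:R -> 0 < K 2%:R 1 ->
   K 1 2%:R = K 2%:R 1 /\ (K 1 0 = K 2%:R 0 \/ K 0 1 = K 0 2%:R)) ->
  exists L : R, ln (run_weight c n.+1) - ln (run_weight c n) @[n --> \oo] --> L.
Proof.
move=> H; have [K0 _ _] := hc_prim c.
pose a n := return_weight c n.+1.
have a0 n : 0 < a n by exact: (return_weight_gt0 cB).
suff [r r0 lim] : exists2 r : R, 0 < r & a n.+1 / a n @[n --> \oo] --> r.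
  exists (ln r); rewrite -(cvg_shiftS _) /=.
  have -> : (fun n => ln (return_weight c n.+2) - ln (return_weight c n.+1)) =
            (fun n => ln (a n.+1 / a n)).
    by apply/funext => n; rewrite ln_div// posrE.
  by apply: continuous_cvg => //; exact: continuous_ln.
have stepP j := (emits_ones_step j).1; have stepQ j := (emits_ones_step j).2.
have rec n : a n.+2 = (K 1 1 + K 2%:R 2%:R) * a n.+1 -
    (K 1 1 * K 2%:R 2%:R - K 1 2%:R * K 2%:R 1) * a n.
  by rewrite /a !return_weightE (stepP n.+1) (stepQ n.+1) (stepP n) (stepQ n); ring.
have [t0|] := ltP 0 (K 1 1 + K 2%:R 2%:R).
  apply: recurrence_ratio_cvg rec t0 _ => //.
  have := sqr_ge0 (K 1 1 - K 2%:R 2%:R); have := mulr_ge0 (K0 1 2%:R) (K0 2%:R 1).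
  rewrite !expr2; lra.
have h1 := K0 1 1; have h2 := K0 2%:R 2%:R => h.
have k1 : K 1 1 = 0 by lra.
have k2 : K 2%:R 2%:R = 0 by lra.
have pos : 0 < K 1 2%:R /\ 0 < K 2%:R 1.
  have := a0 2%N; rewrite rec k1 k2 => h3.
  have h4 : 0 < K 1 2%:R * K 2%:R 1 by rewrite -(pmulr_lgt0 _ (a0 0%N)); lra.
  split; rewrite lt_neqAle K0 andbT eq_sym; apply/negP => /eqP E.
    by rewrite E mul0r ltxx in h4.
  by rewrite E mulr0 ltxx in h4.
have [k12 sym] := H k1 k2 pos.1 pos.2.
exists (K 1 2%:R); first exact: pos.1.
suff step n : a n.+1 = K 1 2%:R * a n.
  under eq_fun do rewrite step mulfK ?gt_eqF//.
  exact: cvg_cst.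
rewrite /a !return_weightE stepP stepQ k1 k2 !mul0r add0r addr0 -k12.
case: sym => [k0|->]; last by ring.
have pq : p n.+1 = q n.+1.
  elim: n => [|n IH]; last by rewrite stepP stepQ k1 k2 -k12 IH; ring.
  by rewrite /p /q !emits_cons emits_nil mulmx1 !mxE.
by rewrite pq; ring.
Qed.

End ReturnRatio.

(** * The relative pressure sequence *)

Section Conclusion.
Context {R : realType} (c : hidden_chain R) (B : 'M[bool]_2).
Hypothesis cB : carried c B.
Local Notation Y := (sft B).
Variables (F : nat -> symseq 2 -> R) (kap : R).
Hypothesis Fpos : forall n y, (0 < n)%N -> Y y -> 0 < F n y.
Hypothesis Fw : forall n y, (0 < n)%N -> Y y -> `|ln (F n y) - log_weight c y n| <= kap.

Lemma kap_ge0 : 0 <= kap.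
Proof. by apply: le_trans (Fw (ltn0Sn 0) (sft_ones cB)); exact: normr_ge0. Qed.

(** The common part of the almost additive and the weakly almost additive cases:
    [C] is the given error, and [D] a nondecreasing error for the weights. *)
Lemma potential_theory (C D : nat -> R) :
  (forall n, 0 <= D n) -> (forall n m, (n <= m)%N -> D n <= D m) ->
  (forall n, (0 < n)%N -> C n + 3 * kap <= D n) ->
  D n / n%:R @[n --> \oo] --> (0 : R) ->
  (forall y n m, Y y -> (0 < n)%N -> (0 < m)%N ->
    expR (- C n) * (F n y * F m (iter n shift y)) <= F (n + m)%N y <=
    expR (C n) * (F n y * F m (iter n shift y))) ->
  exists L : R, [/\ follows c B (potential c L) (fun n => 2 * D n + 2 * boundary_const c D),
    log_asymptotic Y F (potential c L) &
    forall L', ln (run_weight c n.+1) - ln (run_weight c n) @[n --> \oo] --> L' -> L' = L].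
Proof.
move=> D0 Dm CD Dlim aa.
have QM := log_weight_almost_additive Fpos Fw D0 CD aa.
have Y1 := sft_ones cB.
have ones n : iter n shift (fun=> 1 : 'I_2) = (fun=> 1) :> symseq 2.
  by apply/funext => i; rewrite iter_shift.
have [L HL'] : exists L, forall n, (0 < n)%N ->
    `|log_weight c (fun=> 1) n - n%:R * L| <= D n.
  by apply: almost_additive_rate => n m _ _; have := QM _ n m Y1; rewrite ones.
have HL n : `|log_weight c (fun=> 1) n - n%:R * L| <= D n.
  case: n => [|n]; last exact: HL'.
  by rewrite log_weight0 mul0r subrr normr0.
exists L; split.
- by move=> y n Yy _; exact: (potential_bound cB D0 Dm QM HL n Yy).
- apply: (@log_asymptotic_of_bound _ _ _ _ _
    (fun n => 2 * D n + (2 * boundary_const c D + kap))).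
  + by exists (fun=> 1).
  + move=> n y Yy n0; have := potential_bound cB D0 Dm QM HL n Yy.
    by have := Fw n0 Yy; rewrite !ler_norml; lra.
  + exact: affine_sublinear.
- by move=> L' lim; exact: (return_rate_unique cB D0 Dm QM HL Dlim lim).
Qed.

Lemma almost_additive_potential : almost_additive Y F ->
  exists L : R, [/\ exists_unique_measure (R := R) (gibbs Y (potential c L)),
    log_asymptotic Y F (potential c L) &
    forall L', ln (run_weight c n.+1) - ln (run_weight c n) @[n --> \oo] --> L' -> L' = L].
Proof.
move=> [_ [C C0 aa]]; have k0 := kap_ge0.
have [//|//|//||L [fL aL uL]] := @potential_theory (fun=> C) (fun=> C + 3 * kap) _ _ _ _ aa.
- by move=> n; lra.
- exact: cst_sublinear.
- by exists L; split=> //; exact: follows_unique_gibbs fL.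
Qed.

Lemma weakly_almost_additive_potential : weakly_almost_additive Y F ->
  exists L : R, [/\ exists_unique_measure (R := R) (weak_gibbs Y (potential c L)),
    log_asymptotic Y F (potential c L) &
    forall L', ln (run_weight c n.+1) - ln (run_weight c n) @[n --> \oo] --> L' -> L' = L].
Proof.
move=> [_ [C [C0 Clim aa]]]; have k0 := kap_ge0.
pose D n := \big[Num.max/0]_(i < n) C i.+1 + 3 * kap.
have Dlim : D n / n%:R @[n --> \oo] --> (0 : R).
  have := affine_sublinear 1 (3 * kap) (running_max_sublinear Clim).
  by under eq_fun do rewrite mul1r.
have [|||L [fL aL uL]] := @potential_theory C D _ _ _ Dlim aa.
- by move=> n; rewrite addr_ge0 ?bigmax_ge_id// mulr_ge0.
- by move=> n m nm; rewrite lerD2r; exact: (@le_bigmax_ord _ _ _ _ _ xpredT (fun i => C i.+1) nm).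
- case=> // n _; rewrite lerD2r.
  exact: (le_bigmax _ (fun i : 'I_n.+1 => C i.+1) ord_max).
- exists L; split=> //; apply: (follows_unique_weak_gibbs cB fL).
  exact: affine_sublinear.
Qed.

End Conclusion.

Lemma relative_g_word (R : realType) (X : set (symseq 3)) (p : 'I_3 -> 'I_2)
    (f : symseq 3 -> R) n y z :
  word y n = word z n -> relative_g X p f n y = relative_g X p f n z.
Proof.
move=> yz; rewrite /relative_g (_ : is_section X p n y = is_section X p n z)//.
by apply/funext => E; rewrite /is_section yz.
Qed.

(** Ratios of return weights can oscillate only when the block of the states 1
    and 2 is antidiagonal, which is where the conditions on [M] enter.  The
    entries of [K] and [M] agree in that case, since all states are live. *)
Lemma regular_block (R : realType) (A : 'M[bool]_3) (f : symseq 3 -> R) :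
  let K := live_mx A f in let M := potential_mx A f in
  0 \in live A ->
  (~ (exists a1 a2 : R, [/\ 0 < a1, 0 < a2 & mx22 M = antidiag_mx a1 a2]))
      \/ ((exists2 a1 : R, 0 < a1 & mx22 M = antidiag_mx a1 a1) /\
          (M 1 0 = M 2%:R 0 \/ M 0 1 = M 0 2%:R)) ->
  K 1 1 = 0 -> K 2%:R 2%:R = 0 -> 0 < K 1 2%:R -> 0 < K 2%:R 1 ->
  K 1 2%:R = K 2%:R 1 /\ (K 1 0 = K 2%:R 0 \/ K 0 1 = K 0 2%:R).
Proof.
move=> K M S0 HM k1 k2 k12 k21.
have S12 : (1 \in live A) && (2%:R \in live A).
  by move: k12; rewrite /K live_mx_gt0 => /and3P[-> ->].
have [S1 S2] := andP S12.
have KM i j : K i j = M i j.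
  rewrite /K mxE; have live_all i' : i' \in live A by case: (ord3_cases i') => ->.
  by rewrite !live_all.
have l1 : lift ord0 (0 : 'I_2) = 1 :> 'I_3 by exact: val_inj.
have l2 : lift ord0 (1 : 'I_2) = 2%:R :> 'I_3 by exact: val_inj.
have block i j : mx22 M i j = M (lift ord0 i) (lift ord0 j) by rewrite mxE.
rewrite !KM in k1 k2 k12 k21 *.
case: HM => [H|[[a1 a10 E] sym]].
  exfalso; apply: H; exists (M 1 2%:R), (M 2%:R 1); split=> //.
  apply/matrixP => i j; rewrite block [RHS]mxE.
  case: (ord2_cases i) => ->; case: (ord2_cases j) => ->; by rewrite ?l1 ?l2.
split=> //; have := block 0 1; have := block 1 0; rewrite l1 l2 => <- <-.
by rewrite E !mxE.
Qed.

Theorem corollary4p4 (R : realType) (A : 'M[bool]_3) (B : 'M[bool]_2)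
    (X : set (symseq 3)) (Y : set (symseq 2))
    (pi : symseq 3 -> symseq 2) (p : 'I_3 -> 'I_2) (f : symseq 3 -> R)
    (hXA : X = sft A) (hYB : Y = sft B)
    (hX : irreducible X) (hY : irreducible Y)
    (hB : Y = setT \/ B = golden_mx)
    (hpi : factor_map X Y pi) (hp : one_block X pi p)
    (hp1 : p 0 = 0) (hp2 : p 1 = 1) (hp3 : p 2%:R = 1)
    (hf : two_coordinates X f) :
  let g := relative_g X p f in
  let M := potential_mx A f in
  [/\ (* (i) *)
      almost_additive Y g <->
        exists ghat : symseq 2 -> R,
          [/\ borel_on Y ghat, exists_unique_measure (gibbs Y ghat) &
              log_asymptotic Y g ghat],
      weakly_almost_additive Y g ->
        exists ghat : symseq 2 -> R,
          [/\ borel_on Y ghat, log_asymptotic Y g ghat &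
              exists_unique_measure (weak_gibbs Y ghat)] &
      (* (ii) *)
      (~ (exists a1 a2 : R, [/\ 0 < a1, 0 < a2 & mx22 M = antidiag_mx a1 a2]))
      \/ ((exists2 a1 : R, 0 < a1 & mx22 M = antidiag_mx a1 a1) /\
          (M 1 0 = M 2%:R 0 \/ M 0 1 = M 0 2%:R)) ->
      (almost_additive Y g <->
        exists ghat : symseq 2 -> R,
          [/\ {within Y, continuous ghat},
              exists_unique_measure (gibbs Y ghat) &
              log_asymptotic Y g ghat]) /\
      (weakly_almost_additive Y g ->
        exists ghat : symseq 2 -> R,
          [/\ {within Y, continuous ghat}, log_asymptotic Y g ghat &
              exists_unique_measure (weak_gibbs Y ghat)])].
Proof.
move=> g M; subst X Y.
have [c [cK cS cB lift]] := chain_of_factor hX hB hpi hp hp1 hp2 hp3 hf.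
have [C C0 gw] := relative_g_bounds hf cK cS (letterE hp1 hp2 hp3).
have wpos y n : sft B y -> 0 < weight c (word y n) by case: cB => _ _ _ pos /pos.
have g0 n y : (0 < n)%N -> sft B y -> 0 < g n y.
  move=> n0 Yy; have [h _] := gw n y n0 (lift y Yy n).
  by rewrite -(pmulr_rgt0 _ C0); exact: lt_le_trans (wpos y n Yy) h.
have gK n y : (0 < n)%N -> sft B y -> `|ln (g n y) - log_weight c y n| <= `|ln C|.
  move=> n0 Yy; have [h1 h2] := gw n y n0 (lift y Yy n).
  have w0 := wpos y n Yy; have gn := g0 n y n0 Yy.
  have e1 : log_weight c y n <= ln C + ln (g n y).
    by rewrite -lnM ?posrE// ler_ln ?posrE ?mulr_gt0.
  have e2 : ln (g n y) <= ln C + log_weight c y n.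
    by rewrite -lnM ?posrE// ler_ln ?posrE ?mulr_gt0.
  by have := ler_norm (ln C); rewrite ler_norml; lra.
have gc : positive_continuous_seq (sft B) g.
  move=> n n0; split; last by move=> y; exact: g0.
  apply: continuous_subspaceT; apply: (@locally_constant_continuous _ _ _ n).
  by move=> y z; exact: relative_g_word.
have back ghat : exists_unique_measure (R := R) (gibbs (sft B) ghat) ->
    log_asymptotic (sft B) g ghat -> almost_additive (sft B) g.
  move=> [m gm _] asym; split=> //.
  exact: (gibbs_almost_additive cB gm g0 gK asym).
split.
- split=> [aa|[ghat [_ ug asym]]]; last exact: back ug asym.
  have [L [ug asym _]] := almost_additive_potential cB g0 gK aa.
  by exists (potential c L); split=> //; exact: measurable_potential.
- move=> wa; have [L [ug asym _]] := weakly_almost_additive_potential cB g0 gK wa.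
  by exists (potential c L); split=> //; exact: measurable_potential.
move=> HM.
have [L' limL'] : exists L' : R,
    ln (run_weight c n.+1) - ln (run_weight c n) @[n --> \oo] --> L'.
  apply: (return_ratio_cvg cB); rewrite cK; apply: regular_block HM.
  by rewrite -cS; exact: hc_0S.
split.
  split=> [aa|[ghat [_ ug asym]]]; last exact: back ug asym.
  have [L [ug asym uL]] := almost_additive_potential cB g0 gK aa.
  exists (potential c L); split=> //; apply: continuous_subspaceT.
  by apply: continuous_potential; rewrite -(uL L' limL').
move=> wa; have [L [ug asym uL]] := weakly_almost_additive_potential cB g0 gK wa.
exists (potential c L); split=> //; apply: continuous_subspaceT.
by apply: continuous_potential; rewrite -(uL L' limL').
Qed.
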